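(* Let $c\geq1$ be a non-integer real number, and set $\delta:=\frac{2}{c\cdot2^{c+8}}$. Suppose a Hardy field function $\alpha(x)$ of degree $c$ satisfies $\lim_{x\to+\infty}\frac{\alpha(x)}{x^l}\in\{0,+\infty\}$ for all $l\in\mathbb{N}$. Then, for every sufficiently large $M\in\mathbb{N}$ and every pair of sets $A,B\subseteq\{1,\dots,M\}$ satisfying $$|A|\cdot|B|\geq\frac{M^2}{M^{\delta}}=M^{2-\delta},$$ there exist distinct $x\in A$, $y\in B$ and $n\in\mathbb{N}$ such that $x+y=\lfloor\alpha(n)\rfloor$.
   Context: $\mathbb{N}=\{1,2,\dots\}$. Let $\mathcal{G}$ be the ring (under pointwise addition and multiplication) of germs at $+\infty$ of continuous real-valued functions defined on half-lines $(a,+\infty)$; two functions have the same germ if they agree for all sufficiently large $x$. A Hardy field is a subfield of $\mathcal{G}$ closed under differentiation (each element is eventually differentiable and its derivative's germ lies in the field). A Hardy field function is a function whose germ belongs to some Hardy field. Its degree is $\deg(\alpha):=\inf\{l\in\mathbb{R}:\lim_{x\to+\infty}|\alpha(x)|/x^l=0\}$. Functions and germs are not distinguished; when values $\alpha(n)$, $n\in\mathbb{N}$, appear, $\alpha$ denotes a fixed real-valued representative defined on $[1,+\infty)$. ''Sufficiently large $M$'' means $M\geq M_0$ with $M_0$ depending only on $\alpha$ (and $c$). *)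

(* Defs.v *)
From HB Require Import structures.
From mathcomp Require Import all_boot all_order all_algebra finmap.
From mathcomp Require Import all_classical all_reals all_analysis.

Set Implicit Arguments.
Unset Strict Implicit.
Unset Printing Implicit Defensive.

Import Order.TTheory GRing.Theory Num.Theory.
Import numFieldNormedType.Exports.

Local Open Scope classical_set_scope.
Local Open Scope ring_scope.

Definition same_germ {R : realType} (f g : R -> R) : Prop :=
  \forall x \near +oo, f x = g x.

(* A set of germs at +oo is encoded by the set [H] of all functions whose germ
   belongs to it, that is, a set of functions closed under [same_germ]; a
   function on a half-line is extended arbitrarily to a total function. The ring
   operations on [R -> R] are pointwise. *)
Record hardy_field {R : realType} (H : set (R -> R)) : Prop := HardyField {
  hardy_germ : forall f g, same_germ f g -> H f -> H g;
  hardy_continuous : forall f, H f ->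
    exists a : R, forall x, a < x -> {for x, continuous f};
  hardy1 : H 1;
  hardyB : forall f g, H f -> H g -> H (f - g);
  hardyM : forall f g, H f -> H g -> H (f * g);
  hardyV : forall f, H f -> ~ same_germ f 0 ->
    exists2 g, H g & same_germ (f * g) 1;
  (* [derive1] is total: the first conjunct makes [derive1 f] the genuine derivative
     near +oo, which determines its germ. *)
  hardy_derive : forall f, H f ->
    (\forall x \near +oo, derivable f x 1) /\ H (derive1 f) }.

Definition hardy_field_function {R : realType} (f : R -> R) : Prop :=
  exists2 H : set (R -> R), hardy_field H & H f.

Definition deg {R : realType} (f : R -> R) : \bar R :=
  ereal_inf [set l%:E | l in
    [set l : R | `|f x| / x `^ l @[x --> +oo] --> (0 : R)]].

Definition delta {R : realType} (c : R) : R := 2 / (c * 2 `^ (c + 8)).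

(* Main.v *)
Require Import Defs.
From HB Require Import structures.
From mathcomp Require Import all_boot all_order all_algebra finmap.
From mathcomp Require Import all_classical all_reals all_analysis.
From mathcomp Require Import complex zify ring lra.

(** Circle method.  Put [P = 2 M + 2], [Z ~ M ^ delta] and let [n] run over the
    range where [P / Z <= alpha n <= P], with the weights
    [w n = alpha (n + 1) - alpha n].  The trigonometric polynomial
      [2 (cos u - cos (pi / P)) * |sum_(m < 2 P) sin (m pi / (2 P)) e^(i m u)|^2],
    [u = 2 pi (t - 1/2) / P], has frequencies below [2 P], is positive only for
    [t] in [(0, 1)] modulo [P], and its mean value has the same order of magnitude
    as its other coefficients.  Summing it over [t = alpha n - x - y] and using
    Parseval for the indicators of [A] and [B], a solution exists as soon as
      [|sum_n w n e^(2 pi i k alpha n / P)| <= C P / Z] for [1 <= k < 2 P].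
    For [k Z^7 <= N] (with [N] the largest [n]) this sum telescopes up to a small
    error.  For larger [k] van der Corput's inequality is iterated with
    heights [Z^(8 * 2^i)], the number [q] of iterations being the least one with
    [k Z^(7 + 8 (2^(q+1) - 2)) <= N^(q+1)], and the differenced sums are bounded
    by the Kusmin-Landau inequality.  The required bounds
    [alpha^(j) x ~ c (c - 1) .. (c - j + 1) alpha x / x^j] come from the fact
    that elements of a Hardy field are eventually monotone, applied to the
    derivative of [f / f'] for [f = alpha, alpha', ...]. *)

Set Implicit Arguments.
Unset Strict Implicit.
Unset Printing Implicit Defensive.

Import Order.TTheory GRing.Theory Num.Theory.
Import numFieldNormedType.Exports.
Import ComplexField.

Local Open Scope classical_set_scope.
Local Open Scope ring_scope.

(** The weights turn [sum_n w n e^(2 pi i k alpha n / P)] into a Riemann sum of a character over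
    almost a full period, so it is small already for [k = 1]; equal weights would in general leave a
    main term at small [k]. The modulus [P = 2 M + 2] is so large that [alpha n - x - y - 1/2] never
    comes within 1/2 of a nonzero multiple of [P], hence detection modulo [P] is detection in the
    integers. Since [A] and [B] may overlap, distinctness of [x] and [y] is secured beforehand by
    passing to disjoint subsets of about half the size. Non-integrality of [c] keeps every
    [c (c - 1) .. (c - j + 1)] nonzero, so that each derivative has its exact order of magnitude.
    The shape of [delta] comes from the iteration. Each differencing step squares the sum, so the
    powers of [Z] double; frequencies reach about [N^c], so [floor c + 1] steps are the most that is
    needed, and the total power of [Z] stays below [2^(floor c + 5)]. This must be a small power of
    [N], which is roughly [M^(1/c)]: hence the factor [c 2^c] in the denominator. *)

Section Cis.
Context {R : realType}.
Implicit Types (x y : R) (z w : R[i]).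

Lemma normc_ge0 z : 0 <= Normc.normc z.
Proof. by case: z => a b; exact: sqrtr_ge0. Qed.

Lemma sqr_normc z : Normc.normc z ^+ 2 = complex.Re z ^+ 2 + complex.Im z ^+ 2.
Proof. by case: z => a b /=; rewrite sqr_sqrtr // addr_ge0 ?sqr_ge0. Qed.

Lemma sqr_normcE z : Normc.normc z ^+ 2 = complex.Re (z * conjc z).
Proof. by rewrite sqr_normc; case: z => a b /=; ring. Qed.

Lemma normc_conj z : Normc.normc (conjc z) = Normc.normc z.
Proof. by case: z => a b /=; rewrite sqrrN. Qed.

Lemma normc_real (a : R) : Normc.normc (a%:C)%C = `|a|.
Proof. by rewrite /= expr0n /= addr0 sqrtr_sqr. Qed.

Lemma normc_nat (n : nat) : Normc.normc (n%:R : R[i]) = n%:R.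
Proof.
have -> : n%:R = (n%:R%:C)%C :> R[i] by rewrite rmorph_nat.
by rewrite normc_real ger0_norm.
Qed.

Lemma Re_le_normc z : complex.Re z <= Normc.normc z.
Proof.
case: z => a b /=; apply: le_trans (ler_norm a) _.
by rewrite -sqrtr_sqr ler_wsqrtr // lerDl sqr_ge0.
Qed.

Lemma ler_normc_sum (I : Type) (r : seq I) (P : pred I) (F : I -> R[i]) :
  Normc.normc (\sum_(i <- r | P i) F i) <= \sum_(i <- r | P i) Normc.normc (F i).
Proof.
elim/big_rec2: _ => [|i y z Pi le_zy]; first by rewrite Normc.normc0.
by apply: le_trans (le_normcD _ _) _; rewrite lerD2l.
Qed.

Definition cis x : R[i] := (cos x +i* sin x)%C.

Lemma cisD x y : cis (x + y) = cis x * cis y.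
Proof. by rewrite /cis cosD sinD; apply/eqP; rewrite eq_complex /=; apply/andP; split; apply/eqP; ring. Qed.

Lemma cis0 : cis 0 = 1.
Proof. by rewrite /cis cos0 sin0. Qed.

Lemma conj_cis x : conjc (cis x) = cis (- x).
Proof. by rewrite /cis cosN sinN. Qed.

Lemma normc_cis x : Normc.normc (cis x) = 1.
Proof. by rewrite /= cos2Dsin2 sqrtr1. Qed.

Lemma cisX x n : cis x ^+ n = cis (x *+ n).
Proof. by elim: n => [|n IH]; rewrite ?expr0 ?mulr0n ?cis0 // exprS IH mulrS cisD. Qed.

Lemma cis_mul_conj x : cis x * conjc (cis x) = 1.
Proof. by rewrite conj_cis -cisD subrr cis0. Qed.

Lemma cauchy_schwarz (I : Type) (r : seq I) (a b : I -> R) :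
  (\sum_(i <- r) a i * b i) ^+ 2 <= (\sum_(i <- r) a i ^+ 2) * (\sum_(i <- r) b i ^+ 2).
Proof.
rewrite -subr_ge0 -(pmulr_rge0 _ (@ltr0Sn R 1)).
suff -> : 2 * ((\sum_(i <- r) a i ^+ 2) * (\sum_(i <- r) b i ^+ 2) - (\sum_(i <- r) a i * b i) ^+ 2) =
   \sum_(i <- r) \sum_(j <- r) (a i * b j - a j * b i) ^+ 2.
  by apply: sumr_ge0 => i _; apply: sumr_ge0 => j _; apply: sqr_ge0.
have E i : \sum_(j <- r) (a i * b j - a j * b i) ^+ 2 = a i ^+ 2 * (\sum_(j <- r) b j ^+ 2)
    + b i ^+ 2 * (\sum_(j <- r) a j ^+ 2) - 2 * (a i * b i) * (\sum_(j <- r) a j * b j).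
  by rewrite !mulr_sumr -big_split -sumrB; apply: eq_bigr => j _ /=; ring.
under [RHS]eq_bigr do rewrite E.
rewrite sumrB big_split /= -!mulr_suml -mulr_sumr. ring.
Qed.

Lemma sqr_sum_le (I : Type) (r : seq I) (a : I -> R) :
  (\sum_(i <- r) a i) ^+ 2 <= (size r)%:R * \sum_(i <- r) a i ^+ 2.
Proof.
have := cauchy_schwarz r (fun=> 1) a.
under eq_bigr do rewrite mul1r.
by rewrite expr1n big_const_seq count_predT iter_addr_0.
Qed.

End Cis.

(** * The van der Corput inequality and the Kusmin-Landau inequality *)

Section VanDerCorput.
Context {R : realType}.
Implicit Types (f : nat -> R) (z y : nat -> R[i]) (N L H q d h : nat).
Local Notation normc := Normc.normc.

Lemma sum_window (V : zmodType) (y : nat -> V) a b m n :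
  (a <= m)%N -> (n <= b)%N -> (m <= n)%N ->
  (forall i, ~~ (m <= i < n)%N -> y i = 0) ->
  \sum_(a <= i < b) y i = \sum_(m <= i < n) y i.
Proof.
move=> am nb mn y0; rewrite (big_cat_nat (n := m)) //=; last by lia.
rewrite [X in _ + X](big_cat_nat (n := n)) //= big1_seq ?add0r; last first.
  by move=> i; rewrite mem_index_iota => /andP[_ ?]; apply: y0; lia.
rewrite [X in _ + X]big1_seq ?addr0 // => i.
by rewrite mem_index_iota => /andP[_ ?]; apply: y0; lia.
Qed.

(** After the shift by [h'] only the overlap of the support [[H, H + L)] with its translate by
    [d = h - h'] contributes, and [h < H] keeps that overlap inside the range of summation.
    Subtraction is truncated, so for [d >= L] both sides vanish. *)
Lemma vdc_correlation y L H h h' :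
  (h' <= h < H)%N -> (forall i, ~~ (H <= i < H + L)%N -> y i = 0) ->
  \sum_(0 <= m < L + H) y (m + h)%N * conjc (y (m + h')%N) =
  \sum_(0 <= n < L - (h - h')) y (H + n + (h - h'))%N * conjc (y (H + n)%N).
Proof.
move=> /andP[h'h hH] y0; set d := (h - h')%N.
pose v i := y (i + d)%N * conjc (y i).
have v0 i : ~~ (H <= i < H + (L - d))%N -> v i = 0.
  move=> iN; rewrite /v; case: (boolP (H <= i < H + L)%N) => [?|/y0 ->]; last by rewrite conjc0 mulr0.
  by rewrite y0 ?mul0r //; lia.
transitivity (\sum_(0 <= m < L + H) v (m + h')%N).
  by apply: eq_bigr => m _; rewrite /v; do 2 f_equal; lia.
rewrite -[X in index_iota _ X](addnK h') -(big_addn 0 (L + H + h') h' xpredT v) add0n.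
rewrite (sum_window (y := v) (m := H) (n := H + (L - d))) //; try lia.
rewrite -{1}[H]add0n big_addn (_ : H + (L - d) - H = L - d)%N; last by lia.
by apply: eq_bigr => n _; rewrite /v [(n + H)%N]addnC.
Qed.

(** With truncated subtraction [h - h' + (h' - h)] is the distance of [h] and [h']; the distance 0
    occurs once and every other one at most twice. *)
Lemma sum_dist_le (T : nat -> R) h H : (h < H)%N -> (forall d, 0 <= T d) ->
  \sum_(0 <= h' < H) T (h - h' + (h' - h))%N <= T 0%N + 2 * \sum_(1 <= d < H) T d.
Proof.
move=> hH T0; rewrite (big_cat_nat (n := h.+1)) //= mulr_natl mulr2n addrA.
apply: lerD.
  rewrite big_nat_rev /= add0n.
  rewrite (eq_big_nat _ _ (F2 := T)) => [|i /andP[_ ih]]; last by congr T; lia.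
  rewrite big_ltn // lerD2l.
  by rewrite [leRHS](big_cat_nat (n := h.+1)) //= lerDl sumr_ge0.
rewrite -{1}[h.+1]add1n big_addn.
rewrite (eq_big_nat _ _ (F2 := T)) => [|i /andP[_ ih]]; last by congr T; lia.
by rewrite [leRHS](big_cat_nat (n := (H - h)%N)) /= ?lerDl ?sumr_ge0 //; lia.
Qed.

(** [H] times the sum is the sum over [L + H] windows of length [H]. Cauchy-Schwarz over the windows
    and opening the square leave the correlations of the phases at distances below [H]. *)
Lemma van_der_corput f L H : (0 < H)%N ->
  H%:R * normc (\sum_(0 <= n < L) cis (f n)) ^+ 2 <=
  (L + H)%:R * (L%:R + 2 * \sum_(1 <= d < H)
     normc (\sum_(0 <= n < L - d) cis (f (n + d)%N - f n))).
Proof.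
move=> H0; set S := \sum_(0 <= n < L) _.
(* Padding with [H] zeros in front lets every shift by [h < H] of the range [[0, L + H)] see the
   whole sum. *)
pose y i := if (H <= i < H + L)%N then cis (f (i - H)%N) else 0.
pose T d := normc (\sum_(0 <= n < L - d) cis (f (n + d)%N - f n)).
have y0 i : ~~ (H <= i < H + L)%N -> y i = 0 by rewrite /y => /negbTE ->.
have Sy h : (h < H)%N -> \sum_(0 <= m < L + H) y (m + h)%N = S.
  move=> hH; rewrite -[X in index_iota _ X](addnK h) -(big_addn 0 (L + H + h) h xpredT y) add0n.
  rewrite (sum_window (y := y) (m := H) (n := H + L)) //; try lia.
  rewrite -{1}[H]add0n big_addn addKn; apply: eq_big_nat => n /andP[_ nL].
  by rewrite /y addnK (_ : (H <= _ < _)%N = true) //; lia.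
pose V m := \sum_(0 <= h < H) y (m + h)%N.
have VS : \sum_(0 <= m < L + H) V m = H%:R * S.
  rewrite /V exchange_big_nat /= (eq_big_nat _ _ (F2 := fun=> S)); last by move=> h /andP[_ hH]; rewrite -(Sy h hH).
  by rewrite big_const_nat iter_addr_0 subn0 mulr_natl.
have corr h h' : (h < H)%N -> (h' < H)%N ->
    normc (\sum_(0 <= m < L + H) y (m + h)%N * conjc (y (m + h')%N)) = T (h - h' + (h' - h))%N.
  have main a b : (b <= a < H)%N ->
      normc (\sum_(0 <= m < L + H) y (m + a)%N * conjc (y (m + b)%N)) = T (a - b + (b - a))%N.
    move=> ba; rewrite (vdc_correlation ba y0) /T (_ : (a - b + (b - a))%N = (a - b)%N); last by lia.
    congr normc; apply: eq_big_nat => n /andP[_ nL].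
    rewrite /y !ifT; try lia.
    by rewrite conj_cis -cisD -addnA !addKn.
  move=> hH h'H; case: (leqP h' h) => hh; first by apply: main; rewrite hh.
  rewrite -normc_conj rmorph_sum /=.
  under eq_bigr do rewrite rmorphM /= conjcK mulrC.
  by rewrite main ?[((h' - h) + _)%N]addnC //; lia.
have T0 d : 0 <= T d by exact: normc_ge0.
have VT : \sum_(0 <= m < L + H) normc (V m) ^+ 2 <= H%:R * (L%:R + 2 * \sum_(1 <= d < H) T d).
  have -> : \sum_(0 <= m < L + H) normc (V m) ^+ 2 = complex.Re
     (\sum_(0 <= h < H) \sum_(0 <= h' < H) \sum_(0 <= m < L + H) y (m + h)%N * conjc (y (m + h')%N)).
    under [in RHS]eq_bigr do rewrite exchange_big_nat /=.
    rewrite exchange_big_nat /= raddf_sum; apply: eq_bigr => m _.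
    rewrite sqr_normcE /V rmorph_sum mulr_suml; congr complex.Re.
    by apply: eq_bigr => h _; rewrite mulr_sumr.
  apply: le_trans (Re_le_normc _) _; apply: le_trans (ler_normc_sum _ _ _) _.
  set X := L%:R + _; have <- : \sum_(0 <= h < H) X = H%:R * X.
    by rewrite sumr_const_nat subn0 mulr_natl.
  apply: ler_sum_nat => h /andP[_ hH].
  apply: le_trans (ler_normc_sum _ _ _) _.
  rewrite (eq_big_nat _ _ (F2 := fun h' => T (h - h' + (h' - h))%N)); last first.
    by move=> h' /andP[_ ?]; rewrite corr.
  apply: le_trans (sum_dist_le hH T0) _; rewrite /X lerD2r /T.
  under eq_bigr do rewrite addn0 subrr cis0.
  by rewrite big_const_nat iter_addr_0 !subn0 normc_nat.
have : (H%:R * normc S) ^+ 2 <= (L + H)%:R * (H%:R * (L%:R + 2 * \sum_(1 <= d < H) T d)).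
  have -> : H%:R * normc S = normc (\sum_(0 <= m < L + H) V m).
    by rewrite VS Normc.normcM normc_nat.
  apply: le_trans (_ : _ <= (\sum_(0 <= m < L + H) normc (V m)) ^+ 2) _.
    by rewrite lerXn2r ?nnegrE ?normc_ge0 ?sumr_ge0 // ?ler_normc_sum // => *; exact: normc_ge0.
  apply: le_trans (sqr_sum_le _ _) _.
  by rewrite size_iota subn0 ler_wpM2l.
rewrite exprMn expr2 -mulrA [X in _ <= X -> _]mulrCA ler_pM2l ?ltr0n //.
Qed.

End VanDerCorput.

(** * Iterated forward differences *)

Section Differences.
Context {R : realType}.
Implicit Types (f : nat -> R) (n h q : nat).

Definition fdiff f n : R := f n.+1 - f n.

(** This transports hypotheses through a van der Corput step: bounds and monotonicity of the
    difference of order [q + 1] of [f] become those of order [q] of the differenced phase, with the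
    bounds multiplied by [h]. *)
Lemma fdiff_iter_shift q f h n :
  iter q fdiff (fun n => f (n + h)%N - f n) n = \sum_(0 <= j < h) iter q.+1 fdiff f (n + j)%N.
Proof.
elim: q n => [|q IH] n.
  rewrite /= /fdiff (eq_bigr (fun j => (fun j => f (n + j)%N) j.+1 - (fun j => f (n + j)%N) j)); last first.
    by move=> j _; rewrite addnS.
  by rewrite telescope_sumr // addn0.
rewrite iterS {1}/fdiff !IH -sumrB; apply: eq_bigr => j _.
by rewrite [in RHS]iterS /fdiff addSn.
Qed.

End Differences.

(** * Sums with monotone phase increments *)

Section KusminLandau.
Context {R : realType}.
Implicit Types (f : nat -> R) (x lam eps : R) (n L : nat).
Local Notation normc := Normc.normc.

Lemma mean_value (g dg : R -> R) a b : a < b ->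
  (forall x, a <= x <= b -> is_derive x 1 g (dg x)) ->
  exists2 x, a < x < b & g b - g a = dg x * (b - a).
Proof.
move=> ab dgP; have [x||x] := @MVT R g dg a b ab.
- by rewrite in_itv /= => /andP[? ?]; apply: dgP; rewrite !ltW.
- apply: derivable_within_continuous => x; rewrite in_itv /= => xab.
  by have [] := dgP x xab.
- by rewrite in_itv /= => xab ->; exists x.
Qed.

Lemma norm_sin_le x : 0 <= x -> `|sin x| <= x.
Proof.
rewrite le_eqVlt => /predU1P[<-|x0]; first by rewrite sin0 normr0.
have [y _] := mean_value x0 (fun y _ => is_derive_sin y).
rewrite sin0 !subr0 => ->; rewrite normrM (gtr0_norm x0) ler_piMl ?(ltW x0) //.
by rewrite ler_norml cos_geN1 cos_le1.
Qed.

Lemma cos_ge_quad x : 0 <= x -> 1 - x ^+ 2 / 2 <= cos x.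
Proof.
move=> x0; have sx : sin (x / 2) ^+ 2 <= (x / 2) ^+ 2.
  by rewrite -(real_normK (num_real (sin _))) lerXn2r ?nnegrE // ?norm_sin_le; lra.
have -> : cos x = cos ((x / 2) *+ 2) by congr cos; rewrite -mulr_natr mulfVK.
by rewrite cos_mulr2n cos2sin2; lra.
Qed.

Lemma sin_ge_half x : 0 <= x <= 1 -> x / 2 <= sin x.
Proof.
move=> /andP[]; rewrite le_eqVlt => /predU1P[<-|x0 x1]; first by rewrite sin0 mul0r.
have [y] := mean_value x0 (fun y _ => is_derive_sin y).
rewrite sin0 !subr0 => /andP[y0 yx] ->.
have := cos_ge_quad (ltW y0); have : y ^+ 2 <= 1 by rewrite expr_le1 ?ltW // (lt_le_trans yx).
by move=> *; nra.
Qed.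

Lemma sum_by_parts (z r : nat -> R[i]) L :
  \sum_(0 <= n < L.+1) (z n.+1 - z n) * r n =
  z L.+1 * r L - z 0%N * r 0%N - \sum_(0 <= n < L) z n.+1 * (r n.+1 - r n).
Proof.
elim: L => [|L IH]; first by rewrite big_nat1 big_geq // subr0 mulrBl.
by rewrite big_nat_recr //= IH [in RHS]big_nat_recr //=; ring.
Qed.

(** Each term is a difference of consecutive terms times [r n = 1 / (e^(i theta) - 1)], where
    [theta = fdiff f n] is in radians and stays in [[lam, 1]]. Partial summation then needs only the
    size of [r], at most [5 / (2 lam)] at each end, and its variation, at most [2 / lam] because
    [theta] is monotone ([eps] gives the direction): in all [7 / lam]. *)
Lemma kusmin_landau f L lam eps : 0 < lam -> (eps = 1 \/ eps = -1) ->
  (forall n, (n < L)%N -> lam <= fdiff f n <= 1) ->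
  (forall n, (n.+1 < L)%N -> 0 <= eps * (fdiff f n.+1 - fdiff f n)) ->
  normc (\sum_(0 <= n < L) cis (f n)) <= 7 / lam.
Proof.
case: L => [|L] lam0 epsE fL fM.
  by rewrite big_geq // Normc.normc0 divr_ge0 // ltW.
pose s n := sin (fdiff f n / 2); pose c n := cos (fdiff f n / 2).
pose t n := c n / s n.
(* With [t = cot (theta / 2)] this is [1 / (e^(i theta) - 1)], written out in real and imaginary
   part. *)
pose r n : R[i] := (- (1 / 2) +i* (- (t n / 2)))%C.
have lam1 : lam <= 1 by have /andP[? ?] := fL 0%N isT; lra.
have s_ge n : (n <= L)%N -> lam / 4 <= s n.
  move=> nL; have /andP[d1 d2] := fL n nL.
  by apply: le_trans (sin_ge_half _); lra.
have s_gt0 n : (n <= L)%N -> 0 < s n by move=> /s_ge; lra.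
have c_ge n : (n <= L)%N -> 0 <= c n.
  move=> nL; have /andP[d1 d2] := fL n nL.
  have d0 : 0 <= fdiff f n / 2 by lra.
  have d3 : (fdiff f n / 2) ^+ 2 <= 1 by rewrite expr_le1 //; lra.
  by have := cos_ge_quad d0; rewrite -/(c n); lra.
have t_ge n : (n <= L)%N -> 0 <= t n by move=> nL; rewrite divr_ge0 ?c_ge // ltW // s_gt0.
have t_le n : (n <= L)%N -> t n <= 4 / lam.
  move=> nL; rewrite ler_pdivrMr ?s_gt0 // mulrAC ler_pdivlMr //.
  have cl : c n * lam <= lam by rewrite ler_piMl ?cos_le1 // ltW.
  by have := s_ge n nL; lra.
have zr n : (n <= L)%N -> cis (f n) = (cis (f n.+1) - cis (f n)) * r n.
  move=> nL; have -> : f n.+1 = f n + fdiff f n / 2 + fdiff f n / 2 by rewrite /fdiff; lra.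
  rewrite !cisD -[X in _ - X]mulr1 -mulrA -mulrBr -[LHS]mulr1 -mulrA; congr (_ * _).
  have s0 : s n != 0 by rewrite gt_eqF // s_gt0.
  have := cos2Dsin2 (fdiff f n / 2); rewrite /r /cis -/(c n) -/(s n) => cs.
  apply/eqP; rewrite eq_complex /= /t; apply/andP; split; apply/eqP.
    transitivity ((c n ^+ 2 + s n ^+ 2 + 1) / 2); last by field.
    by rewrite cs; field.
  transitivity ((1 - (c n ^+ 2 + s n ^+ 2)) * (c n / s n) / 2); last by field.
  by rewrite cs; field.
have r_le n : (n <= L)%N -> normc (r n) <= 5 / 2 / lam.
  move=> nL.
  have -> : r n = ((- (1 / 2))%:C + 'i * (- (t n / 2))%:C)%C.
    by rewrite /r; simpc.
  apply: le_trans (le_normcD _ _) _.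
  rewrite Normc.normcM !normc_real /= expr0n expr1n add0r sqrtr1 mul1r !normrN.
  rewrite !ger0_norm ?(divr_ge0 (t_ge n nL)) //.
  have : 1 / 2 <= 1 / 2 / lam by rewrite ler_peMr ?invf_ge1.
  by have := t_le n nL; lra.
(* From [cot a - cot b = sin (b - a) / (sin a sin b)]. *)
have t_mono n : (n < L)%N -> 0 <= eps * (t n - t n.+1).
  move=> nL; pose w := (fdiff f n.+1 - fdiff f n) / 2.
  have -> : t n - t n.+1 = sin w / (s n * s n.+1).
    rewrite /t /w mulrBl sinB -/(c n) -/(s n) -/(c n.+1) -/(s n.+1); field.
    by rewrite !gt_eqF ?s_gt0 // ltnW.
  have := fM n nL; have /andP[? ?] := fL n (ltnW nL); have /andP[? ?] := fL n.+1 nL.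
  move=> ew; rewrite mulrA divr_ge0 //; last by rewrite mulr_ge0 // ltW // s_gt0 // ltnW.
  case: epsE => eE; rewrite eE in ew *; rewrite ?mulN1r ?mul1r -?sinN.
    by apply: le_trans (sin_ge_half _); rewrite /w; lra.
  by apply: le_trans (sin_ge_half _); rewrite /w; lra.
have dr_sum : \sum_(0 <= n < L) normc (r n.+1 - r n) <= 2 / lam.
  rewrite (eq_big_nat _ _ (F2 := fun n => eps / 2 * (t n - t n.+1))); last first.
    move=> n /andP[_ nL]; have := t_mono n nL; have -> : r n.+1 - r n = ('i * ((t n - t n.+1) / 2)%:C)%C.
      by apply/eqP; rewrite /r eq_complex /=; apply/andP; split; apply/eqP; field.
    rewrite Normc.normcM normc_real /= expr0n expr1n add0r sqrtr1 mul1r.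
    rewrite normrM (@ger0_norm _ (2^-1)); last by lra.
    case: epsE => ->; rewrite ?mul1r ?mulN1r => tn; first by rewrite ger0_norm //; lra.
    by rewrite ler0_norm; lra.
  rewrite -mulr_sumr.
  have -> : \sum_(0 <= n < L) (t n - t n.+1) = t 0%N - t L.
    rewrite -[RHS]opprB -(telescope_sumr t (leq0n L)) -sumrN.
    by apply: eq_bigr => n _; rewrite opprB.
  have := t_le 0%N isT; have := t_le L (leqnn _); have := t_ge 0%N isT; have := t_ge L (leqnn _).
  by case: epsE => ->; lra.
rewrite (eq_big_nat _ _ (F2 := fun n => (cis (f n.+1) - cis (f n)) * r n)); last first.
  by move=> n /andP[_ nL]; exact: zr.
rewrite (sum_by_parts (fun n => cis (f n))).
apply: le_trans (le_normcD _ _) _; rewrite normcN.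
have -> : 7 / lam = (5 / 2 / lam + 5 / 2 / lam) + 2 / lam by field; rewrite gt_eqF.
apply: lerD.
  apply: le_trans (le_normcD _ _) _; rewrite normcN !Normc.normcM !normc_cis !mul1r.
  by rewrite lerD // r_le.
apply: le_trans (ler_normc_sum _ _ _) _; apply: le_trans dr_sum; apply: ler_sum => n _.
by rewrite Normc.normcM normc_cis mul1r.
Qed.

End KusminLandau.

(** * Repeated differencing with free heights *)

Section IteratedVanDerCorput.
Context {R : realType}.
Implicit Types (f : nat -> R) (x lam Lam eps Z : R) (n N L H q m : nat).
Local Notation normc := Normc.normc.

Definition harm H : R := \sum_(1 <= h < H) h%:R^-1.

Lemma harm_ge0 H : 0 <= harm H.
Proof. by apply: sumr_ge0 => i _; rewrite invr_ge0. Qed.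

Lemma exprD_le_pow2 (x y : R) m : 0 <= x -> 0 <= y ->
  (x + y) ^+ m <= 2 ^+ m * (x ^+ m + y ^+ m).
Proof.
move=> x0 y0; have main (a b : R) : 0 <= a -> a <= b -> (a + b) ^+ m <= 2 ^+ m * (a ^+ m + b ^+ m).
  move=> a0 ab; have b0 := le_trans a0 ab.
  apply: (@le_trans _ _ ((2 * b) ^+ m)); first by rewrite lerXn2r ?nnegrE ?addr_ge0 ?mulr_ge0 //; lra.
  by rewrite exprMn ler_wpM2l ?exprn_ge0 // lerDr exprn_ge0.
case: (leP x y) => [|/ltW] xy; first exact: main.
by rewrite addrC [X in _ * X]addrC; exact: main.
Qed.

(** Cauchy-Schwarz [q] times. There are [H - 1] terms, and dividing by [H] instead only helps. *)
Lemma power_mean_pow2 (x : nat -> R) H q : (0 < H)%N -> (forall i, 0 <= x i) ->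
  ((\sum_(1 <= i < H) x i) / H%:R) ^+ (2 ^ q) <= (\sum_(1 <= i < H) x i ^+ (2 ^ q)) / H%:R.
Proof.
move=> H0 x0; elim: q => [|q IH]; first by under [in leRHS]eq_bigr do rewrite expr1.
rewrite expnS mulnC exprM.
apply: (@le_trans _ _ (((\sum_(1 <= i < H) x i ^+ (2 ^ q)) / H%:R) ^+ 2)).
  by rewrite lerXn2r ?nnegrE ?exprn_ge0 ?divr_ge0 ?sumr_ge0 // => i _; rewrite exprn_ge0.
rewrite expr_div_n ler_pdivrMr ?exprn_gt0 ?ltr0n // expr2 mulrA mulfVK ?gt_eqF ?ltr0n // mulrC.
apply: le_trans (sqr_sum_le _ _) _; rewrite size_iota.
under [in leRHS]eq_bigr do rewrite exprM.
by rewrite [leRHS]mulrC ler_wpM2r ?sumr_ge0 ?ler_nat ?leq_subr // => i _; rewrite sqr_ge0.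
Qed.

(** One step with height [H = Hs 0] bounds the squared mean by [1 / H] plus the average of the
    differenced sums. To the sum at distance [d] the induction hypothesis applies with [d lam],
    [d Lam], [Z^2] and the remaining heights; averaging [1 / (d lam)] over [d < H] produces the
    factor [harm H / H]. The condition [Lam * prod Hs <= 1] survives because [d <= H], and at the
    bottom it keeps the increments in the range of [kusmin_landau]. Normalising by the fixed [N]
    rather than by [L] lets the length shrink freely. *)
Lemma iterated_van_der_corput q : exists2 C : R, 0 < C &
  forall (Hs : nat -> nat) Z lam Lam eps N L f, 1 <= Z -> (0 < N)%N -> (L <= N)%N -> 0 < lam ->
    (eps = 1 \/ eps = -1) ->
    (forall i, (i < q)%N -> (0 < Hs i <= N)%N /\ Z ^+ (2 ^ i.+1) <= (Hs i)%:R) ->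
    Lam * \prod_(0 <= i < q) (Hs i)%:R <= 1 ->
    (forall n, (n < L)%N -> lam <= iter q.+1 fdiff f n <= Lam) ->
    (forall n, (n.+1 < L)%N -> 0 <= eps * (iter q.+1 fdiff f n.+1 - iter q.+1 fdiff f n)) ->
    (normc (\sum_(0 <= n < L) cis (f n)) / N%:R) ^+ (2 ^ q) <=
    C * ((Z ^+ (2 ^ q))^-1 + (N%:R * lam)^-1 * \prod_(0 <= i < q) (harm (Hs i) / (Hs i)%:R)).
Proof.
elim: q => [|q [C C0 IH]].
  exists 7 => // Hs Z lam Lam eps N L f Z1 N0 LN lam0 epsE _.
  rewrite big_geq // mulr1 => Lam1 fL fM.
  rewrite expn0 !expr1 big_geq // mulr1.
  have N0' : 0 < N%:R :> R by rewrite ltr0n.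
  have Z0 : 0 < Z by lra.
  rewrite ler_pdivrMr //; apply: le_trans (kusmin_landau lam0 epsE _ fM) _.
    by move=> n /fL/andP[-> /le_trans]; apply.
  rewrite -mulrA ler_wpM2l // mulrDl invfM mulrAC mulVf ?gt_eqF // mul1r lerDr.
  by rewrite mulr_ge0 ?invr_ge0 // ltW.
(* [8 = 4 * 2]: the 4 is the constant of a single step ([S2] below), the 2 is the loss in
   [exprD_le_pow2]. The summand 1 pays for [H^-m], and [C] for the averaged induction hypothesis. *)
pose m := (2 ^ q)%N; exists (8 ^+ m * (1 + C)); first by rewrite mulr_gt0 ?exprn_gt0 //; lra.
move=> Hs Z lam Lam eps N L f Z1 N0 LN lam0 epsE HsP LamP fL fM.
have N0' : 0 < N%:R :> R by rewrite ltr0n.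
have [/andP[H0 HN] HZ] := HsP 0%N isT; set H := Hs 0%N in H0 HN HZ.
have H0' : 0 < H%:R :> R by rewrite ltr0n.
pose g d n := f (n + d)%N - f n.
pose s d := normc (\sum_(0 <= n < L - d) cis (g d n)) / N%:R.
have s0 d : 0 <= s d by rewrite divr_ge0 ?normc_ge0.
pose P' := \prod_(0 <= i < q) (harm (Hs i.+1) / (Hs i.+1)%:R).
have P'0 : 0 <= P' by apply: prodr_ge0 => i _; rewrite divr_ge0 ?harm_ge0.
have Z0 : 0 < Z by lra.
have sIH d : (1 <= d < H)%N ->
    s d ^+ m <= C * ((Z ^+ (2 ^ q.+1))^-1 + (N%:R * lam)^-1 * P' * d%:R^-1).
  move=> /andP[d1 dH]; have d0 : 0 < d%:R :> R by rewrite ltr0n.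
  have -> : (Z ^+ (2 ^ q.+1)) = (Z ^+ 2) ^+ (2 ^ q) by rewrite -exprM -expnS.
  have -> : (N%:R * lam)^-1 * P' * d%:R^-1 = (N%:R * (d%:R * lam))^-1 * P'.
    by field; rewrite !gt_eqF.
  apply: (IH (fun i => Hs i.+1) _ _ (d%:R * Lam) eps).
  - by rewrite expr_ge1 // ltW.
  - by [].
  - by apply: leq_trans LN; exact: leq_subr.
  - by rewrite mulr_gt0.
  - by [].
  - by move=> i iq; have [? ?] := HsP i.+1 iq; rewrite -exprM -expnS.
  (* [Lam <= 0] can happen only for an empty sum, since [0 < lam]. *)
  - case: (leP Lam 0) => Lam0.
      apply: le_trans ler01; rewrite mulr_le0_ge0 ?prodr_ge0 //.
      by rewrite mulr_ge0_le0 // ltW.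
    apply: le_trans LamP; rewrite big_nat_recl // mulrA [X in _ <= X * _]mulrC.
    rewrite ler_wpM2r ?prodr_ge0 // ler_wpM2r ?(ltW Lam0) // ler_nat.
    exact: ltnW.
  - move=> n nL; rewrite fdiff_iter_shift.
    have -> : d%:R * lam = \sum_(0 <= j < d) lam by rewrite sumr_const_nat subn0 mulr_natl.
    have -> : d%:R * Lam = \sum_(0 <= j < d) Lam by rewrite sumr_const_nat subn0 mulr_natl.
    by apply/andP; split; apply: ler_sum_nat => j /andP[_ jd]; have /andP[] := fL (n + j)%N ltac:(move: nL jd; clear; lia).
  - move=> n nL; rewrite !fdiff_iter_shift -sumrB mulr_sumr big_seq.
    apply: sumr_ge0 => j; rewrite mem_index_iota => /andP[_ jd].
    by rewrite addSn; apply: fM; move: nL jd; clear; lia.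
pose a := (\sum_(1 <= d < H) s d) / H%:R.
have a0 : 0 <= a by rewrite divr_ge0 ?sumr_ge0.
have S2 : (normc (\sum_(0 <= n < L) cis (f n)) / N%:R) ^+ 2 <= 4 * (H%:R^-1 + a).
  have LN' : L%:R <= N%:R :> R by rewrite ler_nat.
  have LHN : (L + H)%:R <= 2 * N%:R :> R.
    by rewrite -natrM ler_nat mul2n -addnn leq_add.
  have -> : 4 * (H%:R^-1 + a) = (2 * N%:R) * (2 * N%:R + 2 * \sum_(1 <= d < H) N%:R * s d) / (H%:R * N%:R ^+ 2).
    by rewrite -mulr_sumr /a; field; rewrite !gt_eqF.
  set X := (2 * N%:R + 2 * _).
  rewrite expr_div_n ler_pdivrMr ?exprn_gt0 //.
  have -> : 2 * N%:R * X / (H%:R * N%:R ^+ 2) * N%:R ^+ 2 = 2 * N%:R * X / H%:R.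
    by field; rewrite !gt_eqF.
  rewrite ler_pdivlMr // mulrC /X {X}.
  apply: le_trans (van_der_corput _ _ H0) _.
  rewrite (eq_bigr (fun d => N%:R * s d)); last first.
    by move=> d _; rewrite /s mulrC mulfVK // gt_eqF.
  have sm : 0 <= \sum_(1 <= d < H) N%:R * s d by apply: sumr_ge0 => d _; rewrite mulr_ge0.
  apply: ler_pM; rewrite ?ler0n ?addr_ge0 ?mulr_ge0 //; lra.
rewrite expnS exprM; apply: (@le_trans _ _ ((4 * (H%:R^-1 + a)) ^+ m)).
  by rewrite lerXn2r ?nnegrE ?sqr_ge0 // mulr_ge0 ?addr_ge0 ?invr_ge0.
rewrite exprMn; apply: (@le_trans _ _ (4 ^+ m * (2 ^+ m * (H%:R^-1 ^+ m + a ^+ m)))).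
  by rewrite ler_wpM2l ?exprn_ge0 // exprD_le_pow2 // invr_ge0.
rewrite mulrA -exprMn -natrM -mulrA ler_wpM2l ?exprn_ge0 // mulrDl mul1r.
rewrite big_nat_recl // -/P' -/H.
apply: lerD.
  rewrite exprVn -expnS expnS exprM.
  have HZm : (Z ^+ 2) ^+ m <= H%:R ^+ m by rewrite lerXn2r ?nnegrE ?sqr_ge0 // ltW.
  have Zm : 0 < (Z ^+ 2) ^+ m by rewrite !exprn_gt0.
  rewrite -[leLHS]addr0 lerD // ?lef_pV2 ?posrE ?exprn_gt0 //.
  by rewrite !mulr_ge0 ?invr_ge0 ?mulr_ge0 ?harm_ge0 // ltW.
apply: le_trans (power_mean_pow2 _ H0 s0) _.
rewrite ler_pdivrMr //.
apply: (@le_trans _ _ (\sum_(1 <= d < H) C * ((Z ^+ (2 ^ q.+1))^-1 + (N%:R * lam)^-1 * P' * d%:R^-1))).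
  by apply: ler_sum_nat.
rewrite -mulr_sumr big_split /= -mulr_sumr -/(harm H) -[leRHS]mulrA ler_wpM2l ?(ltW C0) // mulrDl.
apply: lerD.
  by rewrite -expnS sumr_const_nat -[leLHS]mulr_natr ler_wpM2l ?ler_nat ?leq_subr // invr_ge0 exprn_ge0 ?ltW.
rewrite le_eqVlt; apply/orP; left; apply/eqP; field.
by rewrite !gt_eqF.
Qed.

End IteratedVanDerCorput.

(** * Detecting sums by a trigonometric polynomial *)

Section Minorant.
Context {R : realType}.
Implicit Types (x y u : R) (P m l k n : nat).
Local Notation normc := Normc.normc.

Lemma cis_2pi_nat n : cis (pi *+ 2 * n%:R : R) = 1.
Proof.
by rewrite mulr_natr -cisX /cis cos2pi -[pi *+ 2]add0r sinD2pi sin0 -[(_ +i* _)%C]/(1 : R[i]) expr1n.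
Qed.

(** A geometric sum over two full periods; two, because the detecting polynomial has frequencies up
    to [2 P]. Its ratio differs from 1, as [t / 2] lies strictly between 0 and [pi] in absolute
    value. *)
Lemma sum_cis_orthogonal P (a b : nat) : (0 < P)%N -> (a < P)%N -> (b < P)%N -> a != b ->
  \sum_(0 <= k < 2 * P) cis (pi *+ 2 / P%:R * k%:R * a%:R) *
     conjc (cis (pi *+ 2 / P%:R * k%:R * b%:R)) = 0 :> R[i].
Proof.
move=> P0 aP bP ab; have P0' : 0 < P%:R :> R by rewrite ltr0n.
pose t : R := pi *+ 2 / P%:R * (a%:R - b%:R).
rewrite (eq_bigr (fun k => cis t ^+ k)); last first.
  by move=> k _; rewrite conj_cis -cisD cisX /t -mulr_natr; congr cis; ring.
have tne : cis t != 1.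
  have [u [u0 uP ut]] : exists u : R, [/\ 0 < u, u < pi & sin (t / 2) ^+ 2 = sin u ^+ 2].
    wlog : a b aP bP ab @t / (b < a)%N.
      move=> H; case: (ltngtP a b) => [ba|ba|/eqP]; [|exact: H|by rewrite (negbTE ab)].
      rewrite eq_sym in ab; have [u [? ? E]] := H b a bP aP ab ba.
      exists u; split => //; rewrite -E -[LHS]sqrrN -sinN; congr (sin _ ^+ 2).
      by rewrite /t; field; rewrite gt_eqF.
    move=> ba; exists (t / 2); split => //.
      by rewrite !divr_gt0 // mulr_gt0 ?divr_gt0 ?subr_gt0 ?ltr_nat // pmulrn_lgt0 // pi_gt0.
    have -> : t / 2 = pi * ((a%:R - b%:R) / P%:R).
      by rewrite /t -mulr_natr; field; rewrite gt_eqF.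
    rewrite gtr_pMr ?pi_gt0 // ltr_pdivrMr // mul1r ltrBlDr -natrD ltr_nat; lia.
  have su : 0 < sin u by rewrite sin_gt0_pi // u0 uP.
  apply/eqP => /(congr1 (@complex.Re R)) /=.
  have -> : cos t = cos (t / 2 *+ 2) by congr cos; rewrite -mulr_natr mulfVK.
  rewrite cos_mulr2n cos2sin2 ut => E; have : 0 < sin u ^+ 2 by rewrite exprn_gt0.
  lra.
have := subrX1 (cis t) (2 * P).
have -> : cis t ^+ (2 * P) = 1.
  rewrite cisX /t (_ : _ *+ _ = pi *+ 2 * (2 * a)%:R - pi *+ 2 * (2 * b)%:R); last first.
    by rewrite -mulr_natr !natrM; field; rewrite gt_eqF.
  by rewrite cisD -conj_cis !cis_2pi_nat conjc1 mulr1.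
rewrite subrr big_mkord => /esym/eqP; rewrite mulf_eq0 subr_eq0 (negbTE tne) => /eqP ->.
by [].
Qed.

Lemma parseval P (s : seq nat) : (0 < P)%N -> uniq s -> (forall x : nat, x \in s -> (x < P)%N) ->
  \sum_(0 <= k < 2 * P) normc (\sum_(x <- s) cis (pi *+ 2 / P%:R * k%:R * x%:R)) ^+ 2
  = (2 * P * size s)%:R :> R.
Proof.
move=> P0 us sP.
pose z k (x : nat) : R[i] := cis (pi *+ 2 / P%:R * k%:R * x%:R).
rewrite (eq_bigr (fun k => complex.Re (\sum_(x <- s) \sum_(y <- s) (z k x : R[i]) * conjc (z k y)))); last first.
  move=> k _; rewrite sqr_normcE rmorph_sum mulr_suml; congr complex.Re.
  by apply: eq_bigr => x _; rewrite mulr_sumr.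
rewrite -raddf_sum exchange_big /=.
rewrite (eq_big_seq (fun=> (2 * P)%:R)); last first.
  move=> x xs; rewrite exchange_big /= (bigD1_seq x) //= [X in _ + X]big1_seq ?addr0.
    under eq_bigr do rewrite cis_mul_conj.
    by rewrite sumr_const_nat subn0.
  by move=> y /andP[yx ys]; apply: (sum_cis_orthogonal P0 (sP _ xs) (sP _ ys)); rewrite eq_sym.
by rewrite big_const_seq count_predT iter_addr_0 -mulrnA -[in LHS](rmorph_nat (real_complex R)).
Qed.

(** * A trigonometric polynomial that is positive only where [cos u > cos (pi / P)] *)

Section Kernel.
Context (P : nat) (P_gt1 : (1 < P)%N).
Let b : R := pi / (2 * P)%:R.
Let s x := sin (x * b).

Let P0 : 0 < P%:R :> R. Proof. by rewrite ltr0n ltnW. Qed.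

(** The squared modulus of [sum_m s m e^(i m u)], expanded into cosines. The vector [s] is the first
    Dirichlet eigenvector of the second difference on [[0, 2 P]]: it vanishes at both ends and
    satisfies [s (m + 1) + s (m - 1) = 2 cos b s m]. *)
Definition fejer_kernel u := \sum_(0 <= l < 2 * P) \sum_(0 <= m < 2 * P) s l%:R * s m%:R * cos ((m%:R - l%:R) * u).

Lemma fejer_kernel_ge0 u : 0 <= fejer_kernel u.
Proof.
rewrite (_ : fejer_kernel u = normc (\sum_(0 <= m < 2 * P) (s m%:R)%:C%C * cis (m%:R * u)) ^+ 2).
  by rewrite sqr_ge0.
rewrite sqr_normcE rmorph_sum mulr_sumr raddf_sum; apply: eq_bigr => l _.
rewrite mulr_suml raddf_sum; apply: eq_bigr => m _.
by rewrite /cis /= mulrBl cosB; ring.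
Qed.

(** Both [s] and the cosine obey a three-term recurrence, with factors [2 cos b] and [2 cos u].
    Their discrete Wronskian [W] therefore telescopes, and only the ends remain; there [s] vanishes
    while its outer or inner neighbour is [- sin b] or [sin b]. *)
Lemma cos_mul_fejer_kernel u :
  2 * cos u * fejer_kernel u = 2 * cos b * fejer_kernel u +
   sin b * \sum_(0 <= l < 2 * P) s l%:R * (cos (l%:R * u) + cos ((2 * P - l)%:R * u)).
Proof.
rewrite /fejer_kernel !mulr_sumr -big_split; apply: eq_big_nat => l /andP[_ lP] /=.
pose g x := cos ((x - l%:R) * u).
pose W m := s (m%:R - 1) * g m%:R - s m%:R * g (m%:R - 1).
have sb m : s (m%:R + 1) + s (m%:R - 1) = 2 * cos b * s m%:R.
  by rewrite /s !mulrDl sinD mulN1r sinB mul1r; ring.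
have gu m : g (m%:R + 1) + g (m%:R - 1) = 2 * cos u * g m%:R.
  rewrite /g (_ : (m%:R + 1 - l%:R) * u = (m%:R - l%:R) * u + u); last by ring.
  rewrite (_ : (m%:R - 1 - l%:R) * u = (m%:R - l%:R) * u - u); last by ring.
  by rewrite cosD cosB; ring.
have Wd m : s m%:R * (2 * cos u * g m%:R) = 2 * cos b * s m%:R * g m%:R + (W m.+1 - W m).
  by rewrite -gu -sb /W -natr1 addrK; ring.
have b2P : (2 * P)%:R * b = pi by rewrite /b mulrC mulfVK // pnatr_eq0; lia.
transitivity (\sum_(0 <= m < 2 * P) (2 * cos b * (s l%:R * s m%:R * g m%:R) + s l%:R * (W m.+1 - W m))).
  rewrite mulr_sumr; apply: eq_bigr => m _; rewrite -/(g _).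
  by transitivity (s l%:R * (s m%:R * (2 * cos u * g m%:R))); [ring|rewrite Wd; ring].
rewrite big_split /= -!mulr_sumr; congr (_ + _).
rewrite telescope_sumr // mulrCA; congr (_ * _).
have W2 : W (2 * P)%N = sin b * cos ((2 * P - l)%:R * u).
  rewrite /W {1 2}/s mulrBl b2P mul1r sinpi mul0r subr0 sinB sinpi cospi /g natrB; last exact: ltnW.
  by ring.
have W0 : W 0%N = - (sin b * cos (l%:R * u)).
  by rewrite /W /s !sub0r mul0r sin0 mul0r subr0 mulN1r sinN /g sub0r (mulNr l%:R) cosN mulNr.
by rewrite W2 W0; ring.
Qed.

(** A shift by [P] adds [pi / 2] to the angle, so [m] and [m + P] together contribute 1. *)
Lemma sum_sqr_sin : \sum_(0 <= m < 2 * P) s m%:R ^+ 2 = P%:R.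
Proof.
rewrite (big_cat_nat (n := P)) //=; last by lia.
have -> : \sum_(P <= m < 2 * P) s m%:R ^+ 2 = \sum_(0 <= m < P) s (m + P)%:R ^+ 2.
  by rewrite -{1}[P]add0n big_addn (_ : 2 * P - P = P)%N //; lia.
rewrite -big_split /= (eq_bigr (fun=> 1)) ?sumr_const_nat ?subn0 // => m _.
rewrite natrD /s mulrDl (_ : P%:R * b = pi / 2) ?sinDpihalf; last first.
  by rewrite /b natrM; field; rewrite gt_eqF.
by rewrite addrC cos2Dsin2.
Qed.

(** The eigenvalue gap has order [b^2] and [b P = pi / 2], so [P] times the gap has the order of
    [b]. This makes the boundary terms of [cos_mul_fejer_kernel] comparable with the main term. *)
Lemma fejer_constants : 0 < cos b - cos (2 * b) /\ sin b <= 4 * ((cos b - cos (2 * b)) * P%:R).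
Proof.
have pi2 : 2 <= pi :> R by exact: pi_ge2.
have pi4 : pi <= 4 :> R.
  by have := @pihalf_lt2 R; lra.
have P2 : 2 <= P%:R :> R by rewrite ler_nat.
have bP : b * P%:R = pi / 2 by rewrite /b natrM; field; rewrite gt_eqF.
have b0 : 0 < b by rewrite /b divr_gt0 ?pi_gt0 // ltr0n; lia.
have b1 : b <= 1 by nra.
have := cos_ge_quad (ltW b0) => cb.
have cb2 : 1 / 2 <= cos b by nra.
have -> : cos (2 * b) = 2 * cos b ^+ 2 - 1.
  by rewrite mulrC mulr_natr cos_mulr2n -mulr_natr; ring.
have sb2 : b / 4 <= sin (b / 2) by apply: le_trans (sin_ge_half _); lra.
have c1 : cos b = 1 - 2 * sin (b / 2) ^+ 2.
  have -> : cos b = cos (b / 2 *+ 2) by congr cos; rewrite -mulr_natr mulfVK.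
  by rewrite cos_mulr2n cos2sin2; ring.
have s16 : b ^+ 2 / 16 <= sin (b / 2) ^+ 2 by nra.
have k1 : b ^+ 2 / 4 <= cos b - (2 * cos b ^+ 2 - 1) by nra.
have b2 : 0 < b ^+ 2 by rewrite exprn_gt0.
split; first by lra.
have sbb : sin b <= b by have := norm_sin_le (ltW b0); rewrite ler_norml => /andP[].
have : b ^+ 2 / 4 * P%:R <= (cos b - (2 * cos b ^+ 2 - 1)) * P%:R by rewrite ler_wpM2r // ltW.
have -> : b ^+ 2 / 4 * P%:R = b / 4 * (b * P%:R) by ring.
rewrite bP => h; have : b / 4 <= b / 4 * (pi / 2) by rewrite ler_peMr //; lra.
lra.
Qed.

(** If every [cos (u i)] were at most [cos (2 b)], the weighted sum of
    [2 (cos u - cos (2 b)) * fejer_kernel u] would be at most 0. Expanded in the Fourier sums [G],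
    it is at least [2 kap P (G 0 - 8 B)]: half of the 8 comes from the off-diagonal terms of the
    kernel, half from the boundary terms. *)
Lemma exists_cos_gt (I : eqType) (r : seq I) (w u : I -> R) :
  (forall i, i \in r -> 0 <= w i) ->
  8 * (\sum_(1 <= k < 2 * P) `|\sum_(i <- r) w i * cos (k%:R * u i)|) < \sum_(i <- r) w i ->
  exists2 i, i \in r & cos (pi / P%:R) < cos (u i).
Proof.
move=> w0 hG; apply: contrapT => noi.
pose G (k : R) := \sum_(i <- r) w i * cos (k * u i).
set B := \sum_(1 <= k < _) _ in hG.
have [k0 kP] := fejer_constants; set kap := cos b - _ in k0 kP.
have G0 : G 0 = \sum_(i <- r) w i by apply: eq_bigr => i _; rewrite mul0r cos0 mulr1.
have GN x : G (- x) = G x by apply: eq_bigr => i _; rewrite mulNr cosN.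
have B0 : 0 <= B by apply: sumr_ge0.
pose K i := fejer_kernel (u i).
pose E1 := \sum_(0 <= l < 2 * P) \sum_(0 <= m < 2 * P) s l%:R * s m%:R * G (m%:R - l%:R).
pose E2 := \sum_(0 <= l < 2 * P) s l%:R * (G l%:R + G (2 * P - l)%:R).
have tot : \sum_(i <- r) w i * (2 * (cos (u i) - cos (2 * b)) * K i) = 2 * kap * E1 + sin b * E2.
  transitivity (\sum_(i <- r) (2 * kap * (w i * K i) + sin b *
      \sum_(0 <= l < 2 * P) s l%:R * (w i * cos (l%:R * u i) + w i * cos ((2 * P - l)%:R * u i)))).
    apply: eq_bigr => i _; have := cos_mul_fejer_kernel (u i); rewrite -/(K i) => E.
    have -> : w i * (2 * (cos (u i) - cos (2 * b)) * K i) =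
       w i * (2 * cos (u i) * K i - 2 * cos (2 * b) * K i) by ring.
    rewrite E.
    under [X in _ = _ + _ * X]eq_bigr do rewrite -mulrDr mulrCA.
    by rewrite -mulr_sumr /kap; ring.
  rewrite big_split /= -!mulr_sumr; congr (_ * _ + _ * _).
    under eq_bigr do rewrite /K /fejer_kernel mulr_sumr.
    rewrite exchange_big; apply: eq_bigr => l _ /=.
    under eq_bigr do rewrite mulr_sumr.
    rewrite exchange_big; apply: eq_bigr => m _ /=.
    by rewrite /G mulr_sumr; apply: eq_bigr => i _; rewrite mulrCA.
  rewrite exchange_big; apply: eq_bigr => l _ /=.
  by rewrite -mulr_sumr big_split.
have le0 : 2 * kap * E1 + sin b * E2 <= 0.
  rewrite -tot big_seq; apply: sumr_le0 => i ir.
  rewrite mulr_ge0_le0 ?w0 // mulr_le0_ge0 ?fejer_kernel_ge0 // mulr_ge0_le0 // subr_le0.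
  rewrite (_ : 2 * b = pi / P%:R); last by rewrite /b natrM; field; rewrite gt_eqF.
  by rewrite leNgt; apply/negP => lt; apply: noi; exists i.
have s1 x : `|s x| <= 1 by rewrite ler_norml sin_geN1 sin_le1.
(* The value 0 at [k = 0] removes the diagonal, which is the main term, from the bound by
   [sum_dist_le]; each of the [2 P] rows then loses at most [2 B]. *)
pose T k := if k == 0%N then 0 else `|G k%:R|.
have T0 k : 0 <= T k by rewrite /T; case: eqP.
have TB : \sum_(1 <= k < 2 * P) T k = B.
  by apply: eq_big_nat => k /andP[k1 _]; rewrite /T gtn_eqF.
have E1ge : P%:R * G 0 - 4 * P%:R * B <= E1.
  have -> : 4 * P%:R * B = \sum_(0 <= l < 2 * P) (2 * B).
    by rewrite sumr_const_nat subn0 -[RHS]mulr_natr natrM; ring.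
  rewrite -sum_sqr_sin mulr_suml -sumrB; apply: ler_sum_nat => l /andP[_ lP].
  apply: (@le_trans _ _ (s l%:R ^+ 2 * G 0 - \sum_(0 <= m < 2 * P) T (l - m + (m - l))%N)).
    by rewrite lerD2l lerN2; apply: le_trans (sum_dist_le lP T0) _; rewrite TB /T eqxx add0r.
  rewrite (bigD1_seq l) ?mem_index_iota ?iota_uniq //=.
  rewrite [leRHS](bigD1_seq l) ?mem_index_iota ?iota_uniq //=.
  rewrite subnn /T eqxx add0r subrr -expr2 lerD2l -sumrN; apply: ler_sum => m ml.
  rewrite ifN; last by apply/eqP => E; move/eqP: ml; lia.
  have -> : G (m%:R - l%:R) = G (l - m + (m - l))%N%:R.
    case: (leqP l m) => lm; first by rewrite -natrB // (_ : (_ + _)%N = (m - l)%N) //; lia.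
    by rewrite -GN opprB -natrB ?(ltnW lm) // (_ : (_ + _)%N = (l - m)%N) //; lia.
  rewrite lerNl -mulNr; apply: le_trans (ler_norm _) _; rewrite normrM ler_piMl // normrN normrM.
  by rewrite mulr_ile1.
have E2ge : - (2 * B) <= E2.
  rewrite /E2 big_ltn; last by lia.
  rewrite {1}/s mul0r sin0 mul0r add0r.
  have B2 : \sum_(1 <= k < 2 * P) `|G (2 * P - k)%:R| = B.
    rewrite [LHS]big_nat_rev /= add1n; apply: eq_big_nat => k /andP[k1 kP'].
    by rewrite subSS subKn // ltnW.
  rewrite mulr_natl mulr2n -{2}B2 -big_split /= -sumrN; apply: ler_sum => k _.
  rewrite lerNl -mulNr; apply: le_trans (ler_norm _) _; rewrite normrM normrN.
  apply: (@le_trans _ _ `|G k%:R + G (2 * P - k)%:R|); first by rewrite ler_piMl.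
  exact: ler_normD.
have sb0 : 0 <= sin b.
  apply: sin_ge0_pi; rewrite /b divr_ge0 ?pi_ge0 // ler_pdivrMr ?ltr0n; last by lia.
  by rewrite ler_peMr ?pi_ge0 // ler1n; lia.
rewrite -G0 in hG.
have h1 : 2 * kap * (P%:R * G 0 - 4 * P%:R * B) <= 2 * kap * E1 by rewrite ler_wpM2l // mulr_ge0 // ltW.
have h2 : sin b * - (2 * B) <= sin b * E2 by rewrite ler_wpM2l.
have h3 : sin b * (2 * B) <= 4 * (kap * P%:R) * (2 * B) by rewrite ler_wpM2r // mulr_ge0.
have h4 : kap * P%:R * (8 * B) < kap * P%:R * G 0 by rewrite ltr_pM2l // mulr_gt0.
by move: h1 h2 h3 h4 le0; rewrite mulrN => *; lra.
Qed.

End Kernel.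
End Minorant.

(** * From bounds on exponential sums to a solution *)

Section Detection.
Context {R : realType}.
Local Notation normc := Normc.normc.

(** The cosine condition puts [v] at distance less than 1/2 from a multiple of [P], and the bound on
    [v] excludes all multiples but 0. *)
Lemma cos_gt_small (v : R) (P : nat) : (1 < P)%N ->
  `|v| <= P%:R - 1 / 2 -> cos (pi / P%:R) < cos (pi *+ 2 / P%:R * v) -> `|v| < 1 / 2.
Proof.
move=> P1 vP hc; have P0 : 0 < P%:R :> R by rewrite ltr0n ltnW.
have P2 : 2 <= P%:R :> R by rewrite ler_nat.
have pi0 := @pi_gt0 R.
rewrite ltNge; apply/negP => v12.
have cE : cos (pi *+ 2 / P%:R * v) = cos (pi * (2 * `|v| / P%:R)).
  transitivity (cos (pi *+ 2 / P%:R * `|v|)).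
    by case: (ger0P v) => // _; rewrite mulrN cosN.
  by congr cos; rewrite -mulr_natr; field; rewrite gt_eqF.
have pP : pi / P%:R = pi * (1 / P%:R) :> R by rewrite mul1r.
have iP0 : 0 < 1 / P%:R :> R by rewrite divr_gt0.
have iP1 : 1 / P%:R <= 1 :> R by rewrite ler_pdivrMr //; lra.
have inpi (t : R) : 0 <= t <= 1 -> pi * t \in `[0, pi].
  by move=> /andP[t0 t1]; rewrite in_itv /= mulr_ge0 ?ler_piMr ?(ltW pi0).
have t0 : 1 / P%:R <= 2 * `|v| / P%:R by rewrite ler_pM2r ?invr_gt0 //; lra.
have t2 : 2 * `|v| / P%:R <= 2 - 1 / P%:R.
  by rewrite ler_pdivrMr // mulrBl mulfVK ?gt_eqF //; lra.
move: hc; rewrite cE; apply/negP; rewrite -leNgt.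
have mono (t : R) : 1 / P%:R <= t <= 1 -> cos (pi * t) <= cos (pi * (1 / P%:R)).
  move=> /andP[t1 t3]; rewrite leNgt ltr_cos ?inpi -?leNgt ?ler_pM2l //; apply/andP; split; lra.
rewrite pP; case: (leP (2 * `|v| / P%:R) 1) => t1; first by apply: mono; rewrite t0.
have -> : cos (pi * (2 * `|v| / P%:R)) = cos (pi * (2 - 2 * `|v| / P%:R)).
  by rewrite mulrBr [pi * 2]mulr_natr cosB cos2pi sin2pi mul1r mul0r addr0.
by apply: mono; apply/andP; split; lra.
Qed.

(** [exists_cos_gt] is applied to all triples [(n, (x, y))]. Each Fourier sum factors into the
    exponential sum over [n], at most [eps], and the transforms of [A] and [B]; Cauchy-Schwarz and
    Parseval bound the total of the latter by [2 P sqrt (|A| |B|)]. The factor 8 of [exists_cos_gt]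
    thus becomes 16. *)
Lemma sumset_hits (M P n1 n2 : nat) (a w : nat -> R) (A B : seq nat) (eps : R) :
  P = (2 * M + 2)%N -> uniq A -> uniq B ->
  (forall x, x \in A -> (1 <= x <= M)%N) -> (forall y, y \in B -> (1 <= y <= M)%N) ->
  (forall n, (n1 <= n < n2)%N -> 0 <= w n /\ 0 <= a n <= P%:R) ->
  0 <= eps ->
  (forall k, (1 <= k < 2 * P)%N ->
    normc (\sum_(n1 <= n < n2) (w n)%:C%C * cis (pi *+ 2 / P%:R * k%:R * a n)) <= eps) ->
  (16 * P%:R * eps) ^+ 2 < (\sum_(n1 <= n < n2) w n) ^+ 2 * (size A * size B)%:R ->
  exists n x y : nat, [/\ (n1 <= n < n2)%N, x \in A, y \in B &
     (x + y)%:R <= a n < (x + y)%:R + 1].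
Proof.
move=> PE uA uB AM BM aw eps0 E_le hyp.
have P1 : (1 < P)%N by lia.
have P0 : 0 < P%:R :> R by rewrite ltr0n ltnW.
pose th : R := pi *+ 2 / P%:R.
pose r := [seq (n, p) | n <- index_iota n1 n2, p <- [seq (x, y) | x <- A, y <- B]].
pose W (i : nat * (nat * nat)) := w i.1.
(* The shift by 1/2 centres the interval [[0, 1)] in which [a n - x - y] has to fall. *)
pose V (i : nat * (nat * nat)) := a i.1 - i.2.1%:R - i.2.2%:R - 1 / 2.
have rP n x y : (n, (x, y)) \in r -> [/\ (n1 <= n < n2)%N, x \in A & y \in B].
  move=> /allpairsP [[n' [x' y']]] /= []; rewrite mem_index_iota => nn.
  by move=> /allpairsP [[x'' y'']] /= [xA yB [-> ->]] [-> -> ->].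
have sumr_r (F : nat * (nat * nat) -> R) : \sum_(i <- r) F i =
    \sum_(n1 <= n < n2) \sum_(x <- A) \sum_(y <- B) F (n, (x, y)).
  rewrite big_allpairs; apply: eq_bigr => n _.
  by rewrite (big_allpairs (F := fun p => F (n, p))).
pose T := \sum_(n1 <= n < n2) w n.
have T0 : 0 <= T by rewrite /T big_seq; apply: sumr_ge0 => n; rewrite mem_index_iota => /aw[].
have GT : \sum_(i <- r) W i = T * (size A * size B)%:R.
  rewrite sumr_r mulr_suml; apply: eq_bigr => n _ /=.
  rewrite (eq_bigr (fun=> w n *+ size B)) => [|x _].
    by rewrite big_const_seq count_predT iter_addr_0 -mulrnA mulnC mulr_natr.
  by rewrite /W /= big_const_seq count_predT iter_addr_0.
pose Ah k := normc (\sum_(x <- A) cis (th * k%:R * x%:R)).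
pose Bh k := normc (\sum_(x <- B) cis (th * k%:R * x%:R)).
have Gk k : (1 <= k < 2 * P)%N ->
    `|\sum_(i <- r) W i * cos (k%:R * (th * V i))| <= eps * (Ah k * Bh k).
  move=> kP.
  pose Z : R[i] := cis (- (th * k%:R * (1 / 2))) *
    ((\sum_(n1 <= n < n2) (w n)%:C%C * cis (th * k%:R * a n)) *
     (conjc (\sum_(x <- A) cis (th * k%:R * x%:R)) *
      conjc (\sum_(y <- B) cis (th * k%:R * y%:R)))).
  have ZE : \sum_(i <- r) W i * cos (k%:R * (th * V i)) = complex.Re Z.
    rewrite sumr_r /Z mulr_suml mulr_sumr raddf_sum; apply: eq_bigr => n _.
    rewrite !rmorph_sum mulr_suml !mulr_sumr raddf_sum; apply: eq_bigr => x _.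
    rewrite !mulr_sumr raddf_sum; apply: eq_bigr => y _.
    have key p q e d v : complex.Re (cis p * ((v%:C)%C * cis q * (conjc (cis e) * conjc (cis d)))) =
        v * cos (p + q - e - d) :> R.
      transitivity (complex.Re ((v%:C)%C * cis (p + q - e - d))); last by rewrite /= mul0r subr0.
      by rewrite !conj_cis !cisD; congr complex.Re; ring.
    apply/esym; apply: etrans (key _ _ _ _ _) _; congr (_ * cos _).
    by rewrite /V /=; ring.
  have nZ : normc Z <= eps * (Ah k * Bh k).
    rewrite /Z !Normc.normcM normc_cis mul1r !normc_conj ler_wpM2r ?mulr_ge0 ?normc_ge0 //.
    exact: E_le.
  rewrite ZE; apply: le_trans nZ; rewrite -[X in X <= _]sqrtr_sqr.
  by case: (Z) => ? ? /=; rewrite ler_wsqrtr // lerDl sqr_ge0.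
set S := \sum_(1 <= k < 2 * P) Ah k * Bh k in GT Gk *.
have S0 : 0 <= S by apply: sumr_ge0 => k _; rewrite mulr_ge0 ?normc_ge0.
have S2 : S ^+ 2 <= 4 * P%:R ^+ 2 * (size A * size B)%:R.
  apply: le_trans (cauchy_schwarz _ _ _) _.
  have Pars (D : seq nat) : uniq D -> (forall x, x \in D -> (1 <= x <= M)%N) ->
      \sum_(1 <= k < 2 * P) normc (\sum_(x <- D) cis (th * k%:R * x%:R)) ^+ 2 <= (2 * P * size D)%:R.
    move=> uD DM; rewrite -(@parseval R _ _ (ltnW P1) uD); last by move=> x /DM; lia.
    by rewrite [leRHS]big_ltn ?lerDr ?sqr_ge0 //; lia.
  apply: (@le_trans _ _ ((2 * P * size A)%:R * (2 * P * size B)%:R)).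
    by apply: ler_pM; rewrite ?sumr_ge0 ?Pars // => k _; rewrite sqr_ge0.
  by rewrite !natrM le_eqVlt; apply/orP; left; apply/eqP; ring.
have AB0 : 0 < (size A * size B)%:R :> R.
  rewrite ltNge; apply/negP => AB0.
  by have := le_lt_trans (sqr_ge0 _) hyp; rewrite ltNge mulr_ge0_le0 // sqr_ge0.
have [||[n [x y]] ir hc] := @exists_cos_gt R P P1 _ r W (fun i => th * V i).
- by move=> [n [x y]] /rP[/aw[]].
- rewrite GT.
  apply: (@le_lt_trans _ _ (8 * (eps * S))).
    by rewrite ler_wpM2l // /S mulr_sumr; apply: ler_sum_nat.
  rewrite -(@ltr_pXn2r _ 2) ?nnegrE ?mulr_ge0 // ?(ltW AB0) //.
  apply: (@le_lt_trans _ _ ((16 * P%:R * eps) ^+ 2 * (size A * size B)%:R)).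
    have -> : (8 * (eps * S)) ^+ 2 = (8 * eps) ^+ 2 * S ^+ 2 by ring.
    have -> : (16 * P%:R * eps) ^+ 2 * (size A * size B)%:R = (8 * eps) ^+ 2 * (4 * P%:R ^+ 2 * (size A * size B)%:R) by ring.
    by rewrite ler_wpM2l // sqr_ge0.
  have -> : (T * (size A * size B)%:R) ^+ 2 = T ^+ 2 * (size A * size B)%:R * (size A * size B)%:R by ring.
  by rewrite ltr_pM2r.
have [nn xA yB] := rP _ _ _ ir; exists n, x, y; split => //.
have [_ /andP[a0 aP]] := aw n nn; have /andP[x1 xM] := AM x xA; have /andP[y1 yM] := BM y yB.
have PE' : P%:R = 2 * M%:R + 2 :> R by rewrite PE natrD natrM.
have : `|V (n, (x, y))| < 1 / 2.
  apply: cos_gt_small hc => //.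
  have : 1 <= x%:R :> R by rewrite ler1n.
  have : x%:R <= M%:R :> R by rewrite ler_nat.
  have : 1 <= y%:R :> R by rewrite ler1n.
  have : y%:R <= M%:R :> R by rewrite ler_nat.
  by rewrite ler_norml /V /= => *; apply/andP; split; lra.
by rewrite ltr_norml /V /= natrD => /andP[? ?]; apply/andP; split; lra.
Qed.

(** The common elements are dealt out, one half to each side; all others stay where they are. *)
Lemma disjoint_halves (A B : seq nat) : uniq A -> uniq B ->
  exists A' B' : seq nat, [/\ uniq A', uniq B', {subset A' <= A}, {subset B' <= B} &
    [/\ forall x, x \in A' -> x \in B' -> False,
        (size A <= 2 * size A' + 1)%N & (size B <= 2 * size B' + 1)%N]].
Proof.
move=> uA uB; pose D := [seq x <- A | x \in B].
have uD : uniq D by rewrite filter_uniq.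
pose h := (size D)./2.
have hD : (size D <= 2 * h + 1 <= size D + 1)%N.
  by have := odd_double_half (size D); rewrite -/h; case: (odd _) => <-; rewrite -addnn /=; lia.
clearbody h.
pose A1 := [seq x <- A | x \notin B]; pose B1 := [seq x <- B | x \notin A].
have sA : size A = (size A1 + size D)%N.
  by rewrite addnC -(count_predC (mem B) A) !size_filter.
have sB : size B = (size B1 + size D)%N.
  have -> : size D = size [seq x <- B | x \in A].
    apply: perm_size; apply: uniq_perm; rewrite ?filter_uniq // => x.
    by rewrite !mem_filter andbC.
  by rewrite addnC -(count_predC (mem A) B) !size_filter.
have DP x : x \in D -> (x \in A) && (x \in B) by rewrite mem_filter andbC.
have td : take h D ++ drop h D = D := cat_take_drop h D.
have tD x : x \in take h D -> x \in D by exact: mem_take.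
have dD x : x \in drop h D -> x \in D by exact: mem_drop.
have disj x : x \in take h D -> x \in drop h D -> False.
  move=> xt xd; move: uD; rewrite -td cat_uniq => /and3P[_ /hasPn /(_ x xd)].
  by rewrite /= xt.
exists (A1 ++ take h D), (B1 ++ drop h D); split.
- rewrite cat_uniq filter_uniq // take_uniq // andbT; apply/hasPn => x /tD /DP /andP[_ xB].
  by rewrite mem_filter xB.
- rewrite cat_uniq filter_uniq // drop_uniq // andbT; apply/hasPn => x /dD /DP /andP[xA _].
  by rewrite mem_filter xA.
- by move=> x; rewrite mem_cat mem_filter => /orP[/andP[]|/tD/DP/andP[]].
- by move=> x; rewrite mem_cat mem_filter => /orP[/andP[]|/dD/DP/andP[]].
split.
- move=> x; rewrite !mem_cat !mem_filter => /orP[/andP[xB xA]|xt] /orP[/andP[xA' xB']|xd].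
  + by rewrite xB' in xB.
  + by have /andP[_ xB'] := DP _ (dD _ xd); rewrite xB' in xB.
  + by have /andP[xA _] := DP _ (tD _ xt); rewrite xA in xA'.
  + exact: (disj x).
- have hm : minn h (size D) = h by apply/minn_idPl; lia.
  rewrite sA size_cat size_take_min hm; move: (size D) (size A1) hD => *; lia.
- rewrite sB size_cat size_drop; move: (size D) (size B1) hD => *; lia.
Qed.

End Detection.

(** * Asymptotics in Hardy fields *)

Section RealGrowth.
Context {R : realType}.
Implicit Types (f g df : R -> R) (a b k p x y : R).

Lemma near_pinftyP (P : R -> Prop) :
  (\forall x \near +oo, P x) <-> exists a, forall x, a <= x -> P x.
Proof.
split=> [[a [_ aP]]|[a aP]].
  by exists (a + 1) => x ax; apply: aP; lra.
by exists a; split => [|x ax]; [exact: num_real|apply: aP; exact: ltW].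
Qed.

Lemma near_pinfty_ge a : \forall x \near +oo, a <= x.
Proof. by apply/near_pinftyP; exists a. Qed.

Lemma derivable_is_derive1 f x : derivable f x 1 -> is_derive x 1 f (f^`()%classic x).
Proof. by move=> fx; rewrite derive1E; exact: derivableP. Qed.

Lemma is_derive_div f g x (u v : R) : is_derive x 1 f u -> is_derive x 1 g v -> g x != 0 ->
  is_derive x 1 (fun y => f y / g y) ((u * g x - f x * v) / g x ^+ 2).
Proof.
move=> fu gv gx0; have gV : is_derive x 1 (fun y => (g y)^-1) (- g x ^- 2 * v).
  have [gd <-] := gv; apply: DeriveDef; first exact: derivableV.
  by rewrite deriveV.
have := is_deriveM fu gV; congr is_derive; rewrite /GRing.scale /=.
by field.
Qed.

Lemma le_of_derive_le f df a k : (forall x, a <= x -> is_derive x 1 f (df x)) ->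
  (forall x, a <= x -> df x <= k) ->
  forall x y, a <= x -> x <= y -> f y - f x <= k * (y - x).
Proof.
move=> fd dk x y ax; rewrite le_eqVlt => /predU1P[<-|xy]; first by rewrite !subrr mulr0.
have [z /andP[xz _] ->] := mean_value xy (fun t h => fd t (le_trans ax (andP h).1)).
by rewrite ler_wpM2r ?subr_ge0 ?(ltW xy) // dk // (le_trans ax) // ltW.
Qed.

Lemma ge_of_derive_ge f df a k : (forall x, a <= x -> is_derive x 1 f (df x)) ->
  (forall x, a <= x -> k <= df x) ->
  forall x y, a <= x -> x <= y -> k * (y - x) <= f y - f x.
Proof.
move=> fd dk x y ax; rewrite le_eqVlt => /predU1P[<-|xy]; first by rewrite !subrr mulr0.
have [z /andP[xz _] ->] := mean_value xy (fun t h => fd t (le_trans ax (andP h).1)).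
by rewrite ler_wpM2r ?subr_ge0 ?(ltW xy) // dk // (le_trans ax) // ltW.
Qed.

Lemma is_derive_log_ratio f df p x : 0 < x -> 0 < f x -> is_derive x 1 f (df x) ->
  is_derive x 1 (fun t => ln (f t) - p * ln t) (df x / f x - p / x).
Proof.
move=> x0 fx0 fd.
have d1 : is_derive x 1 (@ln R \o f) ((f x)^-1 * df x) by apply: is_derive1_comp; exact: is_derive1_ln.
have d2 : is_derive x 1 (fun t => p * ln t) (p * x^-1).
  exact: (is_deriveZ p (is_derive1_ln x0)).
by have := is_deriveB d1 d2; congr is_derive; rewrite mulrC.
Qed.

(** The hypothesis says that [ln f - p ln] has derivative at most 0. *)
Lemma powR_growth_le f df p a : 0 < a ->
  (forall x, a <= x -> [/\ 0 < f x, is_derive x 1 f (df x) & x * df x <= p * f x]) ->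
  forall x y, a <= x -> x <= y -> f y <= f x * (y / x) `^ p.
Proof.
move=> a0 fP x y ax xy; have x0 := lt_le_trans a0 ax; have y0 := lt_le_trans x0 xy.
have [fx0 _ _] := fP x ax; have [fy0 _ _] := fP y (le_trans ax xy).
have := @le_of_derive_le (fun t => ln (f t) - p * ln t) (fun t => df t / f t - p / t) a 0 _ _ x y ax xy.
rewrite mul0r => H.
have {}H : ln (f y) - p * ln y - (ln (f x) - p * ln x) <= 0.
  apply: H => t at_; have [ft0 fd fl] := fP t at_; have t0 := lt_le_trans a0 at_.
    exact: is_derive_log_ratio.
  by rewrite subr_le0 ler_pdivrMr // mulrAC ler_pdivlMr // mulrC.
rewrite /powR gt_eqF ?divr_gt0 // ln_div ?posrE //.
rewrite -[X in X <= _]lnK ?posrE // -{1}[f x]lnK ?posrE // -expRD ler_expR.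
by move: H; lra.
Qed.

Lemma powR_growth_ge f df p a : 0 < a ->
  (forall x, a <= x -> [/\ 0 < f x, is_derive x 1 f (df x) & p * f x <= x * df x]) ->
  forall x y, a <= x -> x <= y -> f x * (y / x) `^ p <= f y.
Proof.
move=> a0 fP x y ax xy; have x0 := lt_le_trans a0 ax; have y0 := lt_le_trans x0 xy.
have [fx0 _ _] := fP x ax; have [fy0 _ _] := fP y (le_trans ax xy).
have := @ge_of_derive_ge (fun t => ln (f t) - p * ln t) (fun t => df t / f t - p / t) a 0 _ _ x y ax xy.
rewrite mul0r => H.
have {}H : 0 <= ln (f y) - p * ln y - (ln (f x) - p * ln x).
  apply: H => t at_; have [ft0 fd fl] := fP t at_; have t0 := lt_le_trans a0 at_.
    exact: is_derive_log_ratio.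
  by rewrite subr_ge0 ler_pdivrMr // mulrAC ler_pdivlMr // [_ * t]mulrC.
rewrite /powR gt_eqF ?divr_gt0 // ln_div ?posrE //.
rewrite -[X in _ <= X]lnK ?posrE // -{1}[f x]lnK ?posrE // -expRD ler_expR.
by move: H; lra.
Qed.

Lemma near_ge_of_derive_ge g (b b' : R) : b' < b ->
  (\forall x \near +oo, derivable g x 1) -> (\forall x \near +oo, b <= g^`()%classic x) ->
  \forall x \near +oo, b' * x <= g x.
Proof.
move=> bb /near_pinftyP[a1 gd] /near_pinftyP[a2 gb].
pose a := Num.max a1 a2; apply/near_pinftyP.
(* From this point on the surplus slope [b - b'] outweighs the constant of integration. *)
exists (Num.max a ((b * a - g a) / (b - b'))) => x; rewrite ge_max => /andP[ax].
rewrite ler_pdivrMr ?subr_gt0 // => xl.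
have := @ge_of_derive_ge g (g^`()%classic) a b _ _ a x (lexx _) ax.
move=> H; have {}H : b * (x - a) <= g x - g a.
  by apply: H => t at_; [apply: derivable_is_derive1; apply: gd|apply: gb];
     apply: le_trans at_; rewrite le_max lexx ?orbT.
lra.
Qed.

Lemma near_le_of_derive_le g (b b' : R) : b < b' ->
  (\forall x \near +oo, derivable g x 1) -> (\forall x \near +oo, g^`()%classic x <= b) ->
  \forall x \near +oo, g x <= b' * x.
Proof.
move=> bb /near_pinftyP[a1 gd] /near_pinftyP[a2 gb].
pose a := Num.max a1 a2; apply/near_pinftyP.
exists (Num.max a ((g a - b * a) / (b' - b))) => x; rewrite ge_max => /andP[ax].
rewrite ler_pdivrMr ?subr_gt0 // => xl.
have := @le_of_derive_le g (g^`()%classic) a b _ _ a x (lexx _) ax.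
move=> H; have {}H : g x - g a <= b * (x - a).
  by apply: H => t at_; [apply: derivable_is_derive1; apply: gd|apply: gb];
     apply: le_trans at_; rewrite le_max lexx ?orbT.
lra.
Qed.

End RealGrowth.

(** * Eventual sign and monotonicity in a Hardy field *)

Section HardyFields.
Context {R : realType} (H : set (R -> R)) (hH : hardy_field H).
Implicit Types (f g : R -> R) (a b d l x y : R).

(** A nonzero germ is invertible, hence has no zeros near infinity, and continuity fixes the
    sign. *)
Lemma hardy_near_sign f : H f ->
  [\/ same_germ f 0, \forall x \near +oo, 0 < f x | \forall x \near +oo, f x < 0].
Proof.
move=> Hf; case: (pselect (same_germ f 0)) => [?|f0]; first exact: Or31.
have [g _ /near_pinftyP[a1 fg]] := hardyV hH Hf f0.
have [a2 fc] := hardy_continuous hH Hf.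
pose a := Num.max a1 (a2 + 1).
have fn0 x : a <= x -> f x != 0.
  rewrite ge_max => /andP[ax _]; apply/eqP => fx0.
  by have := fg x ax; rewrite /= /GRing.mul /= fx0 mul0r => /esym/eqP; rewrite oner_eq0.
have fcont x y : a <= x -> {within `[x, y], continuous f}.
  rewrite ge_max => /andP[_ ax]; apply: continuous_in_subspaceT => z.
  by rewrite inE /= in_itv /= => /andP[xz _]; apply: fc; lra.
have f_sign x : a <= x -> 0 < f a * f x.
  move=> ax; rewrite ltNge; apply/negP => fle.
  have [|z] := @IVT R f a x 0 ax (fcont a x (lexx _)).
    rewrite ge_min le_max; case: (ltgtP (f a) 0) => fa0 /=.
    - by rewrite -(nmulr_rle0 _ fa0) fle.
    - by rewrite -(pmulr_rle0 _ fa0) fle.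
    - by have := fn0 a (lexx _); rewrite fa0 eqxx.
  by rewrite in_itv /= => /andP[az _]; apply/eqP; exact: fn0.
case: (ltgtP (f a) 0) => fa.
- apply: Or33; apply/near_pinftyP; exists a => x /f_sign.
  by rewrite nmulr_rgt0.
- apply: Or32; apply/near_pinftyP; exists a => x /f_sign.
  by rewrite pmulr_rgt0.
- by have := fn0 a (lexx _); rewrite fa eqxx.
Qed.

Lemma hardy_near_le_or_ge f b : H f ->
  (\forall x \near +oo, b <= f x) \/ (\forall x \near +oo, f x <= b).
Proof.
move=> Hf; have [/near_pinftyP[a1 fd] Hf'] := hardy_derive hH Hf.
have fder x : a1 <= x -> is_derive x 1 f (f^`()%classic x).
  by move=> ?; apply: derivable_is_derive1; exact: fd.
have mono : (exists a, forall x y, a <= x -> x <= y -> f x <= f y) \/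
            (exists a, forall x y, a <= x -> x <= y -> f y <= f x).
  have [/near_pinftyP[a2 f0]|/near_pinftyP[a2 f0]|/near_pinftyP[a2 f0]] := hardy_near_sign Hf'.
  - left; exists (Num.max a1 a2) => x y ax xy.
    have := @ge_of_derive_ge R f (f^`()%classic) (Num.max a1 a2) 0 _ _ x y ax xy.
    rewrite mul0r subr_ge0; apply => t; rewrite ge_max => /andP[t1 t2].
      exact: fder.
    by rewrite f0.
  - left; exists (Num.max a1 a2) => x y ax xy.
    have := @ge_of_derive_ge R f (f^`()%classic) (Num.max a1 a2) 0 _ _ x y ax xy.
    rewrite mul0r subr_ge0; apply => t; rewrite ge_max => /andP[t1 t2].
      exact: fder.
    by rewrite ltW // f0.
  - right; exists (Num.max a1 a2) => x y ax xy.
    have := @le_of_derive_le R f (f^`()%classic) (Num.max a1 a2) 0 _ _ x y ax xy.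
    rewrite mul0r subr_le0; apply => t; rewrite ge_max => /andP[t1 t2].
      exact: fder.
    by rewrite ltW // f0.
case: mono => [[a fa]|[a fa]].
  case: (pselect (exists2 x, a <= x & b <= f x)) => [[x ax bx]|nx].
    by left; apply/near_pinftyP; exists x => y xy; apply: le_trans bx _; exact: fa.
  right; apply/near_pinftyP; exists a => x ax; rewrite leNgt; apply/negP => /ltW bx.
  by apply: nx; exists x.
case: (pselect (exists2 x, a <= x & f x <= b)) => [[x ax bx]|nx].
  by right; apply/near_pinftyP; exists x => y xy; apply: le_trans bx; exact: fa.
left; apply/near_pinftyP; exists a => x ax; rewrite leNgt; apply/negP => /ltW bx.
by apply: nx; exists x.
Qed.

(* The identity function need not belong to [H], so that x f' / f is reached through
   the derivative of f / f', which does. *)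
Lemma hardy_derive_cvg g l : H g -> g x / x @[x --> +oo] --> l ->
  g^`()%classic x @[x --> +oo] --> l.
Proof.
move=> Hg /cvgrPdist_le gl; have [gd Hg'] := hardy_derive hH Hg.
apply/cvgrPdist_le => e e0.
have e4 : 0 < e / 4 by lra.
(* Otherwise the derivative is eventually at least [l + e], and integration gives
   [(l + e / 2) x <= g x], against the limit of [g x / x]. *)
have up : \forall x \near +oo, g^`()%classic x <= l + e.
  case: (hardy_near_le_or_ge (l + e) Hg') => // /(near_ge_of_derive_ge (b' := l + e / 2) _ gd) H1.
  have /near_pinftyP[a Ha] := H1 ltac:(lra); have /near_pinftyP[a' Ha'] := gl _ e4.
  pose x := Num.max 1 (Num.max a a').
  have x1 : 1 <= x by rewrite le_max lexx.
  have x0 : 0 < x by lra.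
  have ax : a <= x by rewrite !le_max lexx !orbT.
  have ax' : a' <= x by rewrite !le_max lexx !orbT.
  have := Ha x ax; rewrite -ler_pdivlMr // => h1.
  by have := Ha' x ax'; rewrite ler_norml => /andP[? ?]; lra.
have lo : \forall x \near +oo, l - e <= g^`()%classic x.
  case: (hardy_near_le_or_ge (l - e) Hg') => // /(near_le_of_derive_le (b' := l - e / 2) _ gd) H1.
  have /near_pinftyP[a Ha] := H1 ltac:(lra); have /near_pinftyP[a' Ha'] := gl _ e4.
  pose x := Num.max 1 (Num.max a a').
  have x1 : 1 <= x by rewrite le_max lexx.
  have x0 : 0 < x by lra.
  have ax : a <= x by rewrite !le_max lexx !orbT.
  have ax' : a' <= x by rewrite !le_max lexx !orbT.
  have := Ha x ax; rewrite -ler_pdivrMr // => h1.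
  by have := Ha' x ax'; rewrite ler_norml => /andP[? ?]; lra.
near=> x; have ux : g^`()%classic x <= l + e by near: x.
have lx : l - e <= g^`()%classic x by near: x.
by rewrite ler_norml; apply/andP; split; lra.
Unshelve. all: by end_near. Qed.

Lemma hardy_div f g : H f -> H g -> (\forall x \near +oo, g x != 0) -> H (fun x => f x / g x).
Proof.
move=> Hf Hg g0; have gn : ~ same_germ g 0.
  move=> gz; have /near_pinftyP[a /(_ a (lexx _))[/eqP]] : \forall x \near +oo, g x != 0 /\ g x = 0.
    by near=> x; split; near: x.
  by [].
have [h Hh gh] := hardyV hH Hg gn.
apply: (hardy_germ hH _ (hardyM hH Hf Hh)).
near=> x; have gx : g x != 0 by near: x.
have E : g x * h x = 1 by near: x; exact: gh.
have hx : h x = (g x)^-1 by apply: (mulfI gx); rewrite E mulfV.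
by rewrite -hx.
Unshelve. all: by end_near. Qed.

End HardyFields.

(** * Limits of logarithmic derivatives *)

Section HardyAsymptotics.
Context {R : realType}.
Implicit Types (f g alpha : R -> R) (a b c d l p x y : R).

Lemma near_neq0_of_cvg f d : d != 0 -> f x @[x --> +oo] --> d -> \forall x \near +oo, f x != 0.
Proof.
move=> d0 /cvgrPdist_lt fd; have /fd : 0 < `|d| by rewrite normr_gt0.
by apply: filterS => x; apply: contraTneq => ->; rewrite subr0 ltxx.
Qed.

(** For [g = f / f'] the hypothesis reads [g x / x --> 1 / d], whence [g' --> 1 / d]. Since
    [g' = 1 - f f'' / f'^2], the quotient [x f'' / f'] equals [(x f' / f) (1 - g')] and tends to
    [d (1 - 1 / d)]. *)
Lemma hardy_logderive_step (H : set (R -> R)) f d : hardy_field H -> H f -> d != 0 ->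
  x * f^`()%classic x / f x @[x --> +oo] --> d ->
  x * f^`()%classic^`()%classic x / f^`()%classic x @[x --> +oo] --> d - 1.
Proof.
move=> hH Hf d0 fd; have fn0 := near_neq0_of_cvg d0 fd.
have [fder Hf'] := hardy_derive hH Hf; have [f'der _] := hardy_derive hH Hf'.
have f0 : \forall x \near +oo, f x != 0.
  by apply: filterS fn0 => x; apply: contra_neq => ->; rewrite invr0 mulr0.
have f'0 : \forall x \near +oo, f^`()%classic x != 0.
  by apply: filterS fn0 => x; apply: contra_neq => ->; rewrite mulr0 mul0r.
pose g x := f x / f^`()%classic x.
have Hg : H g by exact: hardy_div.
have gx : g x / x @[x --> +oo] --> d^-1.
  apply: cvg_trans (cvgV d0 fd); apply: near_eq_cvg; near=> x.
  have fx : f x != 0 by near: x.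
  have f'x : f^`()%classic x != 0 by near: x.
  have x1 : 1 <= x by near: x; exact: near_pinfty_ge.
  by rewrite /g /unstable.inv_fun /=; field; rewrite fx f'x gt_eqF //; lra.
have gd := hardy_derive_cvg hH Hg gx.
have -> : d - 1 = d * (1 - d^-1) by rewrite mulrBr mulr1 mulfV.
have lim : x * f^`()%classic x / f x * (1 - g^`()%classic x) @[x --> +oo] --> d * (1 - d^-1).
  by apply: cvgM => //; apply: cvgB => //; exact: cvg_cst.
apply: cvg_trans lim; apply: near_eq_cvg; near=> x.
have fx : f x != 0 by near: x.
have f'x : f^`()%classic x != 0 by near: x.
have fdx : derivable f x 1 by near: x; exact: fder.
have f'dx : derivable f^`()%classic x 1 by near: x; exact: f'der.
have := is_derive_div (derivable_is_derive1 fdx) (derivable_is_derive1 f'dx) f'x.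
rewrite -/g => -[_]; rewrite -derive1E => ->.
by field; rewrite fx f'x.
Unshelve. all: by end_near. Qed.

Lemma hardy_derive1n (H : set (R -> R)) f n : hardy_field H -> H f -> H (f^`(n)%classic).
Proof.
by move=> hH Hf; elim: n => [//|n IH]; rewrite derive1nS; exact: (hardy_derive hH IH).2.
Qed.

Lemma deg_le f c l : deg f = c%:E -> `|f x| / x `^ l @[x --> +oo] --> (0 : R) -> c <= l.
Proof.
move=> fc fl; rewrite -lee_fin -fc; apply: ereal_inf_lbound.
by exists l.
Qed.

Lemma deg_witness f c p : deg f = c%:E -> c < p ->
  exists2 l, l < p & `|f x| / x `^ l @[x --> +oo] --> (0 : R).
Proof.
move=> fc cp; have : (deg f < p%:E)%E by rewrite fc lte_fin.
by move=> /ereal_inf_lt[_ [l fl <-]]; rewrite lte_fin => lp; exists l.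
Qed.

Lemma powR_div x y p : 0 < x -> 0 < y -> (x / y) `^ p = x `^ p / y `^ p.
Proof.
move=> x0 y0; have yp : y `^ p != 0 by rewrite gt_eqF ?powR_gt0.
by apply: (mulIf yp); rewrite mulfVK // -powRM ?divr_ge0 ?ltW // mulfVK // gt_eqF.
Qed.

Lemma powR_neg_cvg0 (s C : R) : 0 < s -> 0 <= C -> C / x `^ s @[x --> +oo] --> (0 : R).
Proof.
move=> s0 C0; apply/cvgrPdist_le => e e0; apply/near_pinftyP.
exists (Num.max 1 ((C / e) `^ s^-1)) => x; rewrite ge_max => /andP[x1 xC].
have x0 : 0 < x by lra.
rewrite sub0r normrN ger0_norm ?divr_ge0 ?powR_ge0 // ler_pdivrMr ?powR_gt0 // mulrC -ler_pdivrMr //.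
have -> : C / e = ((C / e) `^ s^-1) `^ s.
  by rewrite -powRrM mulVf ?gt_eqF // powRr1 // divr_ge0 // ltW.
by apply: ge0_ler_powR; rewrite ?nnegrE ?powR_ge0 // ltW.
Qed.

(** For [g = alpha / alpha'], an eventual bound [g x >= x / p] with [p < c] integrates to
    [alpha = O(x^p)], and [g x <= x / p] with [p > c] to [alpha >= C x^p] for some [C > 0]; both
    contradict the degree. As [g'] is eventually on one side of any constant, excluding these cases
    forces [g x / x --> 1 / c]. *)
Lemma hardy_logderive_deg (H : set (R -> R)) alpha c : hardy_field H -> H alpha -> 1 < c ->
  deg alpha = c%:E -> alpha x / x @[x --> +oo] --> +oo ->
  x * alpha^`()%classic x / alpha x @[x --> +oo] --> c.
Proof.
move=> hH Ha c1 degc /cvgryPge ay; have [ader Ha'] := hardy_derive hH Ha.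
have a_ge k : 0 <= k -> \forall x \near +oo, k * x <= alpha x.
  move=> k0; near=> x; have x1 : 1 <= x by near: x; exact: near_pinfty_ge.
  by rewrite -ler_pdivlMr; [near: x; exact: ay|lra].
have a0 : \forall x \near +oo, 0 < alpha x.
  near=> x; have x1 : 1 <= x by near: x; exact: near_pinfty_ge.
  have : 1 * x <= alpha x by near: x; exact: a_ge.
  lra.
have a'0 : \forall x \near +oo, 0 < alpha^`()%classic x.
  have bad : ~ \forall x \near +oo, alpha^`()%classic x <= 0.
    move=> /(@near_le_of_derive_le R alpha 0 1 ltr01 ader) h.
    have /near_pinftyP[a Pa] : \forall x \near +oo, [/\ alpha x <= 1 * x, 2 * x <= alpha x & 1 <= x].
      by near=> x; split; near: x => //; [exact: a_ge|exact: near_pinfty_ge].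
    by have [? ? ?] := Pa a (lexx _); lra.
  have [h|//|h] := hardy_near_sign hH Ha'; exfalso; apply: bad.
    by apply: filterS h => x ->.
  by apply: filterS h => x /ltW.
pose g x := alpha x / alpha^`()%classic x.
have a'n0 : \forall x \near +oo, alpha^`()%classic x != 0 by apply: filterS a'0 => x /gt_eqF ->.
have Hg : H g by exact: hardy_div.
have [gder Hg'] := hardy_derive hH Hg.
have c0 : 0 < c by lra.
have upper p : 0 < p -> p < c -> ~ \forall x \near +oo, p^-1 * x <= g x.
  move=> p0 pc h.
  have /near_pinftyP[a0' Pa] : \forall x \near +oo, [/\ 1 <= x, 0 < alpha x,
      is_derive x 1 alpha (alpha^`()%classic x) & x * alpha^`()%classic x <= p * alpha x].
    near=> x; have gx : p^-1 * x <= g x by near: x.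
    have a'x : 0 < alpha^`()%classic x by near: x.
    split; [by near: x; exact: near_pinfty_ge|by near: x| |].
      by apply: derivable_is_derive1; near: x; exact: ader.
    move: gx; rewrite /g ler_pdivlMr // -mulrA mulrC -ler_pdivlMr ?invr_gt0 // invrK.
    by rewrite [alpha x * _]mulrC.
  pose a := Num.max 1 a0'.
  have a1 : 0 < a by rewrite lt_max ltr01.
  have growth := @powR_growth_le R alpha (alpha^`()%classic) p a a1.
  pose l := (p + c) / 2; suff /(deg_le degc) : `|alpha x| / x `^ l @[x --> +oo] --> (0 : R).
    by rewrite /l; lra.
  have ps : 0 < (c - p) / 2 by lra.
  have C0 : 0 <= alpha a / a `^ p.
    rewrite divr_ge0 ?powR_ge0 // ltW //; have [] := Pa a; rewrite ?le_max ?lexx ?orbT //.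
  apply: (squeeze_cvgr _ (cvg_cst 0) (powR_neg_cvg0 ps C0)).
  near=> x; rewrite divr_ge0 ?normr_ge0 ?powR_ge0 //=.
  have ax : a <= x by near: x; exact: near_pinfty_ge.
  have x0 : 0 < x by exact: lt_le_trans ax.
  have [_ ax0 _ _] : [/\ 1 <= x, 0 < alpha x, is_derive x 1 alpha (alpha^`()%classic x) &
       x * alpha^`()%classic x <= p * alpha x].
    by apply: Pa; apply: le_trans ax; rewrite le_max lexx orbT.
  rewrite gtr0_norm // ler_pdivrMr ?powR_gt0 //.
  apply: le_trans (growth _ _ _ (lexx a) ax) _.
    by move=> t at_; have [|? ? ? ?] := Pa t; first by apply: le_trans at_; rewrite le_max lexx orbT.
  have xl : x `^ l = x `^ p * x `^ ((c - p) / 2).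
    by rewrite -powRD; [congr (_ `^ _); rewrite /l; lra|rewrite (gt_eqF x0) implybT].
  rewrite powR_div // xl le_eqVlt; apply/orP; left; apply/eqP; field.
  by rewrite !gt_eqF ?powR_gt0.
have lower p : c < p -> ~ \forall x \near +oo, g x <= p^-1 * x.
  move=> pc h; have p0 : 0 < p by lra.
  have /near_pinftyP[a0' Pa] : \forall x \near +oo, [/\ 1 <= x, 0 < alpha x,
      is_derive x 1 alpha (alpha^`()%classic x) & p * alpha x <= x * alpha^`()%classic x].
    near=> x; have gx : g x <= p^-1 * x by near: x.
    have a'x : 0 < alpha^`()%classic x by near: x.
    split; [by near: x; exact: near_pinfty_ge|by near: x| |].
      by apply: derivable_is_derive1; near: x; exact: ader.
    move: gx; rewrite /g ler_pdivrMr // -mulrA -ler_pdivrMl ?invr_gt0 // invrK //.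
  pose a := Num.max 1 a0'.
  have a1 : 0 < a by rewrite lt_max ltr01.
  have growth := @powR_growth_ge R alpha (alpha^`()%classic) p a a1.
  have [l lp] := deg_witness degc pc.
  have C0 : 0 < alpha a / a `^ p.
    rewrite divr_gt0 ?powR_gt0 //; have [] := Pa a; rewrite ?le_max ?lexx ?orbT //.
  move=> /cvgrPdist_lt /(_ _ C0) /near_pinftyP[a2 Pa2].
  pose x := Num.max a a2.
  have ax : a <= x by rewrite le_max lexx.
  have := Pa2 x; rewrite le_max lexx orbT => /(_ isT).
  have x0 : 0 < x by exact: lt_le_trans ax.
  have x1 : 1 <= x by apply: le_trans ax; rewrite le_max lexx.
  have [_ ax0 _ _] : [/\ 1 <= x, 0 < alpha x, is_derive x 1 alpha (alpha^`()%classic x) &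
       p * alpha x <= x * alpha^`()%classic x].
    by apply: Pa; apply: le_trans ax; rewrite le_max lexx orbT.
  rewrite sub0r normrN (gtr0_norm ax0) gtr0_norm ?divr_gt0 ?powR_gt0 // ltr_pdivrMr ?powR_gt0 //.
  apply/negP; rewrite -leNgt.
  apply: le_trans (growth _ _ _ (lexx a) ax); last first.
    by move=> t at_; have [|? ? ? ?] := Pa t; first by apply: le_trans at_; rewrite le_max lexx orbT.
  have fa0 : 0 <= alpha a / a `^ p by exact: ltW.
  by rewrite powR_div // [leRHS]mulrA [leRHS]mulrAC ler_wpM2l // ler_powR // ltW.
have gx : g x / x @[x --> +oo] --> c^-1.
  apply/cvgrPdist_le => e0' e0'0.
  (* The cap keeps [c^-1 - e] positive, so that its inverse can serve as an exponent. *)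
  pose e := Num.min e0' (c^-1 / 2).
  have ci0 : 0 < c^-1 by rewrite invr_gt0.
  have e0 : 0 < e by rewrite lt_min e0'0 divr_gt0.
  have ee : e <= e0' by rewrite ge_min lexx.
  have ec : e <= c^-1 / 2 by rewrite ge_min lexx orbT.
  (* Passing from [g'] to [g] costs some slope: [g'] is compared with [c^-1 + e / 2], which gives
     either the claim or [(c^-1 + e / 4) x <= g x], excluded by [upper]. *)
  have up : \forall x \near +oo, g x <= (c^-1 + e) * x.
    have e2 : c^-1 + e / 2 < c^-1 + e by lra.
    case: (hardy_near_le_or_ge hH (c^-1 + e / 2) Hg') => [h|]; last exact: near_le_of_derive_le.
    have e4 : c^-1 + e / 4 < c^-1 + e / 2 by lra.
    exfalso; apply: (upper (c^-1 + e / 4)^-1).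
    - by rewrite invr_gt0; lra.
    - by rewrite -[ltRHS]invrK ltf_pV2 ?posrE //; lra.
    - by rewrite invrK; exact: near_ge_of_derive_ge gder h.
  have lo : \forall x \near +oo, (c^-1 - e) * x <= g x.
    have e2 : c^-1 - e < c^-1 - e / 2 by lra.
    case: (hardy_near_le_or_ge hH (c^-1 - e / 2) Hg') => [|h]; first exact: near_ge_of_derive_ge.
    have e4 : c^-1 - e / 2 < c^-1 - e / 4 by lra.
    exfalso; apply: (lower (c^-1 - e / 4)^-1).
    - by rewrite -[ltLHS]invrK ltf_pV2 ?posrE //; lra.
    - by rewrite invrK; exact: near_le_of_derive_le gder h.
  near=> x; have x1 : 1 <= x by near: x; exact: near_pinfty_ge.
  have x0 : 0 < x by lra.
  have u : g x / x <= c^-1 + e by rewrite ler_pdivrMr //; near: x.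
  have v : c^-1 - e <= g x / x by rewrite ler_pdivlMr //; near: x.
  by rewrite ler_norml; apply/andP; split; lra.
have ci : c^-1 != 0 by rewrite invr_eq0 gt_eqF.
rewrite -[X in _ --> X]invrK; apply: cvg_trans (cvgV ci gx); apply: near_eq_cvg; near=> x.
have fx : 0 < alpha x by near: x.
have f'x : alpha^`()%classic x != 0 by near: x.
have x1 : 1 <= x by near: x; exact: near_pinfty_ge.
by rewrite /g /unstable.inv_fun; field; rewrite f'x !gt_eqF //; lra.
Unshelve. all: by end_near. Qed.

End HardyAsymptotics.

(** * Explicit growth inequalities for the function and its derivatives *)

Section Regularity.
Context {R : realType}.
Implicit Types (alpha : R -> R) (c x y : R).

Lemma near_forall_leq (P : nat -> R -> Prop) J :
  (forall j, \forall x \near +oo, P j x) ->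
  \forall x \near +oo, forall j, (j <= J)%N -> P j x.
Proof.
move=> nP; elim: J => [|J IH].
  by apply: filterS (nP 0%N) => x Px j; rewrite leqn0 => /eqP ->.
near=> x => j; rewrite leq_eqVlt => /predU1P[->|]; first by near: x.
by rewrite ltnS; move: j; near: x.
Unshelve. all: by end_near. Qed.

Definition falling c (j : nat) : R := \prod_(0 <= i < j) (c - i%:R).

Lemma falling_neq0 c j : c \isn't a Num.int -> falling c j != 0.
Proof.
move=> cZ; rewrite /falling prodf_seq_neq0; apply/allP => i _ /=.
by rewrite subr_eq0; apply: contraNneq cZ => ->; exact: natr_int.
Qed.

Lemma hardy_logderive_all (H : set (R -> R)) alpha c j : hardy_field H -> H alpha -> 1 < c ->
  c \isn't a Num.int -> deg alpha = c%:E -> alpha x / x @[x --> +oo] --> +oo ->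
  x * alpha^`(j.+1)%classic x / alpha^`(j)%classic x @[x --> +oo] --> c - j%:R.
Proof.
move=> hH Ha c1 cZ degc ay; elim: j => [|j IH].
  by rewrite subr0 derive1n1 derive1n0; exact: (hardy_logderive_deg hH).
rewrite -natr1 opprD addrA derive1nS.
apply: (hardy_logderive_step hH (hardy_derive1n _ hH Ha)).
  by rewrite subr_eq0; apply: contraNneq cZ => ->; exact: natr_int.
by rewrite -derive1nS.
Qed.

Lemma hardy_derive_asymptotic (H : set (R -> R)) alpha c j : hardy_field H -> H alpha -> 1 < c ->
  c \isn't a Num.int -> deg alpha = c%:E -> alpha x / x @[x --> +oo] --> +oo ->
  x ^+ j * alpha^`(j)%classic x / alpha x @[x --> +oo] --> falling c j.
Proof.
move=> hH Ha c1 cZ degc ay.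
have lim i := @hardy_logderive_all H alpha c i hH Ha c1 cZ degc ay.
have nz i : \forall x \near +oo, alpha^`(i)%classic x != 0.
  have ci : c - i%:R != 0 by rewrite subr_eq0; apply: contraNneq cZ => ->; exact: natr_int.
  apply: filterS (near_neq0_of_cvg ci (lim i)) => x.
  by apply: contra_neq => ->; rewrite invr0 mulr0.
elim: j => [|j IH].
  apply: cvg_near_cst; near=> x.
  have : alpha^`(0)%classic x != 0 by near: x; exact: nz.
  by rewrite derive1n0 expr0 mul1r /falling big_geq //= => ?; rewrite divff.
have -> : falling c j.+1 = (c - j%:R) * falling c j by rewrite /falling big_nat_recr //= mulrC.
apply: cvg_trans (cvgM (lim j) IH); apply: near_eq_cvg; near=> x.
have a0 : alpha^`(0)%classic x != 0 by near: x; exact: nz.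
have aj : alpha^`(j)%classic x != 0 by near: x; exact: nz.
rewrite derive1n0 in a0; rewrite /= exprS; field.
by rewrite a0.
Unshelve. all: by end_near. Qed.

(** The explicit form in which the sum estimates use the Hardy field hypotheses: everything holds
    from [a] on with one constant [K], and [eps j] is the sign of the derivative of order [j]. The
    exponents [c + 1 / 4], [c / 2] and [2 c] are crude substitutes for [c], whose slack the later
    constants absorb. *)
Record regular_growth alpha c (J : nat) (a K : R) (eps : nat -> R) : Prop := RegularGrowth {
  rg_a : 1 <= a;
  rg_K : 1 <= K;
  rg_eps : forall j, eps j = 1 \/ eps j = -1;
  rg_eps1 : eps 1%N = 1;
  rg_eps2 : eps 2%N = 1;
  rg_ge : forall x, a <= x -> x <= alpha x;
  rg_le : forall x, a <= x -> alpha x <= x `^ (c + 1 / 4);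
  rg_derive : forall x j, a <= x -> (j <= J)%N ->
    is_derive x 1 (alpha^`(j)%classic) (alpha^`(j.+1)%classic x);
  rg_size : forall x j, a <= x -> (j <= J)%N ->
    K^-1 * (alpha x / x ^+ j) <= eps j * alpha^`(j)%classic x <= K * (alpha x / x ^+ j);
  rg_ratio : forall x y, a <= x -> x <= y ->
    alpha x * (y / x) `^ (c / 2) <= alpha y <= alpha x * (y / x) `^ (2 * c) }.

Lemma hardy_regularity alpha c J : hardy_field_function alpha -> 1 < c ->
  c \isn't a Num.int -> deg alpha = c%:E -> alpha x / x @[x --> +oo] --> +oo ->
  exists a K eps, regular_growth alpha c J a K eps.
Proof.
move=> [H hH Ha] c1 cZ degc ay.
have lim j := @hardy_derive_asymptotic H alpha c j hH Ha c1 cZ degc ay.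
have fnz j : 0 < `|falling c j| by rewrite normr_gt0 falling_neq0.
(* Near infinity each normalised derivative is within half of its limit [falling c j]; this [K]
   dominates all the resulting bounds and their inverses. *)
pose K := 1 + \sum_(0 <= j < J.+1) (2 * `|falling c j| + 2 / `|falling c j|).
have Kj j : (j <= J)%N -> 2 * `|falling c j| <= K /\ 2 / `|falling c j| <= K.
  move=> jJ; have : 2 * `|falling c j| + 2 / `|falling c j| <= K.
    rewrite /K (bigD1_seq j) ?mem_index_iota ?iota_uniq //=.
    set S := (X in _ <= 1 + (_ + X)); have : 0 <= S; last by lra.
    by apply: sumr_ge0 => i _; rewrite addr_ge0 ?mulr_ge0 ?invr_ge0.
  have : 0 <= 2 / `|falling c j| by rewrite divr_ge0.
  have : 0 <= 2 * `|falling c j| by rewrite mulr_ge0.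
  by move=> ? ? ?; split; lra.
have K1 : 1 <= K.
  by rewrite lerDl sumr_ge0 // => i _; rewrite addr_ge0 ?mulr_ge0 ?invr_ge0.
have K0 : 0 < K by lra.
pose eps j := Num.sg (falling c j).
have epsP j : eps j = 1 \/ eps j = -1.
  rewrite /eps; case: (ltgtP (falling c j) 0) => [/ltr0_sg ->|/gtr0_sg ->|f0]; [by right|by left|].
  by have := fnz j; rewrite f0 normr0 ltxx.
have ge_x : \forall x \near +oo, x <= alpha x.
  near=> x; have x1 : 1 <= x by near: x; exact: near_pinfty_ge.
  have : 1 <= alpha x / x by near: x; move/cvgryPge: ay; exact.
  by rewrite ler_pdivlMr ?mul1r //; lra.
have le_x : \forall x \near +oo, alpha x <= x `^ (c + 1 / 4).
  have [l lc /cvgrPdist_le /(_ _ ltr01) hl] := deg_witness degc (ltac:(lra) : c < c + 1 / 4).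
  near=> x; have x1 : 1 <= x by near: x; exact: near_pinfty_ge.
  have x0 : 0 < x by lra.
  have : `|0 - `|alpha x| / x `^ l| <= 1 by near: x.
  rewrite sub0r normrN ger0_norm ?divr_ge0 ?powR_ge0 // ler_pdivrMr ?powR_gt0 // => h.
  apply: le_trans (ler_norm _) _; apply: le_trans h _.
  by rewrite [leLHS]mul1r ler_powR // ltW.
have der : \forall x \near +oo, forall j, (j <= J)%N ->
    is_derive (x : R) 1 (alpha^`(j)%classic) (alpha^`(j.+1)%classic x).
  apply: near_forall_leq => j; have [jd _] := hardy_derive hH (hardy_derive1n j hH Ha).
  by apply: filterS jd => x /derivable_is_derive1; rewrite derive1nS.
have size : \forall x \near +oo, forall j, (j <= J)%N ->
    K^-1 * (alpha x / x ^+ j) <= eps j * alpha^`(j)%classic x <= K * (alpha x / x ^+ j).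
  suff : \forall x \near +oo, forall j, (j <= J)%N -> (j <= J)%N ->
      K^-1 * (alpha x / x ^+ j) <= eps j * alpha^`(j)%classic x <= K * (alpha x / x ^+ j).
    by apply: filterS => x h j jJ; exact: h.
  apply: near_forall_leq => j; near=> x => jJ; have [K2 Ki] := Kj j jJ.
  have x1 : 1 <= x by near: x; exact: near_pinfty_ge.
  have ax : x <= alpha x by near: x.
  have x0 : 0 < x by lra.
  have xj : 0 < x ^+ j by rewrite exprn_gt0.
  have d0 : 0 < `|falling c j| / 2 by rewrite divr_gt0.
  have : `|falling c j - x ^+ j * alpha^`(j)%classic x / alpha x| <= `|falling c j| / 2.
    by near: x; move/cvgrPdist_le: (lim j); apply; rewrite divr_gt0.
  set t := _ / alpha x => tle.
  have et : `|falling c j| / 2 <= eps j * t /\ eps j * t <= 2 * `|falling c j|.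
    move: tle; rewrite /eps; case: (ltgtP (falling c j) 0) (fnz j) => [f0|f0|->]; last by rewrite normr0 ltxx.
      by rewrite ltr0_sg // (ltr0_norm f0) ler_norml => _ /andP[? ?]; split; lra.
    by rewrite gtr0_sg // (gtr0_norm f0) ler_norml => _ /andP[? ?]; split; lra.
  have aE : eps j * alpha^`(j)%classic x = (eps j * t) * (alpha x / x ^+ j).
    by rewrite /t; field; rewrite !gt_eqF //; lra.
  have q0 : 0 <= alpha x / x ^+ j by rewrite divr_ge0 ?ltW //; lra.
  rewrite aE; apply/andP; split; rewrite ler_wpM2r //; last by lra.
  apply: le_trans et.1; rewrite -[X in _ <= X]invrK lef_pV2 ?posrE ?invr_gt0 // invf_div.
  lra.
have c0 : 0 < c by lra.
have lim1 : \forall x \near +oo, c / 2 <= x * alpha^`()%classic x / alpha x <= 2 * c.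
  have /cvgrPdist_le/(_ (c / 2)) := hardy_logderive_deg hH Ha c1 degc ay.
  by move=> /(_ ltac:(lra)); apply: filterS => x; rewrite ler_norml => /andP[? ?]; lra.
have /near_pinftyP[a aP] : \forall x \near +oo, [/\ x <= alpha x, alpha x <= x `^ (c + 1 / 4),
    forall j, (j <= J)%N -> is_derive (x : R) 1 (alpha^`(j)%classic) (alpha^`(j.+1)%classic x),
    forall j, (j <= J)%N -> K^-1 * (alpha x / x ^+ j) <= eps j * alpha^`(j)%classic x <= K * (alpha x / x ^+ j)
    & c / 2 <= x * alpha^`()%classic x / alpha x <= 2 * c].
  by near=> x; split; near: x.
pose b := Num.max 1 a.
have b1 : 1 <= b by rewrite le_max lexx.
have ba x : b <= x -> 1 <= x /\ a <= x by rewrite ge_max => /andP.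
have b0 : 0 < b by lra.
have D x : b <= x -> [/\ 0 < alpha x, is_derive x 1 alpha (alpha^`()%classic x) &
     c / 2 * alpha x <= x * alpha^`()%classic x /\ x * alpha^`()%classic x <= 2 * c * alpha x].
  move=> bx; have [x1 ax] := ba x bx; have [h1 _ h2 _ /andP[h3 h4]] := aP x ax.
  have ax0 : 0 < alpha x by lra.
  split => //; first by have := h2 0%N isT; rewrite derive1n1 derive1n0.
  by split; [rewrite -ler_pdivlMr|rewrite -ler_pdivrMr].
exists b, K, eps; split => //.
- by rewrite /eps /falling big_nat1 subr0 gtr0_sg.
- by rewrite /eps /falling big_nat_recr //= big_nat1 subr0 gtr0_sg // mulr_gt0 // subr_gt0.
- by move=> x /ba[_ /aP[]].
- by move=> x /ba[_ /aP[]].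
- by move=> x j /ba[_ /aP[_ _ h _ _]]; exact: h.
- by move=> x j /ba[_ /aP[_ _ _ h _]]; exact: h.
move=> x y bx xy; apply/andP; split.
  by apply: (@powR_growth_ge R alpha (alpha^`()%classic) _ b b0 _ x y bx xy) => t bt; have [? ? [? ?]] := D t bt; split.
by apply: (@powR_growth_le R alpha (alpha^`()%classic) _ b b0 _ x y bx xy) => t bt; have [? ? [? ?]] := D t bt; split.
Unshelve. all: by end_near. Qed.

End Regularity.

(** * Exponential sums along a Hardy field function *)

Section ExponentialSums.
Context {R : realType}.
Implicit Types (f : nat -> R) (x y z lam Lam eps Z : R) (n N L k q : nat).
Local Notation normc := Normc.normc.

Lemma is_derive_shift1 (g : R -> R) x (v : R) : is_derive (x + 1) 1 g v ->
  is_derive x 1 (fun t => g (t + 1)) v.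
Proof.
move=> gv; have s : is_derive x 1 (fun t => t + 1) (1 : R).
  have := is_deriveD (is_derive_id x (1 : R)) (is_derive_cst (1 : R) x (1 : R)).
  by rewrite addr0.
by have := @is_derive1_comp R g (fun t => t + 1) x v 1 gv s; rewrite mulr1.
Qed.

(** Iterated mean value theorem, with [G] the sequence of successive derivatives. The induction
    replaces each [G i] by its increment over a unit step, which again forms such a sequence. *)
Lemma fdiff_iter_bounds q (G : nat -> R -> R) z n (a lo hi : R) :
  (forall x i, a <= x -> (i < q)%N -> is_derive x 1 (G i) (G i.+1 x)) -> a <= z + n%:R ->
  (forall y, z + n%:R <= y <= z + n%:R + q%:R -> lo <= G q y <= hi) ->
  lo <= iter q fdiff (fun m => G 0%N (z + m%:R)) n <= hi.
Proof.
elim: q G => [|q IH] G Gd an Gb; first by apply: Gb; rewrite addr0 lexx.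
pose G' i x := G i (x + 1) - G i x.
rewrite iterSr (_ : fdiff _ = fun m => G' 0%N (z + m%:R)); last first.
  by apply/funext => m; rewrite /fdiff /G' -natr1 addrA.
apply: IH => // [x i ax iq|y /andP[y1 y2]].
  apply: is_deriveB; last exact: Gd (ltnW _).
  by apply: is_derive_shift1; apply: Gd; [lra|exact: ltnW].
have ay : a <= y by lra.
have [w /andP[w1 w2]] := @mean_value R (G q) (G q.+1) y (y + 1) (ltac:(lra))
   (fun x h => Gd x q (le_trans ay (andP h).1) (ltnSn q)).
rewrite addrAC subrr add0r mulr1 /G' => ->.
by apply: Gb; rewrite -natr1 addrA; apply/andP; split; lra.
Qed.

Lemma fdiff_iter_scale (e : R) f m : iter m fdiff (fun n => e * f n) = (fun n => e * iter m fdiff f n).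
Proof.
by elim: m => [//|m IH]; rewrite iterS IH; apply/funext => n; rewrite iterS /fdiff mulrBr.
Qed.

Lemma normc_sum_cis_sign (e : R) f (n1 n2 : nat) : e = 1 \/ e = -1 ->
  normc (\sum_(n1 <= n < n2) cis (e * f n)) = normc (\sum_(n1 <= n < n2) cis (f n)).
Proof.
case=> ->; first by under eq_bigr do rewrite mul1r.
rewrite -normc_conj rmorph_sum; congr normc; apply: eq_bigr => n _.
by rewrite mulN1r; rewrite -[RHS]conjcK conj_cis.
Qed.

(* [8 * (2 ^ q.+1 - 2)] is the exponent of the product of the heights
   [Z ^ (8 * 2 ^ i)], [1 <= i <= q]. *)
Definition weyl_expo q := (7 + 8 * (2 ^ q.+1 - 2))%N.

Lemma weyl_expoS q : weyl_expo q.+1 = (weyl_expo q + 8 * 2 ^ q.+1)%N.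
Proof.
rewrite /weyl_expo [(2 ^ q.+2)%N]expnS; have : (2 <= 2 ^ q.+1)%N by rewrite -{1}[2%N]expn1 leq_exp2l.
lia.
Qed.

Lemma prod_weyl_heights (Z : nat) q :
  \prod_(0 <= i < q) ((Z ^ (8 * 2 ^ i.+1))%N%:R : R) = Z%:R ^+ (8 * (2 ^ q.+1 - 2)).
Proof.
elim: q => [|q IH]; first by rewrite big_geq // expn1 subnn muln0 expr0.
rewrite big_nat_recr //= IH natrX -exprD; congr (_ ^+ _).
have := weyl_expoS q; rewrite /weyl_expo; move: (2 ^ q.+2)%N (2 ^ q.+1)%N => u v h; apply/eqP; lia.
Qed.

Lemma harm_le_ln n : harm n.+2 <= 1 + ln n.+1%:R :> R.
Proof.
elim: n => [|n IH]; first by rewrite /harm big_nat1 invr1 ln1 addr0.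
rewrite /harm big_nat_recr //= -/(harm _).
have n0 : 0 < n.+2%:R :> R by [].
have /le_ln1Dx : -1 < - n.+2%:R^-1 :> R by rewrite ltrN2 invf_lt1 // ltr1n.
have -> : 1 + - n.+2%:R^-1 = n.+1%:R / n.+2%:R :> R.
  by rewrite -[in RHS](addrK 1 n.+1%:R) natr1 mulrBl mul1r divff // gt_eqF.
rewrite ln_div ?posrE // => h; move: h IH.
move: (ln n.+1%:R) (ln n.+2%:R) (n.+2%:R^-1) (harm n.+2) => *; lra.
Qed.

End ExponentialSums.

(** * Choice of the heights and saving of a factor [Z] *)

Section WeylSaving.
Context {R : realType}.
Implicit Types (f : nat -> R) (x y A B : R) (n N L Z k q : nat).
Local Notation normc := Normc.normc.

(** Used to absorb the constant and all logarithms from [harm] into one factor [Z]. For positive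
    exponents [ln x] is bounded through the root [y] of order [r], chosen so that the left side
    costs only [sqrt x] and the other [sqrt x] pays for the constant [D]. *)
Lemma polylog_le_id A B q : 0 <= A -> 0 <= B ->
  exists2 x0, 1 <= x0 & forall x, x0 <= x -> A * (1 + B * ln x) ^+ q <= x.
Proof.
move=> A0 B0; case: q => [|q].
  by exists (1 + A) => [|x]; rewrite ?lerDl // expr0 mulr1; lra.
pose r := (2 * q.+1)%N; pose D := A * (1 + B * r%:R) ^+ q.+1.
have D0 : 0 <= D by rewrite mulr_ge0 // exprn_ge0 // addr_ge0 // mulr_ge0.
exists ((1 + D) ^+ 2) => [|x xD]; first by rewrite expr_ge1 //; lra.
have x1 : 1 <= x by apply: le_trans xD; rewrite expr_ge1 //; lra.
pose y := x `^ (r%:R^-1).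
have y0 : 0 < y by rewrite powR_gt0 //; lra.
have yx : y ^+ r = x by rewrite -powR_mulrn ?(ltW y0) // -powRrM mulVf ?powRr1 ?pnatr_eq0 //; lra.
have y1 : 1 <= y by rewrite -[leLHS](powRr0 x) ler_powR // invr_ge0.
have lx : ln x <= r%:R * y.
  rewrite -{1}yx lnXn // -[_ *+ r]mulr_natl ler_wpM2l //.
  have := @le_ln1Dx R (y - 1); rewrite (_ : 1 + (y - 1) = y); last by ring.
  by move=> h; have := h ltac:(lra); lra.
have l0 : 0 <= ln x by rewrite ln_ge0.
have Dy : D <= y ^+ q.+1.
  rewrite -(@ler_pXn2r _ 2) ?nnegrE ?exprn_ge0 ?(ltW y0) // -exprM mulnC yx.
  by apply: le_trans xD; rewrite lerXn2r ?nnegrE //; lra.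
rewrite -[leRHS]yx /r mulnC exprM expr2.
apply: (@le_trans _ _ (D * y ^+ q.+1)); last by rewrite ler_wpM2r // exprn_ge0 // ltW.
rewrite /D -mulrA -exprMn ler_wpM2l //.
have Bl : B * ln x <= B * (r%:R * y) by rewrite ler_wpM2l.
have Bl0 : 0 <= B * ln x by rewrite mulr_ge0.
have Br : (1 + B * r%:R) * y = y + B * (r%:R * y) by ring.
by rewrite Br lerXn2r ?nnegrE //; lra.
Qed.

(** The upper condition on [k] keeps the fully differenced increments below 1: the 7 in [weyl_expo]
    is 6 for the [Z^6] in the upper bound plus 1 for [A <= Z]. The lower condition controls
    [1 / (N lam)]: the last term is at most [Z^(weyl_expo (q - 1) + 2)] divided by the product of
    the heights, and it is below [Z^(- 2^q)] because [9 + 2^q <= 8 * 2^q] for [q >= 1]. *)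
Lemma weyl_saving A q : 1 <= A -> exists2 C, 1 <= C & forall Z N k L f (e e' : R),
  C <= Z%:R -> (0 < q)%N -> (N ^ q <= k * Z ^ weyl_expo q.-1)%N ->
  (k * Z ^ weyl_expo q <= N ^ q.+1)%N -> (Z ^ (2 ^ (q + 4)) <= N)%N -> (L <= N)%N ->
  (0 < k)%N ->
  e = 1 \/ e = -1 -> e' = 1 \/ e' = -1 ->
  (forall n, (n < L)%N -> A^-1 * (k%:R / (Z%:R * N%:R ^+ q.+1)) <= e * iter q.+1 fdiff f n
      <= A * (k%:R * Z%:R ^+ 6 / N%:R ^+ q.+1)) ->
  (forall n, (n.+1 < L)%N -> 0 <= e' * (iter q.+1 fdiff f n.+1 - iter q.+1 fdiff f n)) ->
  normc (\sum_(0 <= n < L) cis (f n)) <= C * (N%:R / Z%:R).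
Proof.
move=> A1; have [C C0 HC] := @iterated_van_der_corput R q.
have [x0 x01 Hx] := @polylog_le_id A (8 * 2 ^ q)%:R q (ltac:(lra)) (ler0n _ _).
exists (1 + 2 * C + x0 + A) => [|Z N k L f e e' CZ q0 kl ku ZN LN k0 eP e'P fL fM]; first by lra.
have Z1 : 1 < Z%:R :> R by lra.
have Z0 : 0 < Z%:R :> R by lra.
have Z1' : (1 < Z)%N by rewrite -(ltr1n R).
have N0 : (0 < N)%N by apply: leq_trans ZN; rewrite expn_gt0 ltnW.
have N0' : 0 < N%:R :> R by rewrite ltr0n.
have k0' : 0 < k%:R :> R by rewrite ltr0n.
pose Hs i := (Z ^ (8 * 2 ^ i.+1))%N.
have Hs1 i : (1 < Hs i)%N by rewrite -{1}(expn0 Z) ltn_exp2l // muln_gt0 expn_gt0.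
have pq : (2 <= 2 ^ q)%N by rewrite -{1}[2%N]expn1 leq_exp2l.
have HsN i : (i < q)%N -> (Hs i <= N)%N.
  move=> iq; apply: leq_trans ZN; rewrite leq_exp2l //.
  apply: (@leq_trans (2 ^ 3 * 2 ^ q)); first by rewrite leq_mul2l leq_exp2l.
  by rewrite -expnD leq_exp2l //; lia.
pose l : R := 1 + (8 * 2 ^ q)%:R * ln Z%:R.
have harmH i : (i < q)%N -> harm (Hs i) <= l.
  move=> iq; have := Hs1 i; case E : (Hs i) => [|[|n]] // _; apply: le_trans (harm_le_ln n) _.
  rewrite lerD2l; apply: (@le_trans _ _ (ln (Hs i)%:R)).
    by rewrite E ler_ln ?posrE // ler_nat.
  rewrite /Hs natrX lnXn // -[ln _ *+ _]mulr_natl ler_wpM2r ?ln_ge0 ?(ltW Z1) // ler_nat leq_mul2l.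
  by rewrite leq_exp2l.
have l0 : 0 <= l by rewrite addr_ge0 // mulr_ge0 // ln_ge0 // ltW.
have AlZ : A * l ^+ q <= Z%:R by apply: Hx; lra.
set P := Z%:R ^+ (8 * (2 ^ q.+1 - 2)) : R.
have P0 : 0 < P by rewrite exprn_gt0.
have prodP : \prod_(0 <= i < q) (harm (Hs i) / (Hs i)%:R) <= l ^+ q / P.
  rewrite big_split /= prodfV (prod_weyl_heights Z q) -/P ler_pM2r ?invr_gt0 //.
  rewrite -[X in _ <= _ ^+ X]subn0 -prodr_const_nat.
  rewrite big_seq [leRHS]big_seq; apply: ler_prod => i; rewrite mem_index_iota => /andP[_ iq].
  by rewrite harm_ge0 harmH.
have lam0 : 0 < A^-1 * (k%:R / (Z%:R * N%:R ^+ q.+1)).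
  by rewrite mulr_gt0 ?invr_gt0 ?divr_gt0 ?mulr_gt0 ?exprn_gt0 //; lra.
have ee : e * e' = 1 \/ e * e' = -1.
  by case: eP => ->; case: e'P => ->; rewrite ?mul1r ?mulN1r ?opprK; [left|right|right|left].
have e2 : e * e = 1 by case: eP => ->; ring.
have := HC Hs Z%:R _ (A * (k%:R * Z%:R ^+ 6 / N%:R ^+ q.+1)) (e * e') N L (fun n => e * f n)
  (ltW Z1) N0 LN lam0 ee.
rewrite fdiff_iter_scale => /(_ _ _ fL).
have c1 i : (i < q)%N -> (0 < Hs i <= N)%N /\ Z%:R ^+ (2 ^ i.+1) <= (Hs i)%:R :> R.
  move=> iq; rewrite HsN // ltnW //; split => //.
  by rewrite /Hs natrX ler_weXn2l ?(ltW Z1) // leq_pmull.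
have c2 : A * (k%:R * Z%:R ^+ 6 / N%:R ^+ q.+1) * \prod_(0 <= i < q) (Hs i)%:R <= 1.
  rewrite prod_weyl_heights -/P.
  have -> : A * (k%:R * Z%:R ^+ 6 / N%:R ^+ q.+1) * P = A * (k%:R * (Z%:R ^+ 6 * P)) / N%:R ^+ q.+1 by ring.
  rewrite ler_pdivrMr ?exprn_gt0 // mul1r.
  apply: (@le_trans _ _ (k * Z ^ weyl_expo q)%:R); last by rewrite -natrX ler_nat.
  rewrite natrM natrX /weyl_expo exprD -/P (_ : 7 = 1 + 6)%N // exprD expr1.
  rewrite mulrCA ler_wpM2l // -[leRHS]mulrA ler_wpM2r ?mulr_ge0 ?exprn_ge0 //; lra.
have c3 n : (n.+1 < L)%N -> 0 <= e * e' * (e * iter q.+1 fdiff f n.+1 - e * iter q.+1 fdiff f n).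
  move=> nL; rewrite -mulrBr mulrACA e2 mul1r; exact: fM.
move=> /(_ c1 c2 c3); rewrite normc_sum_cis_sign //.
set S := normc _ => hS.
have S0 : 0 <= S / N%:R by rewrite divr_ge0 // normc_ge0.
have Zm : 0 < Z%:R ^+ (2 ^ q) :> R by rewrite exprn_gt0.
have second : (N%:R * (A^-1 * (k%:R / (Z%:R * N%:R ^+ q.+1))))^-1 *
    \prod_(0 <= i < q) (harm (Hs i) / (Hs i)%:R) <= (Z%:R ^+ (2 ^ q))^-1.
  have A0 : 0 < A by lra.
  have -> : (N%:R * (A^-1 * (k%:R / (Z%:R * N%:R ^+ q.+1))))^-1 = A * (Z%:R * (N%:R ^+ q / k%:R)).
    by rewrite exprS; field; rewrite !gt_eqF ?exprn_gt0.
  apply: (@le_trans _ _ (A * (Z%:R * Z%:R ^+ weyl_expo q.-1) * (l ^+ q / P))).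
    apply: ler_pM => //.
    - by rewrite !mulr_ge0 ?divr_ge0 ?exprn_ge0 // ltW.
    - by apply: prodr_ge0 => i _; rewrite divr_ge0 ?harm_ge0.
    rewrite ler_wpM2l ?(ltW A0) // ler_wpM2l ?(ltW Z0) // ler_pdivrMr // mulrC.
    by rewrite -!natrX -natrM ler_nat.
  rewrite -[leRHS]div1r ler_pdivlMr // -exprS.
  have -> : A * Z%:R ^+ (weyl_expo q.-1).+1 * (l ^+ q / P) * Z%:R ^+ (2 ^ q) =
     (A * l ^+ q) * Z%:R ^+ ((weyl_expo q.-1).+1 + 2 ^ q) / P by rewrite exprD; ring.
  rewrite ler_pdivrMr // mul1r.
  apply: (@le_trans _ _ (Z%:R * Z%:R ^+ ((weyl_expo q.-1).+1 + 2 ^ q))).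
    by rewrite ler_wpM2r // exprn_ge0 // ltW.
  rewrite -exprS ler_weXn2l ?(ltW Z1) // /weyl_expo prednK // expnS.
  by move: pq; move: (2 ^ q)%N => u; clear; lia.
have {}hS : (S / N%:R) ^+ (2 ^ q) <= ((1 + 2 * C) / Z%:R) ^+ (2 ^ q).
  apply: (le_trans hS); rewrite expr_div_n ler_pdivlMr //.
  apply: (@le_trans _ _ (C * (2 * (Z%:R ^+ (2 ^ q))^-1) * Z%:R ^+ (2 ^ q))).
    by rewrite ler_wpM2r ?(ltW Zm) // ler_wpM2l ?(ltW C0) //; lra.
  rewrite -!mulrA mulVf ?gt_eqF // mulr1.
  apply: (@le_trans _ _ ((1 + 2 * C) ^+ 1)); first by rewrite expr1; lra.
  by apply: ler_weXn2l; [lra|rewrite expn_gt0].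
have {}hS : S / N%:R <= (1 + 2 * C) / Z%:R.
  move: hS; rewrite ler_pXn2r ?nnegrE ?expn_gt0 //.
  by rewrite divr_ge0 ?(ltW Z0) //; lra.
move: hS; rewrite ler_pdivrMr // => hS; apply: (le_trans hS).
by rewrite mulrAC -mulrA ler_wpM2r ?divr_ge0 //; lra.
Qed.

Lemma weyl_saving_upto A Q : 1 <= A -> exists2 C, 1 <= C & forall q, (q <= Q)%N -> forall Z N k L f (e e' : R),
  C <= Z%:R -> (0 < q)%N -> (N ^ q <= k * Z ^ weyl_expo q.-1)%N ->
  (k * Z ^ weyl_expo q <= N ^ q.+1)%N -> (Z ^ (2 ^ (q + 4)) <= N)%N -> (L <= N)%N ->
  (0 < k)%N ->
  e = 1 \/ e = -1 -> e' = 1 \/ e' = -1 ->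
  (forall n, (n < L)%N -> A^-1 * (k%:R / (Z%:R * N%:R ^+ q.+1)) <= e * iter q.+1 fdiff f n
      <= A * (k%:R * Z%:R ^+ 6 / N%:R ^+ q.+1)) ->
  (forall n, (n.+1 < L)%N -> 0 <= e' * (iter q.+1 fdiff f n.+1 - iter q.+1 fdiff f n)) ->
  normc (\sum_(0 <= n < L) cis (f n)) <= C * (N%:R / Z%:R).
Proof.
move=> A1; elim: Q => [|Q [C C1 IH]].
  by exists 1 => // q; rewrite leqn0 => /eqP -> *.
have [C' C1' H'] := weyl_saving Q.+1 A1; exists (C + C') => [|q]; first by lra.
rewrite leq_eqVlt => /predU1P[->|qQ] Z N k L f e e' CZ; move=> *.
  apply: (@le_trans _ _ (C' * (N%:R / Z%:R))); last by rewrite ler_wpM2r ?divr_ge0 //; lra.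
  by apply: (H' _ _ k _ _ e e') => //; lra.
apply: (@le_trans _ _ (C * (N%:R / Z%:R))); last by rewrite ler_wpM2r ?divr_ge0 //; lra.
by apply: (IH q qQ _ _ k _ _ e e') => //; lra.
Qed.

End WeylSaving.

(** * Unweighted sums at high frequencies *)

Section RegularExponentialSums.
Context {R : realType} (alpha : R -> R) (c : R) (J : nat) (a K : R) (eps : nat -> R).
Context (rg : regular_growth alpha c J a K eps) (c_gt0 : 0 < c).
Implicit Types (x y z : R) (n j k N L : nat).
Local Notation normc := Normc.normc.

Lemma rg_gt0 x : a <= x -> 0 < alpha x.
Proof. by move: (rg_a rg) => a1 ax; have := rg_ge rg ax; lra. Qed.

Lemma rg_homo x y : a <= x -> x <= y -> alpha x <= alpha y.
Proof.
move: (rg_a rg) (rg_K rg) c_gt0 => a1 K1 c0.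
move=> ax xy; have /andP[+ _] := rg_ratio rg ax xy; apply: le_trans.
have x0 : 0 < x by lra.
have yx1 : 1 <= y / x by rewrite ler_pdivlMr // mul1r.
by rewrite ler_peMr ?(ltW (rg_gt0 ax)) // -[leLHS](powRr0 (y / x)) ler_powR //; lra.
Qed.

Lemma rg_double x y : a <= x -> x <= y -> y <= 2 * x -> alpha y <= 2 `^ (2 * c) * alpha x.
Proof.
move: (rg_a rg) (rg_K rg) c_gt0 => a1 K1 c0.
move=> ax xy y2; have /andP[_ h] := rg_ratio rg ax xy; apply: (le_trans h).
rewrite mulrC ler_wpM2r ?(ltW (rg_gt0 ax)) //.
have x0 : 0 < x by lra.
have yx2 : y / x <= 2 by rewrite ler_pdivrMr.
have yx0 : 0 <= y / x by rewrite divr_ge0 //; lra.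
by apply: ge0_ler_powR; rewrite ?nnegrE //; lra.
Qed.

Lemma rg_fdiff j z n (lo hi : R) : (j <= J)%N -> a <= z + n%:R ->
  (forall y, z + n%:R <= y <= z + n%:R + j%:R -> lo <= eps j * alpha^`(j)%classic y <= hi) ->
  lo <= eps j * iter j fdiff (fun m => alpha (z + m%:R)) n <= hi.
Proof.
move: (rg_a rg) (rg_K rg) c_gt0 => a1 K1 c0.
move=> jJ an h; have := @fdiff_iter_bounds R j (fun i x => eps j * alpha^`(i)%classic x) z n a lo hi.
rewrite derive1n0 fdiff_iter_scale; apply => // x i ax ij.
exact: (is_deriveZ (eps j) (rg_derive rg ax (leq_trans (ltnW ij) jJ))).
Qed.

Lemma rg_fdiff_ge0 j z n : (j <= J)%N -> a <= z + n%:R ->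
  0 <= eps j * iter j fdiff (fun m => alpha (z + m%:R)) n.
Proof.
move: (rg_a rg) (rg_K rg) c_gt0 => a1 K1 c0.
move=> jJ an; have := @rg_fdiff j z n 0 (K * alpha (z + n%:R + j%:R)) jJ an; case/(_ _)/andP => // y /andP[y1 y2].
have ay : a <= y by lra.
have y0 : 1 <= y ^+ j by rewrite exprn_ege1 //; lra.
have a0 := rg_gt0 ay; have /andP[h1 h2] := rg_size rg ay jJ; apply/andP; split.
  by apply: le_trans h1; rewrite mulr_ge0 ?invr_ge0 ?divr_ge0 //; lra.
apply: (le_trans h2); rewrite ler_wpM2l //; first by lra.
apply: (@le_trans _ _ (alpha y)); last exact: rg_homo.
by rewrite ler_pdivrMr ?ler_peMr //; lra.
Qed.

Definition rg_weight n : R := alpha n.+1%:R - alpha n%:R.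

Lemma rg_weight_ge0 n : a <= n%:R -> 0 <= rg_weight n.
Proof. by move=> an; rewrite subr_ge0 rg_homo // ler_nat. Qed.

Lemma rg_weight_homo n : (2 <= J)%N -> a <= n%:R -> rg_weight n <= rg_weight n.+1.
Proof.
move: (rg_a rg) (rg_K rg) c_gt0 => a1 K1 c0.
move=> J2 an; have := @rg_fdiff_ge0 2 0 n J2; rewrite add0r => /(_ an).
by rewrite (rg_eps2 rg) mul1r /= /fdiff /rg_weight !add0r; lra.
Qed.

Lemma rg_weight_le n N : (2 <= J)%N -> a <= n%:R -> (n <= N)%N ->
  rg_weight n <= K * 2 `^ (2 * c) * (alpha N%:R / N%:R).
Proof.
move: (rg_a rg) (rg_K rg) c_gt0 => a1 K1 c0.
move=> J2 an nN; have aN : a <= N%:R by apply: (le_trans an); rewrite ler_nat.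
have N0 : 0 < N%:R :> R by lra.
apply: (@le_trans _ _ (rg_weight N)).
  elim: N nN aN N0 => [|N IH]; first by rewrite leqn0 => /eqP ->.
  rewrite leq_eqVlt => /predU1P[-> //|nN] _ _.
  have aN : a <= N%:R by apply: (le_trans an); rewrite ler_nat.
  apply: le_trans (IH nN aN _) (rg_weight_homo J2 aN); lra.
have := @rg_fdiff 1 0 N 0 (K * 2 `^ (2 * c) * (alpha N%:R / N%:R)) (ltnW J2).
rewrite add0r (rg_eps1 rg) mul1r /= /fdiff !add0r => /(_ aN); case/(_ _)/andP => // y /andP[y1 y2].
have ay : a <= y by lra.
have a0 := rg_gt0 ay; have /andP[h1 h2] := rg_size rg ay (ltnW J2).
rewrite (rg_eps1 rg) !expr1 in h1 h2; apply/andP; split.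
  by apply: le_trans h1; rewrite mulr_ge0 ?invr_ge0 ?divr_ge0 //; lra.
apply: (le_trans h2); rewrite -mulrA ler_wpM2l //; first by lra.
rewrite mulrA; apply: ler_pM; rewrite ?invr_ge0 ?(ltW a0) //; first by lra.
  by apply: rg_double => //; lra.
by rewrite lef_pV2 ?posrE //; lra.
Qed.

(** Origin of the [Z^6]: between [N1] and [N] the function grows at most by the factor [Z] and at
    least like the power [c / 2], while [Q + 1 <= 3 c = 6 (c / 2)]. *)
Lemma rg_interval_ratio (N1 N Z P : nat) (Q : nat) : Q.+1%:R <= 3 * c -> a <= N1%:R -> (N1 <= N)%N ->
  (0 < Z)%N -> (0 < P)%N -> P%:R / Z%:R <= alpha N1%:R -> alpha N%:R <= P%:R ->
  forall q, (q <= Q)%N -> (N%:R / N1%:R) ^+ q.+1 <= Z%:R ^+ 6 :> R.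
Proof.
move: (rg_a rg) (rg_K rg) c_gt0 => a1 K1 c0.
move=> Qc aN1 N1N Z0 P0 aPZ aP q qQ.
have N10 : 0 < N1%:R :> R by lra.
have N1N' : N1%:R <= N%:R :> R by rewrite ler_nat.
have Z0' : 0 < Z%:R :> R by rewrite ltr0n.
have P0' : 0 < P%:R :> R by rewrite ltr0n.
pose r : R := N%:R / N1%:R.
have r1 : 1 <= r by rewrite ler_pdivlMr // mul1r.
have rZ : r `^ (c / 2) <= Z%:R.
  have /andP[h _] := rg_ratio rg aN1 N1N'.
  have PZ0 : 0 < P%:R / Z%:R :> R by rewrite divr_gt0.
  rewrite -(ler_pM2l PZ0) mulfVK ?gt_eqF //; apply: le_trans aP; apply: le_trans h.
  by rewrite ler_wpM2r // powR_ge0.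
apply: (@le_trans _ _ (r ^+ Q.+1)); first by rewrite ler_weXn2l.
rewrite -powR_mulrn; last by lra.
apply: (@le_trans _ _ (r `^ (c / 2 * 6%:R))); first by rewrite ler_powR //; lra.
rewrite powRrM powR_mulrn ?powR_ge0 // lerXn2r ?nnegrE ?powR_ge0 //; lra.
Qed.

(** The difference is controlled by derivative values at points that may overshoot [N], but stay
    below [2 N]; hence the powers of 2 on both sides. *)
Lemma rg_fdiff_size q n N1 N (Z P : R) : (q.+1 <= J)%N -> a <= N1%:R -> (N1 <= N)%N ->
  n%:R + N1%:R + 1 <= N%:R :> R -> q.+1%:R + 1 <= N%:R :> R -> 0 < Z -> 0 < P ->
  P / Z <= alpha N1%:R -> alpha N%:R <= P ->
  (N%:R / N1%:R) ^+ q.+1 <= Z ^+ 6 ->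
  K^-1 * (P / (Z * (2 * N%:R) ^+ q.+1)) <=
  eps q.+1 * iter q.+1 fdiff (fun m => alpha (N1%:R + m%:R)) n <=
  K * (2 `^ (2 * c) * P * Z ^+ 6 / N%:R ^+ q.+1).
Proof.
move: (rg_a rg) (rg_K rg) c_gt0 => a1 K1 c0 qJ aN1 N1N nN qN Z0 P0 aPZ aP ratio.
have N1N' : N1%:R <= N%:R :> R by rewrite ler_nat.
have N0 : 0 < N%:R :> R by lra.
have N10 : 0 < N1%:R :> R by lra.
have c2 : 0 < 2 `^ (2 * c) :> R by rewrite powR_gt0.
have an : a <= N1%:R + n%:R by apply: (le_trans aN1); rewrite lerDl.
apply: rg_fdiff => // y /andP[y1 y2].
have yN1 : N1%:R <= y by apply: le_trans y1; rewrite lerDl.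
have ay : a <= y by lra.
have y0 : 0 < y by lra.
have y2N : y <= 2 * N%:R by lra.
have /andP[h1 h2] := rg_size rg ay qJ; apply/andP; split.
  apply: le_trans h1; rewrite ler_wpM2l ?invr_ge0 //; first by lra.
  rewrite invfM mulrA; apply: ler_pM.
  - by rewrite divr_ge0 // ltW.
  - by rewrite invr_ge0 exprn_ge0 // mulr_ge0 // ltW.
  - by apply: (le_trans aPZ); apply: rg_homo.
  - by rewrite lef_pV2 ?posrE ?exprn_gt0 ?mulr_gt0 // lerXn2r ?nnegrE //; lra.
apply: (le_trans h2); rewrite ler_wpM2l //; first by lra.
have aN : a <= N%:R by lra.
have ayP : alpha y <= 2 `^ (2 * c) * P.
  apply: (@le_trans _ _ (2 `^ (2 * c) * alpha N%:R)); last by rewrite ler_wpM2l // ltW.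
  case: (leP y N%:R) => yN; last by apply: rg_double => //; exact: ltW.
  apply: (le_trans (rg_homo ay yN)); rewrite ler_peMl ?(ltW (rg_gt0 aN)) //.
  by rewrite -[leLHS](powRr0 2) ler_powR //; lra.
have yZ : (y ^+ q.+1)^-1 <= Z ^+ 6 / N%:R ^+ q.+1.
  rewrite ler_pdivlMr ?exprn_gt0 // mulrC; apply: le_trans ratio.
  rewrite expr_div_n ler_wpM2l ?exprn_ge0 ?(ltW N0) // lef_pV2 ?posrE ?exprn_gt0 //.
  by rewrite lerXn2r ?nnegrE ?(ltW N10) ?(ltW y0).
rewrite -[X in _ <= X]mulrA; apply: ler_pM => //.
  exact: ltW (rg_gt0 ay).
by rewrite invr_ge0 exprn_ge0 // ltW.
Qed.

(** Uniformity in the endpoint [n2] prepares partial summation against the weights. As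
    [weyl_expo 0 = 7], the assumption [N < k Z^7] excludes [q = 0], and minimality of [q] is
    precisely the lower condition on [k] in [weyl_saving]. *)
Lemma rg_high_frequency Q : (Q.+2 <= J)%N -> Q.+1%:R <= 3 * c ->
  exists2 C, 1 <= C & forall Z N N1 P k : nat, C <= Z%:R -> a <= N1%:R -> (N1 <= N)%N ->
    (Q.+2 <= N)%N -> (0 < P)%N -> P%:R / Z%:R <= alpha N1%:R -> alpha N%:R <= P%:R ->
    (Z ^ (2 ^ (Q + 4)) <= N)%N -> (N < k * Z ^ 7)%N -> (k * Z ^ weyl_expo Q <= N ^ Q.+1)%N ->
    forall n2, (N1 <= n2 <= N)%N ->
    normc (\sum_(N1 <= n < n2) cis (pi *+ 2 / P%:R * k%:R * alpha n%:R)) <= C * (N%:R / Z%:R).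
Proof.
move: (rg_a rg) (rg_K rg) c_gt0 => a1 K1 c0.
move=> QJ Qc; have pi0 := @pi_gt0 R.
(* 8 dominates [2 pi], from [t P = 2 pi k]; the two powers of 2 come from the bounds of
   [rg_fdiff_size]. *)
pose A := 8 * K * (2 ^+ Q.+1 + 2 `^ (2 * c)).
have c2 : 0 < 2 `^ (2 * c) :> R by rewrite powR_gt0.
have c21 : 1 <= 2 ^+ Q.+1 :> R by rewrite exprn_ege1 //; lra.
have A8 : 8 * K * 2 ^+ Q.+1 <= A by rewrite ler_wpM2l //; lra.
have A9 : 8 * K * 2 `^ (2 * c) <= A by rewrite ler_wpM2l //; lra.
have A1 : 1 <= A by apply: le_trans A8; nra.
have [C C1 HC] := weyl_saving_upto Q A1.
exists C => // Z N N1 P k CZ aN1 N1N QN P0 aPZ aP ZN kl ku n2 /andP[n21 n2N].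
have Z0' : 0 < Z%:R :> R by lra.
have Z0 : (0 < Z)%N by rewrite -(ltr0n R).
have P0' : 0 < P%:R :> R by rewrite ltr0n.
have k0 : (0 < k)%N by case: k kl {ku}.
have k0' : 0 < k%:R :> R by rewrite ltr0n.
have N10 : 0 < N1%:R :> R by lra.
have N1N' : N1%:R <= N%:R :> R by rewrite ler_nat.
have N0 : 0 < N%:R :> R by lra.
have ratio := rg_interval_ratio Qc aN1 N1N Z0 P0 aPZ aP.
have ex : exists q, (k * Z ^ weyl_expo q <= N ^ q.+1)%N by exists Q.
case: (ex_minnP ex) => q qP qmin; have qQ : (q <= Q)%N by exact: qmin.
have q0 : (0 < q)%N.
  rewrite lt0n; apply/eqP => qE; move: qP; rewrite qE expn1 leqNgt (_ : weyl_expo 0 = 7)%N // kl //.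
have ql : (N ^ q <= k * Z ^ weyl_expo q.-1)%N.
  rewrite leqNgt; apply/negP => /ltnW h.
  have := qmin q.-1; rewrite prednK // => /(_ h); rewrite leqNgt prednK // leqnn //.
have qJ : (q.+2 <= J)%N by apply: leq_trans QJ; rewrite !ltnS.
set t := pi *+ 2 / P%:R * k%:R.
have t0 : 0 < t by rewrite mulr_gt0 // divr_gt0 // mulr2n addr_gt0.
pose g m := alpha (N1%:R + m%:R).
have <- : \sum_(0 <= n < n2 - N1) cis (t * g n) = \sum_(N1 <= n < n2) cis (t * alpha n%:R).
  by rewrite -{2}[N1]add0n big_addn; apply: eq_bigr => m _; rewrite /g -natrD addnC.
have ZqN : (Z ^ (2 ^ (q + 4)) <= N)%N.
  by apply: leq_trans ZN; rewrite leq_pexp2l // leq_pexp2l // leq_add2r.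
have tP : t * P%:R = 2 * pi * k%:R by rewrite /t -mulr_natr; field; rewrite gt_eqF.
have pi4 : pi <= 4 :> R by have := @pihalf_lt2 R; lra.
have pi2 : 2 <= pi :> R by exact: pi_ge2.
apply: (HC q qQ Z N k (n2 - N1)%N (fun n => t * g n) (eps q.+1) (eps q.+2)) => //.
- by rewrite leq_subLR (leq_trans n2N) // leq_addl.
- exact: (rg_eps rg).
- exact: (rg_eps rg).
- move=> n nL; rewrite (fdiff_iter_scale t g q.+1) [eps q.+1 * _]mulrCA.
  have an : a <= N1%:R + n%:R by apply: (le_trans aN1); rewrite lerDl.
  have nN : n%:R + N1%:R + 1 <= N%:R :> R by rewrite -natrD natr1 ler_nat; move: nL n2N n21; clear; lia.
  have qN : q.+1%:R + 1 <= N%:R :> R by rewrite natr1 ler_nat; move: qQ QN; clear; lia.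
  have /andP[] := rg_fdiff_size (ltnW qJ) aN1 N1N nN qN Z0' P0' aPZ aP (ratio q qQ).
  move=> h1 h2; apply/andP; split.
    apply: (@le_trans _ _ (t * (K^-1 * (P%:R / (Z%:R * (2 * N%:R) ^+ q.+1))))); last by rewrite ler_pM2l.
    have -> : t * (K^-1 * (P%:R / (Z%:R * (2 * N%:R) ^+ q.+1))) =
        (2 * pi / (K * 2 ^+ q.+1)) * (k%:R / (Z%:R * N%:R ^+ q.+1)).
      transitivity ((t * P%:R) * (K^-1 / (Z%:R * (2 * N%:R) ^+ q.+1))); first by ring.
      rewrite tP exprMn; field; rewrite !gt_eqF ?exprn_gt0 //; clear -K1 alpha c J a K eps rg c_gt0; lra.
    rewrite ler_wpM2r ?divr_ge0 ?mulr_ge0 ?exprn_ge0 ?(ltW N0) //.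
    have K2 : 0 < K * 2 ^+ q.+1 by rewrite mulr_gt0 ?exprn_gt0 //; clear -K1 alpha c J a K eps rg c_gt0; lra.
    apply: (@le_trans _ _ (K * 2 ^+ q.+1)^-1); last by rewrite ler_peMl ?invr_ge0 ?(ltW K2) //; clear -pi2 alpha c J a K eps rg c_gt0; lra.
    rewrite lef_pV2 ?posrE //; last by clear -A1 alpha c J a K eps rg c_gt0; lra.
    apply: le_trans A8; apply: ler_pM; rewrite ?exprn_ge0 //; try by clear -K1 alpha c J a K eps rg c_gt0; lra.
    by rewrite ler_weXn2l // ?ltnS //; clear -alpha c J a K eps rg c_gt0; lra.
  apply: (@le_trans _ _ (t * (K * (2 `^ (2 * c) * P%:R * Z%:R ^+ 6 / N%:R ^+ q.+1)))); first by rewrite ler_pM2l.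
  have -> : t * (K * (2 `^ (2 * c) * P%:R * Z%:R ^+ 6 / N%:R ^+ q.+1)) =
      (2 * pi * K * 2 `^ (2 * c)) * (k%:R * Z%:R ^+ 6 / N%:R ^+ q.+1).
    transitivity ((t * P%:R) * (K * (2 `^ (2 * c) * Z%:R ^+ 6 / N%:R ^+ q.+1))); first by ring.
    by rewrite tP; ring.
  rewrite ler_wpM2r ?divr_ge0 ?mulr_ge0 ?exprn_ge0 ?(ltW N0) //.
  apply: le_trans A9; rewrite ler_wpM2r ?(ltW c2) // ler_wpM2r //; clear -pi4 K1 alpha c J a K eps rg c_gt0; lra.
move=> n nL; rewrite !(fdiff_iter_scale t g q.+1) -mulrBr mulrCA mulr_ge0 ?(ltW t0) //.
have := @rg_fdiff_ge0 q.+2 N1%:R n qJ; rewrite iterS {1}/fdiff; apply.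
by apply: (le_trans aN1); rewrite lerDl.
Qed.

End RegularExponentialSums.

(** * Taylor bounds on the circle and partial summation *)

Section CisEstimates.
Context {R : realType}.
Implicit Types (x y d : R).
Local Notation normc := Normc.normc.

Lemma normc_le_add x y : normc (x +i* y)%C <= `|x| + `|y|.
Proof.
have -> : (x +i* y)%C = (x%:C + 'i * y%:C)%C by simpc.
apply: le_trans (le_normcD _ _) _.
by rewrite Normc.normcM !normc_real /= expr0n expr1n add0r sqrtr1 mul1r.
Qed.

Lemma normc_cisB x y : normc (cis x - cis y) <= 2 * `|x - y|.
Proof.
pose d := x - y; have -> : cis x - cis y = cis y * (cis d - 1).
  by rewrite mulrBr -cisD mulr1; congr (cis _ - _); rewrite /d; ring.
rewrite Normc.normcM normc_cis mul1r.
have -> : cis d - 1 = ((cos d - 1) +i* sin d)%C by apply/eqP; rewrite eq_complex /= subr0 !eqxx.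
apply: le_trans (normc_le_add _ _) _; rewrite mulr_natl mulr2n.
have nsin (t : R) : `|sin t| <= `|t|.
  case: (ger0P t) => t0; first exact: norm_sin_le.
  by rewrite -normrN -sinN norm_sin_le // oppr_ge0 ltW.
apply: lerD (nsin d).
have -> : cos d = cos (d / 2 *+ 2) by congr cos; rewrite -mulr_natr mulfVK.
have h := nsin (d / 2); rewrite normrM (@ger0_norm _ 2^-1) // in h.
have s1 : `|sin (d / 2)| <= 1 by rewrite ler_norml sin_geN1 sin_le1.
rewrite cos_mulr2n cos2sin2 -(real_normK (num_real (sin _))).
have : `|sin (d / 2)| ^+ 2 <= `|sin (d / 2)| by rewrite expr2 ler_piMl.
have := sqr_ge0 (`|sin (d / 2)|).
by move=> *; rewrite ler_norml; apply/andP; split; lra.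
Qed.

Lemma normc_cis_taylor x : 0 <= x <= 1 -> normc (cis x - 1 - 'i%C * (x%:C)%C) <= x ^+ 2.
Proof.
move=> /andP[x0 x1].
have -> : cis x - 1 - 'i%C * (x%:C)%C = ((cos x - 1) +i* (sin x - x))%C.
  by apply/eqP; rewrite eq_complex /=; apply/andP; split; apply/eqP; ring.
apply: le_trans (normc_le_add _ _) _.
have c1 : `|cos x - 1| <= x ^+ 2 / 2.
  by have := cos_ge_quad x0; have := cos_le1 x; rewrite ler_norml => *; apply/andP; split; lra.
suff : `|sin x - x| <= x ^+ 2 / 2 by lra.
move: x0; rewrite le_eqVlt => /predU1P[<-|x0]; first by rewrite sin0 subrr normr0 expr0n mul0r.
have [y /andP[y0 yx]] := mean_value x0 (fun y _ => is_derive_sin y).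
rewrite sin0 !subr0 => ->.
have yq := cos_ge_quad (ltW y0); have y1 := cos_le1 y.
have -> : cos y * x - x = - ((1 - cos y) * x) by ring.
rewrite normrN ger0_norm ?mulr_ge0 ?subr_ge0 ?(ltW x0) //.
have : (1 - cos y) * x <= (y ^+ 2 / 2) * 1.
  by apply: ler_pM; rewrite ?subr_ge0 ?(ltW x0) //; lra.
have : y ^+ 2 <= x ^+ 2 by rewrite lerXn2r ?nnegrE ?(ltW y0) ?(ltW x0) ?(ltW yx).
lra.
Qed.

Lemma normc_weighted_sum (z : nat -> R[i]) (w : nat -> R) (n1 n2 : nat) (B : R) : (n1 <= n2)%N -> 0 <= B ->
  (forall m : nat, (n1 <= m <= n2)%N -> normc (\sum_(n1 <= n < m) z n) <= B) ->
  (forall n : nat, (n1 <= n)%N -> 0 <= w n) -> (forall n : nat, (n1 <= n)%N -> w n <= w n.+1) ->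
  normc (\sum_(n1 <= n < n2) (w n)%:C%C * z n) <= 2 * w n2 * B.
Proof.
rewrite leq_eqVlt => /predU1P[-> B0 zB w0 wh|n12 B0 zB w0 wh].
  by rewrite big_geq // Normc.normc0 !mulr_ge0 // w0.
pose L := (n2 - n1.+1)%N; pose z' m := \sum_(n1 <= n < n1 + m) z n.
have n2E : n2 = (n1 + L.+1)%N by rewrite /L; lia.
have -> : \sum_(n1 <= n < n2) (w n)%:C%C * z n = \sum_(0 <= m < L.+1) (z' m.+1 - z' m) * (w (n1 + m)%N)%:C%C.
  rewrite n2E -{1}[n1]add0n big_addn addKn; apply: eq_bigr => m _.
  by rewrite /z' addnS big_nat_recr /= ?leq_addr // addrAC subrr add0r mulrC addnC.
rewrite (sum_by_parts z' (fun m => (w (n1 + m)%N)%:C%C)).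
have z'0 : z' 0%N = 0 by rewrite /z' addn0 big_geq.
have z'B m : (m <= L.+1)%N -> normc (z' m) <= B by move=> mL; apply: zB; rewrite n2E leq_addr leq_add2l.
have wn2 : w (n1 + L)%N <= w n2 by rewrite n2E addnS wh // leq_addr.
have wL0 : 0 <= w (n1 + L)%N by rewrite w0 // leq_addr.
have w10 := w0 n1 (leqnn _).
rewrite z'0 mul0r subr0; apply: le_trans (le_normcD _ _) _; rewrite normcN.
have -> : 2 * w n2 * B = B * w n2 + w n2 * B by ring.
apply: lerD.
  rewrite Normc.normcM normc_real ger0_norm //; apply: ler_pM => //; last exact: z'B.
  exact: normc_ge0.
apply: le_trans (ler_normc_sum _ _ _) _.
apply: (@le_trans _ _ (\sum_(0 <= m < L) (w (n1 + m.+1)%N - w (n1 + m)%N) * B)).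
  apply: ler_sum_nat => m /andP[_ mL]; rewrite -rmorphB Normc.normcM normc_real ger0_norm; last first.
    by rewrite subr_ge0 addnS wh // leq_addr.
  by rewrite mulrC ler_wpM2l ?subr_ge0 ?addnS ?wh ?leq_addr //; apply: z'B; rewrite ltnS ltnW.
rewrite -mulr_suml (telescope_sumr (fun m => w (n1 + m)%N)) // addn0 ler_wpM2r //; lra.
Qed.

End CisEstimates.

(** * Weighted sums at all frequencies *)

Section AllFrequencies.
Context {R : realType} (alpha : R -> R) (c : R) (J : nat) (a K : R) (eps : nat -> R).
Context (rg : regular_growth alpha c J a K eps) (c_gt0 : 0 < c) (J2 : (2 <= J)%N).
Implicit Types (x y z : R) (n j k N L : nat).
Local Notation normc := Normc.normc.
Local Notation w := (rg_weight alpha).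

(** With [t = 2 pi k / P], the increment of [cis (t alpha n)] is [cis (t alpha n) * i t w n] up to
    [(t w n)^2], so [i t] times the sum telescopes. The end values are compared with [cis (t P) = 1]
    and [cis 0 = 1], which gives the first two terms; the quadratic errors add up to at most
    [t^2 W P], the third. *)
Lemma rg_low_frequency (Z N N1 P k : nat) (W : R) : a <= N1%:R -> (N1 <= N)%N -> (0 < P)%N -> (0 < k)%N ->
  alpha N%:R <= P%:R ->
  (forall n, (N1 <= n <= N)%N -> w n <= W) -> pi *+ 2 / P%:R * k%:R * W <= 1 ->
  normc (\sum_(N1 <= n < N) (w n)%:C%C * cis (pi *+ 2 / P%:R * k%:R * alpha n%:R)) <=
  2 * (P%:R - alpha N%:R) + 2 * alpha N1%:R + pi *+ 2 * k%:R * W.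
Proof.
move: (rg_a rg) => a1 aN1 N1N P0 k0 aP wW tW.
have P0' : 0 < P%:R :> R by rewrite ltr0n.
have k0' : 0 < k%:R :> R by rewrite ltr0n.
set t := pi *+ 2 / P%:R * k%:R in tW *.
have t0 : 0 < t by rewrite mulr_gt0 // divr_gt0 // mulr2n addr_gt0 ?pi_gt0.
set E := \sum_(N1 <= n < N) _.
have an n : (N1 <= n)%N -> a <= n%:R by move=> h; apply: (le_trans aN1); rewrite ler_nat.
have w0 n : (N1 <= n)%N -> 0 <= w n by move=> /an; exact: (rg_weight_ge0 rg).
have W0 : 0 <= W by apply: le_trans (wW N1 _); [exact: w0|rewrite leqnn].
pose rem n := cis (t * alpha n%:R) * (cis (t * w n) - 1 - 'i%C * ((t * w n)%:C)%C).
have tel : 'i%C * (t%:C)%C * E = cis (t * alpha N%:R) - cis (t * alpha N1%:R) - \sum_(N1 <= n < N) rem n.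
  rewrite -(telescope_sumr (fun n => cis (t * alpha n%:R)) N1N) -sumrB mulr_sumr.
  apply: eq_bigr => n _; rewrite /rem.
  have -> : cis (t * alpha n.+1%:R) = cis (t * alpha n%:R) * cis (t * w n).
    by rewrite -cisD; congr cis; rewrite /rg_weight; ring.
  have -> : ((t * w n)%:C)%C = (t%:C)%C * ((w n)%:C)%C by rewrite rmorphM.
  by ring.
have ctP : cis (t * P%:R) = 1 :> R[i].
  rewrite -(cis_2pi_nat k); congr cis; rewrite /t; field; rewrite gt_eqF //.
have remb : normc (\sum_(N1 <= n < N) rem n) <= t * W * t * P%:R.
  apply: le_trans (ler_normc_sum _ _ _) _.
  apply: (@le_trans _ _ (\sum_(N1 <= n < N) (t * W * t) * w n)).
    apply: ler_sum_nat => n /andP[n1 n2]; rewrite /rem Normc.normcM normc_cis mul1r.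
    have wn0 := w0 n n1; have wnW : w n <= W by apply: wW; rewrite n1 ltnW.
    have twn : t * w n <= t * W by rewrite ler_pM2l.
    apply: le_trans (normc_cis_taylor _) _; first by rewrite mulr_ge0 ?(ltW t0) //= (le_trans twn).
    have -> : t * W * t * w n = (t * W) * (t * w n) by ring.
    by rewrite expr2 ler_wpM2r // mulr_ge0 // ltW.
  rewrite -mulr_sumr ler_wpM2l ?(mulr_ge0 (mulr_ge0 (ltW t0) W0) (ltW t0)) //.
  have -> : \sum_(N1 <= n < N) w n = alpha N%:R - alpha N1%:R.
    exact: (telescope_sumr (fun n => alpha n%:R) N1N).
  by have := rg_gt0 rg aN1; lra.
have : t * normc E <= t * (2 * (P%:R - alpha N%:R) + 2 * alpha N1%:R + pi *+ 2 * k%:R * W).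
  have -> : t * normc E = normc ('i%C * (t%:C)%C * E).
    by rewrite !Normc.normcM normc_real /= expr0n expr1n add0r sqrtr1 mul1r gtr0_norm.
  rewrite tel; apply: le_trans (le_normcD _ _) _; rewrite normcN.
  have -> : t * (2 * (P%:R - alpha N%:R) + 2 * alpha N1%:R + pi *+ 2 * k%:R * W) =
      (2 * (t * P%:R - t * alpha N%:R) + 2 * (t * alpha N1%:R)) + t * W * t * P%:R.
    rewrite -mulr_natr /t -[pi *+ 2]mulr_natr; field; rewrite gt_eqF //.
  apply: lerD remb.
  have -> : cis (t * alpha N%:R) - cis (t * alpha N1%:R) =
     - (cis (t * P%:R) - cis (t * alpha N%:R)) - (cis (t * alpha N1%:R) - cis 0) by rewrite ctP cis0; ring.
  apply: le_trans (le_normcD _ _) _; rewrite !normcN; apply: lerD.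
    apply: le_trans (normc_cisB _ _) _.
    by rewrite ger0_norm // -mulrBr mulr_ge0 ?(ltW t0) // subr_ge0.
  apply: le_trans (normc_cisB _ _) _.
  by rewrite subr0 ger0_norm // mulr_ge0 ?(ltW t0) // ltW // (rg_gt0 rg).
by rewrite ler_pM2l.
Qed.

Lemma rg_exponential_sums Q : (Q.+2 <= J)%N -> Q.+1%:R <= 3 * c ->
  exists2 C, 1 <= C & forall Z N N1 P : nat, C <= Z%:R -> a <= N1%:R -> (N1 <= N)%N ->
    (Q.+2 <= N)%N -> (0 < P)%N -> P%:R / Z%:R <= alpha N1%:R <= 2 `^ (2 * c) * (P%:R / Z%:R) ->
    alpha N%:R <= P%:R <= alpha N.+1%:R ->
    (Z ^ (2 ^ (Q + 4)) <= N)%N -> (2 * P * Z ^ weyl_expo Q <= N ^ Q.+1)%N ->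
    forall k, (1 <= k < 2 * P)%N ->
    normc (\sum_(N1 <= n < N) (w n)%:C%C * cis (pi *+ 2 / P%:R * k%:R * alpha n%:R)) <=
    C * (P%:R / Z%:R).
Proof.
move=> QJ Qc; move: (rg_a rg) (rg_K rg) c_gt0 => a1 K1 c0.
have [C0 C01 HC0] := rg_high_frequency rg c_gt0 QJ Qc.
have c2 : 0 < 2 `^ (2 * c) :> R by rewrite powR_gt0.
pose D := K * 2 `^ (2 * c).
have D0 : 0 < D by rewrite mulr_gt0 //; lra.
have pi4 : pi <= 4 :> R by have := @pihalf_lt2 R; lra.
have pi0 := @pi_gt0 R.
have DC0 : 0 <= D * C0 by exact: mulr_ge0 (ltW D0) (le_trans ler01 C01).
(* [2 D C0] serves the high frequencies. For the low ones, [10 D] collects 2 from the gap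
   [P - alpha N] and 8 from the quadratic error, and the last term comes from [alpha N1]. Moreover
   [8 D <= Z] makes the phase increments at most 1. *)
exists (C0 + 2 * D * C0 + 10 * D + 2 * 2 `^ (2 * c)) => [|Z N N1 P CZ aN1 N1N QN P0 /andP[aPZ aPZ2] /andP[aP Pa] ZN top k /andP[k0 kP]].
  lra.
have Z1 : 1 <= Z%:R :> R by lra.
have Z0 : 0 < Z%:R :> R by lra.
have P0' : 0 < P%:R :> R by rewrite ltr0n.
have N1' : N1%:R <= N%:R :> R by rewrite ler_nat.
have N0 : 0 < N%:R :> R by lra.
have ZN' : Z%:R <= N%:R :> R.
  rewrite ler_nat; apply: leq_trans ZN; rewrite -{1}(expn1 Z) leq_pexp2l ?expn_gt0 //.
  by rewrite -(ltr0n R).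
have wle n : (N1 <= n <= N)%N -> w n <= D * (P%:R / N%:R).
  move=> /andP[n1 n2]; have an : a <= n%:R by apply: (le_trans aN1); rewrite ler_nat.
  apply: le_trans (rg_weight_le rg c_gt0 J2 an n2) _.
  by rewrite ler_wpM2l ?(ltW D0) // ler_wpM2r ?invr_ge0 ?(ltW N0).
have PZ0 : 0 < P%:R / Z%:R :> R by rewrite divr_gt0.
case: (leqP (k * Z ^ 7) N) => kN; last first.
  apply: (@le_trans _ _ (2 * w N * (C0 * (N%:R / Z%:R)))).
    apply: normc_weighted_sum => //.
    - by rewrite mulr_ge0 ?divr_ge0 //; lra.
    - apply: (HC0 Z N N1 P k) => //; first by lra.
      by apply: leq_trans top; rewrite leq_mul2r ltnW ?orbT.
    - move=> n n1; apply: (rg_weight_ge0 rg c_gt0); apply: (le_trans aN1); by rewrite ler_nat.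
    - move=> n n1; apply: (rg_weight_homo rg c_gt0 J2); apply: (le_trans aN1); by rewrite ler_nat.
  apply: (@le_trans _ _ (2 * (D * (P%:R / N%:R)) * (C0 * (N%:R / Z%:R)))).
    by rewrite ler_wpM2r ?mulr_ge0 ?divr_ge0 //; [lra|rewrite ler_wpM2l // wle // N1N leqnn].
  have -> : 2 * (D * (P%:R / N%:R)) * (C0 * (N%:R / Z%:R)) = 2 * D * C0 * (P%:R / Z%:R).
    by field; rewrite !gt_eqF.
  by rewrite ler_wpM2r ?(ltW PZ0) //; lra.
have kZN : k%:R * Z%:R <= N%:R :> R.
  apply: (@le_trans _ _ (k * Z ^ 7)%:R); last by rewrite ler_nat.
  by rewrite natrM natrX ler_wpM2l // -{1}[Z%:R]expr1 ler_weXn2l.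
have kW : k%:R * (D * (P%:R / N%:R)) <= D * (P%:R / Z%:R).
  have -> : k%:R * (D * (P%:R / N%:R)) = (k%:R * Z%:R) / N%:R * (D * (P%:R / Z%:R)).
    by field; rewrite !gt_eqF.
  by rewrite ler_piMl ?(mulr_ge0 (ltW D0) (ltW PZ0)) // ler_pdivrMr // mul1r.
have t1 : pi *+ 2 / P%:R * k%:R * (D * (P%:R / N%:R)) <= 1.
  apply: (@le_trans _ _ (pi *+ 2 / P%:R * (D * (P%:R / Z%:R)))).
    by rewrite -mulrA ler_wpM2l // divr_ge0 ?(ltW P0') // mulr2n addr_ge0 // ltW.
  have -> : pi *+ 2 / P%:R * (D * (P%:R / Z%:R)) = (2 * pi) * D / Z%:R.
    by rewrite -mulr_natl; field; rewrite !gt_eqF.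
  rewrite ler_pdivrMr // mul1r; apply: (@le_trans _ _ (8 * D)); last by lra.
  by rewrite ler_wpM2r ?(ltW D0) //; lra.
apply: le_trans (rg_low_frequency Z aN1 N1N P0 k0 aP wle t1) _.
have Pd : P%:R - alpha N%:R <= D * (P%:R / Z%:R).
  apply: (@le_trans _ _ (w N)); first by rewrite /rg_weight lerD2r.
  apply: le_trans (wle N _) _; first by rewrite N1N leqnn.
  by rewrite ler_wpM2l ?(ltW D0) // ler_wpM2l ?(ltW P0') // lef_pV2 ?posrE.
have pk : pi *+ 2 * k%:R * (D * (P%:R / N%:R)) <= 8 * (D * (P%:R / Z%:R)).
  rewrite -mulrA; apply: ler_pM => //.
  - by rewrite mulr2n addr_ge0 // ltW.
  - exact: mulr_ge0 (ler0n _ _) (mulr_ge0 (ltW D0) (divr_ge0 (ltW P0') (ltW N0))).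
  - by rewrite -mulr_natr; lra.
have C0PZ : 0 <= (C0 + 2 * D * C0) * (P%:R / Z%:R) by rewrite mulr_ge0 ?(ltW PZ0) //; lra.
have -> : (C0 + 2 * D * C0 + 10 * D + 2 * 2 `^ (2 * c)) * (P%:R / Z%:R) =
  (C0 + 2 * D * C0) * (P%:R / Z%:R) + (2 * (D * (P%:R / Z%:R)) + 2 * (2 `^ (2 * c) * (P%:R / Z%:R)) + 8 * (D * (P%:R / Z%:R))) by ring.
lra.
Qed.

End AllFrequencies.

(** * Numerical conditions linking [M], [N], [Z] and [delta] *)

Section Thresholds.
Context {R : realType}.
Implicit Types (c x y : R) (M N P Z Q : nat).

Lemma delta_gt0 c : 0 < c -> 0 < delta c.
Proof. by move=> c0; rewrite divr_gt0 // mulr_gt0 // powR_gt0. Qed.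

(** [delta c] is made for this: [Q + 4 <= c + 5] and [delta c * 2^(c + 5)] equals [1 / (4 c)]. *)
Lemma delta_mul_pow2_le c Q : 1 <= c -> Q%:R <= c + 1 -> delta c * 2 ^+ (Q + 4) <= (4 * c)^-1.
Proof.
move=> c1 Qc; have c0 : 0 < c by lra.
have p8 : 0 < 2 `^ (c + 8) :> R by rewrite powR_gt0.
have h : 2 ^+ (Q + 4) <= 2 `^ (c + 5) :> R.
  by rewrite -powR_mulrn // ler_powR ?natrD //; lra.
have e : 2 `^ (c + 8) = 2 `^ (c + 5) * 8 :> R.
  have -> : c + 8 = c + 5 + 3%:R by ring.
  by rewrite powRD ?pnatr_eq0 ?implybT // powR_mulrn //; ring.
have p5 : 0 < 2 `^ (c + 5) :> R by rewrite powR_gt0.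
apply: (@le_trans _ _ (delta c * 2 `^ (c + 5))); first by rewrite ler_wpM2l // ltW // delta_gt0.
rewrite le_eqVlt; apply/orP; left; apply/eqP; rewrite /delta e; field.
by rewrite !gt_eqF.
Qed.

Lemma delta_le_half c : 1 <= c -> delta c <= 1 / 2.
Proof.
move=> c1; have h := @delta_mul_pow2_le c 0 c1 (ltac:(lra)).
have d0 := delta_gt0 (lt_le_trans ltr01 c1).
have : delta c * 1 <= delta c * 2 ^+ (0 + 4).
  by rewrite ler_wpM2l ?(ltW d0) // exprn_ege1 //; lra.
have : (4 * c)^-1 <= 4^-1 by rewrite lef_pV2 ?posrE //; lra.
by move=> *; lra.
Qed.

(** As [(c + 1/4) / (4 c) <= 5/16], the power [Z^(2^(Q + 4))] is at most [(2 N)^(5/16)], and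
    [weyl_expo Q <= 2^(Q + 4)]. So [2 P Z^(weyl_expo Q)] is at most a constant times [N^(c + 9/16)],
    which leaves [N^(7/16)] below [N^(c + 1)] for that constant. *)
Lemma size_thresholds c Q : 1 <= c -> c < Q%:R -> Q%:R <= c + 1 -> exists N0 : nat,
  forall M P N Z : nat, (N0 <= N)%N -> (0 < M)%N -> (M <= P)%N -> P%:R <= N.+1%:R `^ (c + 1 / 4) ->
    Z%:R <= M%:R `^ delta c -> (Z ^ (2 ^ (Q + 4)) <= N)%N /\ (2 * P * Z ^ weyl_expo Q <= N ^ Q.+1)%N.
Proof.
move=> c1 cQ Qc; have c0 : 0 < c by lra.
(* Chosen so that [N >= b] gives [2^(c + 25/16) <= N^(7/16)]; the exponent is [1 + (c + 9/16)], from
   [2 (2 N)^(c + 9/16)]. *)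
pose b : R := (2 `^ (c + 25 / 16)) `^ (16 / 7).
exists (maxn 2 (Num.truncn b).+1) => M P N Z; rewrite geq_max => /andP[N2 bN] M0 MP PN ZM.
have N2' : 2 <= N%:R :> R by rewrite ler_nat.
have bN' : b <= N%:R.
  by apply: le_trans (ltW (truncnS_gt b)) _; rewrite ler_nat.
set Y : R := 2 * N%:R; have Y1 : 1 <= Y by rewrite /Y; lra.
have Y0 : 0 < Y by lra.
have d0 := delta_gt0 c0.
have PY : P%:R <= Y `^ (c + 1 / 4).
  have NS : N.+1%:R = N%:R + 1 :> R by rewrite natr1.
  apply: (le_trans PN); rewrite NS; apply: ge0_ler_powR; rewrite ?nnegrE; [lra|lra|lra|].
  by rewrite /Y; lra.
have M0' : 0 < M%:R :> R by rewrite ltr0n.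
have MY : M%:R <= Y `^ (c + 1 / 4) by apply: le_trans PY; rewrite ler_nat.
have ZY : Z%:R ^+ (2 ^ (Q + 4)) <= Y `^ (5 / 16).
  apply: (@le_trans _ _ ((M%:R `^ delta c) ^+ (2 ^ (Q + 4)))).
    by rewrite lerXn2r ?nnegrE ?powR_ge0.
  rewrite -powR_mulrn ?powR_ge0 // -powRrM natrX.
  apply: (@le_trans _ _ ((Y `^ (c + 1 / 4)) `^ (delta c * 2 ^+ (Q + 4)))).
    have e0 : 0 <= delta c * 2 ^+ (Q + 4) by exact: mulr_ge0 (ltW d0) (exprn_ge0 _ (ler0n _ 2)).
    by apply: ge0_ler_powR; rewrite ?nnegrE ?powR_ge0.
  rewrite -powRrM ler_powR //.
  apply: (@le_trans _ _ ((c + 1 / 4) * (4 * c)^-1)).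
    by rewrite ler_wpM2l ?delta_mul_pow2_le //; lra.
  by rewrite ler_pdivrMr //; lra.
split.
  rewrite -(ler_nat R) natrX; apply: (le_trans ZY).
  apply: (@le_trans _ _ (Y `^ (2^-1))); first by rewrite ler_powR //; lra.
  rewrite -(@ler_pXn2r _ 2) ?nnegrE ?powR_ge0 // -powR_mulrn ?powR_ge0 // -powRrM mulVf // powRr1 ?(ltW Y0) //.
  by rewrite /Y expr2 ler_wpM2r.
rewrite -(ler_nat R) natrM !natrX (natrM _ 2 P).
have ZY' : Z%:R ^+ weyl_expo Q <= Y `^ (5 / 16).
  case: Z ZY {ZM} => [|Z] ZY; first by rewrite expr0n /weyl_expo addn_eq0 /= powR_ge0.
  apply: le_trans ZY; apply: ler_weXn2l; first by rewrite ler1n.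
  rewrite /weyl_expo addnC expnD expnS (_ : 2 ^ 4 = 16)%N //.
  have : (0 < 2 ^ Q)%N by rewrite expn_gt0.
  by move: (2 ^ Q)%N => u; clear; lia.
apply: (@le_trans _ _ (2 * Y `^ (c + 1 / 4) * Y `^ (5 / 16))).
  apply: (ler_pM _ _ _ ZY'); [exact: mulr_ge0|exact: exprn_ge0|].
  by rewrite ler_wpM2l.
have Y0' : Y == 0 = false by rewrite gt_eqF.
rewrite -mulrA -powRD ?Y0' ?implybT // /Y powRM //.
have N0 : 0 < N%:R :> R by lra.
have N0' : (N%:R == 0 :> R) = false by rewrite gt_eqF.
have -> : c + 1 / 4 + 5 / 16 = c + 9 / 16 by lra.
rewrite mulrA -{1}[2]powRr1 // -powRD ?pnatr_eq0 ?implybT //.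
have -> : 1 + (c + 9 / 16) = c + 25 / 16 by lra.
apply: (@le_trans _ _ (N%:R `^ (7 / 16) * N%:R `^ (c + 9 / 16))).
  rewrite ler_wpM2r ?powR_ge0 //.
  have -> : 2 `^ (c + 25 / 16) = b `^ (7 / 16).
    rewrite /b -powRrM; have -> : 16 / 7 * (7 / 16) = 1 :> R by field.
    by rewrite powRr1 ?powR_ge0.
  by apply: ge0_ler_powR; rewrite ?nnegrE ?powR_ge0.
rewrite -powRD ?N0' ?implybT // -powR_mulrn // ler_powR //; first by lra.
by rewrite -natr1; lra.
Qed.

Lemma powR_ge_threshold (d X0 : R) : 0 < d -> exists M0 : nat, forall M : nat, (M0 <= M)%N -> X0 <= M%:R `^ d.
Proof.
move=> d0; exists (Num.truncn (Num.max 1 X0 `^ d^-1)).+1 => M M0M.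
set x := Num.max 1 X0 in M0M.
have x0 : 0 <= x by rewrite le_max ler01.
apply: (@le_trans _ _ x); first by rewrite le_max lexx orbT.
have -> : x = (x `^ d^-1) `^ d by rewrite -powRrM mulVf ?gt_eqF // powRr1.
apply: ge0_ler_powR; rewrite ?nnegrE ?powR_ge0 ?(ltW d0) //.
by apply: le_trans (ltW (truncnS_gt _)) _; rewrite ler_nat.
Qed.

Lemma size_le_of_range (A : seq nat) M : uniq A -> (forall x : nat, x \in A -> (1 <= x <= M)%N) ->
  (size A <= M)%N.
Proof.
move=> uA AM; rewrite -(size_iota 1 M); apply: uniq_leq_size => // x /AM.
by rewrite mem_iota; lia.
Qed.

(** Relative to [P^2 M^2], the error has order [1 / X^2] and the main term [1 / X], so a large [X]
    wins. Halving both sets costs a factor 4 and a rounding error [5 M], at most half of [M^2 / X];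
    hence [8 X]. And [256 = 16 * 8 * 2], from [P / Z <= 8 M / X] and [T >= P / 2]. *)
Lemma density_estimate (C M X Z P T : R) (sA sB a b : nat) :
  0 < C -> 0 < M -> sA%:R <= M -> sB%:R <= M -> (sA <= 2 * a + 1)%N -> (sB <= 2 * b + 1)%N ->
  (a <= sA)%N -> (b <= sB)%N -> 1 <= M ->
  M ^+ 2 / X <= (sA * sB)%:R -> 10 * X <= M -> 8 * (256 * C) ^+ 2 < X ->
  X <= 2 * Z -> P <= 4 * M -> 0 < P -> P / 2 <= T ->
  (16 * P * (C * (P / Z))) ^+ 2 < T ^+ 2 * (a * b)%:R.
Proof.
move=> C0 M0 sAM sBM aA bB aA' bB' M1 dens XM XC XZ PM P0 PT.
have X0 : 0 < X by have := sqr_ge0 (256 * C); lra.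
have Z0 : 0 < Z by lra.
have aM : a%:R <= M by apply: le_trans sAM; rewrite ler_nat.
have bM : b%:R <= M by apply: le_trans sBM; rewrite ler_nat.
have ab : M ^+ 2 / (8 * X) <= (a * b)%:R.
  have h : (sA * sB)%:R <= 4 * (a * b)%:R + 5 * M.
    apply: (@le_trans _ _ ((2 * a + 1) * (2 * b + 1))%:R).
      by rewrite ler_nat leq_mul.
    have -> : ((2 * a + 1) * (2 * b + 1))%:R = 4 * (a * b)%:R + 2 * a%:R + 2 * b%:R + 1 :> R.
      by rewrite (natrM _ _ (2 * b + 1)) (natrD _ (2 * a) 1) (natrD _ (2 * b) 1) (natrM _ 2 a) (natrM _ 2 b) (natrM _ a b); ring.
    lra.
  have e : M ^+ 2 / X = 8 * (M ^+ 2 / (8 * X)) by field; rewrite gt_eqF.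
  have h2 : 10 * M <= M ^+ 2 / X.
    by rewrite ler_pdivlMr // expr2 mulrAC ler_wpM2r // ltW.
  lra.
have PZ : P / Z <= 8 * (M / X).
  rewrite ler_pdivrMr // mulrAC mulrA ler_pdivlMr //.
  apply: (@le_trans _ _ ((4 * M) * (2 * Z))); first by apply: ler_pM => //; exact: ltW.
  by rewrite le_eqVlt; apply/orP; left; apply/eqP; ring.
have PZ0 : 0 < P / Z by rewrite divr_gt0.
have MX0 : 0 < M / X by rewrite divr_gt0.
apply: (@lt_le_trans _ _ ((P / 2) ^+ 2 * (M ^+ 2 / (8 * X)))); last first.
  apply: ler_pM; rewrite ?sqr_ge0 ?divr_ge0 ?sqr_ge0 ?mulr_ge0 ?(ltW X0) //.
  by rewrite lerXn2r ?nnegrE //; lra.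
apply: (@le_lt_trans _ _ ((P / 2) ^+ 2 * ((256 * C) ^+ 2 * (M / X) ^+ 2))).
  have -> : (P / 2) ^+ 2 * ((256 * C) ^+ 2 * (M / X) ^+ 2) = (16 * P * (C * (8 * (M / X)))) ^+ 2 by field; rewrite gt_eqF.
  have P16 : 0 < 16 * P by rewrite mulr_gt0.
  have le1 : 16 * P * (C * (P / Z)) <= 16 * P * (C * (8 * (M / X))) by rewrite ler_pM2l // ler_pM2l.
  have ge1 : 0 <= 16 * P * (C * (P / Z)) by exact: mulr_ge0 (ltW P16) (mulr_ge0 (ltW C0) (ltW PZ0)).
  by rewrite lerXn2r ?nnegrE // (le_trans ge1).
rewrite ltr_pM2l ?exprn_gt0 ?divr_gt0 //.
have -> : (256 * C) ^+ 2 * (M / X) ^+ 2 = (8 * (256 * C) ^+ 2) * (M ^+ 2 / (8 * X ^+ 2)) by field; rewrite gt_eqF.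
have -> : M ^+ 2 / (8 * X) = X * (M ^+ 2 / (8 * X ^+ 2)) by field; rewrite gt_eqF.
by rewrite ltr_pM2r // divr_gt0 ?mulr_gt0 ?exprn_gt0.
Qed.

End Thresholds.

(** A zero limit would put the exponent 1 into the set whose infimum is the degree. *)
Lemma deg_gt1_div_cvg (R : realType) (c : R) (alpha : R -> R) : 1 < c -> deg alpha = c%:E ->
  alpha x / x ^+ 1 @[x --> +oo] --> (0 : R) \/ alpha x / x ^+ 1 @[x --> +oo] --> +oo ->
  alpha x / x @[x --> +oo] --> +oo.
Proof.
move=> c1 degc [h|//]; exfalso; have : c <= 1; last by lra.
apply: (deg_le degc); apply/cvgrPdist_le => e e0.
move/cvgrPdist_le: h => /(_ e e0) h; near=> x.
have x1 : 1 <= x by near: x; exact: near_pinfty_ge.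
have x0 : 0 < x by lra.
have : `|0 - alpha x / x ^+ 1| <= e by near: x.
by rewrite !sub0r !normrN expr1 powRr1 ?(ltW x0) // !normrM normr_id (@ger0_norm _ x^-1) // invr_ge0 ltW.
Unshelve. all: by end_near. Qed.

Theorem theorem1p18 (R : realType) (c : R) (alpha : R -> R)
    (c_ge1 : 1 <= c) (c_nint : c \isn't a Num.int)
    (alpha_hardy : hardy_field_function alpha)
    (alpha_deg : deg alpha = c%:E)
    (alpha_lim : forall l : nat, (0 < l)%N ->
       (alpha x / x ^+ l @[x --> +oo] --> (0 : R)) \/
       (alpha x / x ^+ l @[x --> +oo] --> +oo)) :
  exists M0 : nat, forall M : nat, (0 < M)%N -> (M0 <= M)%N ->
    forall A B : {fset nat},
      (forall x, x \in A -> (1 <= x <= M)%N) ->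
      (forall y, y \in B -> (1 <= y <= M)%N) ->
      M%:R ^+ 2 / M%:R `^ delta c <= (#|` A| * #|` B|)%:R :> R ->
      exists x y n : nat,
        [/\ x \in A, y \in B, x <> y, (0 < n)%N
          & (x + y)%:Z = Num.floor (alpha n%:R)].
Proof.
have le_P m : (m <= 2 * m + 2)%N by lia.
have c1 : 1 < c.
  rewrite lt_neqAle c_ge1 andbT; apply: contraNneq c_nint => <-; exact: int_num1.
have c0 : 0 < c by lra.
have ay := deg_gt1_div_cvg c1 alpha_deg (alpha_lim 1%N isT).
(* The least integer above [c]: all [k < 2 P] then satisfy the upper condition on [k] at [q = Q].
   Derivatives up to order [Q + 2] enter, the last one for the monotonicity of the differences of
   order [Q + 1]. *)
pose Q := (Num.truncn c).+1.
have /andP[tc cQ] := truncn_itv (ltW c0).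
have Qc : Q%:R <= c + 1 by rewrite /Q -natr1 lerD2r.
have Q3 : Q.+1%:R <= 3 * c by rewrite -natr1; lra.
have [a [K [eps rg]]] := hardy_regularity Q.+2 alpha_hardy c1 c_nint alpha_deg ay.
have a1 := rg_a rg; have K1 := rg_K rg.
have [C C1 expsum] := rg_exponential_sums rg c0 (isT : (2 <= Q.+2)%N) (leqnn Q.+2) Q3.
have [Nt thresholds] := size_thresholds c_ge1 cQ Qc.
have d0 := delta_gt0 c0; have d2 := delta_le_half c_ge1.
pose G : R := 2 `^ (2 * c); have G0 : 0 < G by rewrite powR_gt0.
pose n0 := (Num.truncn a).+1.
have an0 : a <= n0%:R by exact: ltW (truncnS_gt a).
have ag n : (n0 <= n)%N -> a <= n%:R by move=> h; apply: (le_trans an0); rewrite ler_nat.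
(* [n0] marks the range of the growth inequalities, [Nt] and [Q.+2] are required by the sum
   estimates, and [8 K G] makes the last weight at most [P / 8]. *)
pose N0 := maxn (maxn n0 Nt) (maxn Q.+2 (Num.truncn (8 * K * G)).+1).
have [M1 M1P] := powR_ge_threshold (2 * C + 16 * G + 16 + 8 * (256 * C) ^+ 2 + 1) d0.
(* Since [delta c <= 1 / 2], both this constant and [X] are at most [sqrt M], so their product is at
   most [M]. *)
have [M2 M2P] := powR_ge_threshold (10 + alpha n0%:R) (ltac:(lra) : (0 : R) < 1 / 2).
exists (maxn (maxn M1 M2) (Num.truncn (alpha N0%:R)).+1) => M M0.
rewrite !geq_max -andbA => /and3P[/M1P MX /M2P Mh MN] A B AM BM dens.
set X := M%:R `^ delta c in MX dens.
have M0' : 1 <= M%:R :> R by rewrite ler1n.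
have C2 : 0 <= (256 * C) ^+ 2 by rewrite sqr_ge0.
have C0 : 0 < C by clear -C1; lra.
have XC : 8 * (256 * C) ^+ 2 < X by clear -MX C0 G0; lra.
have XZ0 : 2 * C + 16 * G + 16 <= X by clear -MX C2; lra.
have X0 : 0 < X by clear -XZ0 C0 G0; lra.
pose Z := Num.truncn X; have /andP[ZX XZ] := truncn_itv (ltW X0); rewrite -/Z -natr1 in ZX XZ.
have [ZC ZG Z8] : [/\ C <= Z%:R, 8 * G <= Z%:R & 8 <= Z%:R :> R].
  by clear -XZ0 XZ C0 C1 G0; split; lra.
have Z1 : 1 <= Z%:R :> R by clear -Z8; lra.
have Z0 : 0 < Z%:R :> R by clear -Z8; lra.
pose P := (2 * M + 2)%N; have P0 : (0 < P)%N by rewrite /P addn2.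
have PE : P%:R = 2 * M%:R + 2 :> R by rewrite /P (natrD _ (2 * M) 2) (natrM _ 2 M).
have P0' : 0 < P%:R :> R by rewrite ltr0n.
have alpha_n0' : 0 < alpha n0%:R by exact: (rg_gt0 rg an0).
have XM : (10 + alpha n0%:R) * X <= M%:R.
  have M12 : M%:R = M%:R `^ (1 / 2) * M%:R `^ (1 / 2) :> R.
    by rewrite -powRD ?gt_eqF ?ltr0n ?implybT // -[LHS]powRr1 ?ler0n //; congr (_ `^ _); clear; lra.
  rewrite [leRHS]M12; apply: ler_pM => //; [by clear -alpha_n0' ; lra|exact: ltW|].
  by rewrite ler_powR.
have XM10 : 10 * X <= M%:R.
  by apply: le_trans XM; rewrite ler_wpM2r ?(ltW X0) //; clear -alpha_n0'; lra.
have aX : alpha n0%:R * X <= M%:R.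
  by apply: le_trans XM; rewrite ler_wpM2r ?(ltW X0) //; clear -alpha_n0'; lra.
have aN0P : alpha N0%:R <= P%:R.
  apply: (le_trans (ltW (truncnS_gt _))); rewrite ler_nat; apply: (leq_trans MN).
  exact: le_P.
have n0N0 : (n0 <= N0)%N by rewrite /N0 !leq_max leqnn.
have exN : exists n, (n0 <= n)%N && (alpha n%:R <= P%:R) by exists N0; rewrite n0N0.
have bdN n : (n0 <= n)%N && (alpha n%:R <= P%:R) -> (n <= P)%N.
  by move=> /andP[/ag an aP]; rewrite -(ler_nat R); apply: le_trans (rg_ge rg an) aP.
case: (ex_maxnP exN bdN) => N /andP[n0N aNP] Nmax.
have N0N : (N0 <= N)%N by apply: Nmax; rewrite n0N0.
have aPN : P%:R < alpha N.+1%:R.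
  rewrite ltNge; apply/negP => h; have := Nmax N.+1; rewrite h (leq_trans n0N (leqnSn N)) /=.
  by move=> /(_ isT); rewrite ltnn.
have [NtN QN KN] : [/\ (Nt <= N)%N, (Q.+2 <= N)%N & 8 * K * G <= N%:R].
  move: N0N; rewrite /N0 !geq_max => /andP[/andP[_ ?] /andP[? h]]; split => //.
  by apply: le_trans (ltW (truncnS_gt _)) _; rewrite ler_nat.
have aN : a <= N%:R by exact: ag.
have N0' : 0 < N%:R :> R by clear -aN a1; lra.
have Pd : P%:R - alpha N%:R <= P%:R / 8.
  apply: (@le_trans _ _ (rg_weight alpha N)); first by rewrite /rg_weight lerD2r ltW.
  apply: le_trans (rg_weight_le rg c0 (isT : (2 <= Q.+2)%N) aN (leqnn N)) _.
  rewrite -/G mulrA ler_pdivrMr // [leRHS]mulrAC ler_pdivlMr //.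
  have h1 : 8 * K * G * alpha N%:R <= N%:R * alpha N%:R.
    by rewrite ler_wpM2r // ltW // (rg_gt0 rg).
  have h2 : N%:R * alpha N%:R <= N%:R * P%:R by rewrite ler_wpM2l.
  by rewrite [P%:R * _]mulrC; apply: le_trans (le_trans h1 h2); rewrite le_eqVlt; apply/orP; left; apply/eqP; ring.
have PZ8 : P%:R / Z%:R <= P%:R / 8 :> R by rewrite ler_wpM2l ?(ltW P0') // lef_pV2 ?posrE.
have aPZN : P%:R / Z%:R <= alpha N%:R by clear -Pd PZ8 P0'; lra.
have ex1 : exists n, (n0 <= n)%N && (P%:R / Z%:R <= alpha n%:R).
  by exists N; rewrite n0N.
(* The predecessor of [N1] still lies in the regular range, as [alpha n0 < P / Z], and has value at
   most [P / Z]; doubling then bounds [alpha N1]. *)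
case: (ex_minnP ex1) => N1 /andP[n0N1 aPZ] N1min.
have N1N : (N1 <= N)%N by apply: N1min; rewrite n0N.
have aN1 : a <= N1%:R by exact: ag.
have an0PZ : alpha n0%:R < P%:R / Z%:R.
  rewrite ltr_pdivlMr //; apply: (@le_lt_trans _ _ (alpha n0%:R * X)); last by clear -aX PE M0'; lra.
  by rewrite ler_wpM2l // ltW // (rg_gt0 rg).
have N1n0 : (n0 < N1)%N.
  rewrite ltn_neqAle n0N1 andbT; apply/eqP => E.
  by move: aPZ; rewrite -E leNgt an0PZ.
have aN1PZ : alpha N1%:R <= G * (P%:R / Z%:R).
  have [m mE] : exists m, N1 = m.+1 by exists N1.-1; rewrite prednK // (leq_ltn_trans _ N1n0).
  have n0m : (n0 <= m)%N by rewrite mE ltnS in N1n0.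
  have am := ag m n0m.
  have amP : alpha m%:R <= P%:R / Z%:R.
    rewrite leNgt; apply/negP => /ltW h; have := N1min m; rewrite n0m h mE => /(_ isT).
    by rewrite ltnn.
  apply: (@le_trans _ _ (G * alpha m%:R)); last by rewrite ler_wpM2l // ltW.
  have mS : N1%:R = m%:R + 1 :> R by rewrite mE natr1.
  by apply: (rg_double rg c0 am); rewrite mS; clear -am a1; lra.
have [ZN top] : (Z ^ (2 ^ (Q + 4)) <= N)%N /\ (2 * P * Z ^ weyl_expo Q <= N ^ Q.+1)%N.
  apply: (thresholds M P N Z NtN M0 (le_P M) _ ZX).
  apply: ltW; apply: (lt_le_trans aPN); apply: (rg_le rg).
  by apply: (le_trans aN); rewrite ler_nat.
have GPZ : G * (P%:R / Z%:R) <= P%:R / 8.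
  rewrite mulrA ler_pdivrMr // [leRHS]mulrAC ler_pdivlMr //.
  have : 8 * G * P%:R <= Z%:R * P%:R by rewrite ler_wpM2r // ltW.
  by rewrite [P%:R * _]mulrC; apply: le_trans; rewrite le_eqVlt; apply/orP; left; apply/eqP; ring.
have esum := expsum Z N N1 P ZC aN1 N1N QN P0 _ _ ZN top.
have {}esum := esum (ltac:(by rewrite aPZ)) (ltac:(by rewrite aNP ltW)).
have Tsum : \sum_(N1 <= n < N) rg_weight alpha n = alpha N%:R - alpha N1%:R.
  exact: (telescope_sumr (fun n => alpha n%:R) N1N).
have [A' [B' [uA uB subA subB [disj sA sB]]]] := disjoint_halves (fset_uniq A) (fset_uniq B).
have AM' x : x \in A' -> (1 <= x <= M)%N by move=> /subA; exact: AM.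
have BM' x : x \in B' -> (1 <= x <= M)%N by move=> /subB; exact: BM.
have szA : (size (enum_fset A) <= M)%N by apply: size_le_of_range (fset_uniq A) _ => x; exact: AM.
have szB : (size (enum_fset B) <= M)%N by apply: size_le_of_range (fset_uniq B) _ => x; exact: BM.
(* The total weight [alpha N - alpha N1] misses [P] by at most [P / 8] at each end, so it exceeds
   [P / 2]. *)
have final : (16 * P%:R * (C * (P%:R / Z%:R))) ^+ 2 <
    (\sum_(N1 <= n < N) rg_weight alpha n) ^+ 2 * (size A' * size B')%:R.
  rewrite Tsum; apply: (density_estimate (X := X) (M := M%:R) C0 _ _ _ sA sB) => //.
  - by rewrite ltr0n.
  - by rewrite ler_nat.
  - by rewrite ler_nat.
  - exact: uniq_leq_size.
  - exact: uniq_leq_size.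
  - by clear -XZ Z1; lra.
  - by clear -PE M0'; lra.
  - by clear -Pd aN1PZ GPZ P0'; lra.
have [||n [x [y [nn xA yB xy]]]] := sumset_hits (erefl P) uA uB AM' BM' _ _ esum final.
- move=> n /andP[n1 n2]; have an : a <= n%:R by apply: (le_trans aN1); rewrite ler_nat.
  rewrite (rg_weight_ge0 rg c0) //; split => //; rewrite (ltW (rg_gt0 rg an)) /=.
  by apply: le_trans aNP; apply: (rg_homo rg c0) => //; rewrite ler_nat ltnW.
- by rewrite mulr_ge0 ?divr_ge0 // ltW.
exists x, y, n; split.
- exact: subA.
- exact: subB.
- by move=> E; apply: (disj x) => //; rewrite E.
- by move: nn => /andP[n1 _]; apply: leq_trans n1; apply: leq_trans n0N1.
by apply/esym/floor_def; rewrite intrD /=; move: xy.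
Qed.
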